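(* The satisfiability problem of $\mathrm{GRA}(e,p,s,\neg,J,\exists)$ is $\textsc{NP}$-complete.
   Context: AD-relations. $A^0=\{\epsilon\}$, with $\epsilon$ the empty tuple. A $k$-ary AD-relation over a set $A$ is a pair $(R,k)$ with $R\subseteq A^k$, $k\ge 0$; $t\in(R,k)$ means $t\in R$. Vocabularies contain only relation symbols (of any arity $k\ge 0$, countably infinitely many available for each arity). Models have nonempty domains; $A$ is the domain of $\mathfrak{A}$. Terms. $\mathrm{GRA}(e,p,s,\neg,J,\exists)$ is the set of terms built from relation symbols and the constant $e$ by the unary operators $p,s,\neg,\exists$ and the binary operator $J$. Each term $\mathcal{T}$ defines in each model $\mathfrak{A}$ an AD-relation $\mathcal{T}^{\mathfrak{A}}$ of arity $\mathit{ar}(\mathcal{T})$. Let $k=\mathit{ar}(\mathcal{T})$, $\ell=\mathit{ar}(\mathcal{S})$. - $R^{\mathfrak{A}}$ is the interpretation of $R$, paired with the arity of $R$; $e^{\mathfrak{A}}=(\{(a,a)\mid a\in A\},2)$. - If $k\ge2$: $(p\mathcal{T})^{\mathfrak{A}}=(\{(a_k,a_1,\dots,a_{k-1})\mid(a_1,\dots,a_k)\in\mathcal{T}^{\mathfrak{A}}\},k)$ and $(s\mathcal{T})^{\mathfrak{A}}=(\{(a_1,\dots,a_{k-2},a_k,a_{k-1})\mid(a_1,\dots,a_k)\in\mathcal{T}^{\mathfrak{A}}\},k)$; if $k\le1$ both equal $\mathcal{T}^{\mathfrak{A}}$. - $(\neg\mathcal{T})^{\mathfrak{A}}=(\{t\in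 A^k\mid t\notin\mathcal{T}^{\mathfrak{A}}\},k)$. - $(J(\mathcal{T},\mathcal{S}))^{\mathfrak{A}}=(\{(a_1,\dots,a_k,b_1,\dots,b_\ell)\mid(a_1,\dots,a_k)\in\mathcal{T}^{\mathfrak{A}},(b_1,\dots,b_\ell)\in\mathcal{S}^{\mathfrak{A}}\},k+\ell)$. - If $k\ge1$: $(\exists\mathcal{T})^{\mathfrak{A}}=(\{(a_1,\dots,a_{k-1})\mid(a_1,\dots,a_k)\in\mathcal{T}^{\mathfrak{A}}\text{ for some }a_k\in A\},k-1)$; if $k=0$: $(\exists\mathcal{T})^{\mathfrak{A}}=\mathcal{T}^{\mathfrak{A}}$. Satisfiability problem for a set $\mathcal{G}$ of terms: on input $\mathcal{T}\in\mathcal{G}$, answer yes iff there exists a model $\mathfrak{A}$ such that $\mathcal{T}^{\mathfrak{A}}$ is not the empty AD-relation $(\varnothing,\mathit{ar}(\mathcal{T}))$. *)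

(* Defs.v *)
From HB Require Import structures.
From mathcomp Require Import all_boot all_algebra.

Set Implicit Arguments.
Unset Strict Implicit.
Unset Printing Implicit Defensive.

(******************************************************************************)
(*                          AD-relations and terms                            *)
(******************************************************************************)

Record adrel (A : Type) := ADrel {
  ad_arity : nat;
  ad_rel : ad_arity.-tuple A -> Prop
}.

Definition ad_eq (A : Type) : adrel A :=
  @ADrel A 2 (fun x => exists a : A, x = [tuple a; a]).

(* rotr 1 (a_1, ..., a_k) = (a_k, a_1, ..., a_(k-1)); it is the identity when *)
(* k <= 1.                                                                    *)
Definition ad_perm (A : Type) (r : adrel A) : adrel A :=
  @ADrel A (ad_arity r)
    (fun x => exists2 y, ad_rel (a := r) y & tval x = rotr 1 y).

(* The identity on sequences of size at most 1. *)
Definition swap_last (A : Type) (s : seq A) : seq A :=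
  if rev s is a :: b :: s' then rev (b :: a :: s') else s.

Definition ad_swap (A : Type) (r : adrel A) : adrel A :=
  @ADrel A (ad_arity r)
    (fun x => exists2 y, ad_rel (a := r) y & tval x = swap_last y).

Definition ad_neg (A : Type) (r : adrel A) : adrel A :=
  @ADrel A (ad_arity r) (fun x => ~ ad_rel x).

Definition ad_join (A : Type) (r s : adrel A) : adrel A :=
  @ADrel A (ad_arity r + ad_arity s)
    (fun x => exists y z,
       [/\ ad_rel (a := r) y, ad_rel (a := s) z & tval x = y ++ z]).

(* When the arity is 0, x and y are both the empty tuple and the relation is  *)
(* unchanged.                                                                 *)
Definition ad_ex (A : Type) (r : adrel A) : adrel A :=
  @ADrel A (ad_arity r).-1
    (fun x => exists2 y, ad_rel (a := r) y & tval x = take (ad_arity r).-1 y).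

(* Rel k w is the k-ary relation symbol with name w. *)
Inductive term :=
  | Rel of nat & seq bool
  | Equ
  | Perm of term
  | Swap of term
  | Neg of term
  | Join of term & term
  | Ex of term.

(* A model interprets every relation symbol; those not occurring in a term do *)
(* not affect its value.                                                      *)
Record model := Model {
  dom : Type;
  dom_inhabited : inhabited dom;
  interp : forall k : nat, seq bool -> k.-tuple dom -> Prop
}.

Fixpoint value (m : model) (t : term) : adrel (dom m) :=
  match t with
  | Rel k w => ADrel (@interp m k w)
  | Equ => ad_eq (dom m)
  | Perm t => ad_perm (value m t)
  | Swap t => ad_swap (value m t)
  | Neg t => ad_neg (value m t)
  | Join t u => ad_join (value m t) (value m u)
  | Ex t => ad_ex (value m t)
  end.

Definition satisfiable (t : term) : Prop :=
  exists m : model, exists x, ad_rel (a := value m t) x.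

(******************************************************************************)
(*                        Terms as input strings                              *)
(******************************************************************************)

Inductive token :=
  tRel | tArity | tBit0 | tBit1 | tEnd | tEqu | tPerm | tSwap | tNeg | tJoin
| tEx.

Definition tokens : seq token :=
  [:: tRel; tArity; tBit0; tBit1; tEnd; tEqu; tPerm; tSwap; tNeg; tJoin; tEx].

Definition token_code (c : token) : 'I_11 :=
  inord match c with
  | tRel => 0 | tArity => 1 | tBit0 => 2 | tBit1 => 3 | tEnd => 4 | tEqu => 5
  | tPerm => 6 | tSwap => 7 | tNeg => 8 | tJoin => 9 | tEx => 10
  end.

Definition token_decode (i : 'I_11) : token := nth tRel tokens i.

Lemma token_codeK : cancel token_code token_decode.
Proof. by case; rewrite /token_decode inordK. Qed.

#[warning="-redundant-canonical-projection"]
HB.instance Definition _ := Finite.copy token (can_type token_codeK).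

(* Polish notation. The k-ary symbol with name w is written with k in unary,  *)
(* like an atom R(x_1, ..., x_k) that lists its k arguments.                  *)
Fixpoint encode (t : term) : seq token :=
  match t with
  | Rel k w => tRel :: nseq k tArity
                 ++ [seq (if b then tBit1 else tBit0) | b <- w] ++ [:: tEnd]
  | Equ => [:: tEqu]
  | Perm t => tPerm :: encode t
  | Swap t => tSwap :: encode t
  | Neg t => tNeg :: encode t
  | Join t u => tJoin :: encode t ++ encode u
  | Ex t => tEx :: encode t
  end.

Lemma encode_prefix t u r r' :
  encode t ++ r = encode u ++ r' -> t = u /\ r = r'.
Proof.
elim: t u r r' => [k w||t IH|t IH|t IH|t1 IH1 t2 IH2|t IH]
                  [k' w'||u|u|u|u1 u2|u] r r' //=.
- case; rewrite -!catA; elim: k k' => [|k IHk] [|k'] /=.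
  + elim: w w' => [|[] w IHw] [|[] w'] //=; first by case.
    * by case=> /IHw[[->] ->].
    * by case=> /IHw[[->] ->].
  + by case: w => [|[] w].
  + by case: w' IHk => [|[] w'].
  + by case=> /IHk[[ek ew] ->]; rewrite ek ew.
- by case.
- by case=> /IH[-> ->].
- by case=> /IH[-> ->].
- by case=> /IH[-> ->].
- by case; rewrite -!catA => /IH1[-> /IH2[-> ->]].
- by case=> /IH[-> ->].
Qed.

Lemma encode_inj : injective encode.
Proof.
by move=> t u tu; have [] : t = u /\ [::] = [::] :> seq token
  by apply: encode_prefix; rewrite tu.
Qed.

Definition gra_sat (s : seq token) : Prop :=
  exists2 t : term, s = encode t & satisfiable t.

(******************************************************************************)
(*           Multitape nondeterministic Turing machines and NP                *)
(******************************************************************************)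

(* A head movement: None stays, Some false goes left, Some true goes right.   *)
Definition move := option bool.

(* The tape alphabet is option symbol, None being the blank. A machine halts  *)
(* when no transition applies.                                                *)
Record machine := Machine {
  state : finType;
  symbol : finType;
  last_tape : nat;
  start : state;
  accepting : {set state};
  delta : state -> {ffun 'I_last_tape.+1 -> option symbol} ->
          {set state * {ffun 'I_last_tape.+1 -> option symbol * move}}
}.

Definition deterministic (M : machine) : Prop :=
  forall q a, #|@delta M q a| <= 1.

(* (l, r) is the two-way infinite tape ... blank (rev l) r blank ...; the     *)
(* head is on the first cell of r, or on a blank if r is empty.               *)
Definition tape (X : Type) : Type := (seq (option X) * seq (option X))%type.

Definition tape_read (X : Type) (t : tape X) : option X := head None t.2.

Definition tape_write (X : Type) (t : tape X) (a : option X) : tape X :=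
  (t.1, a :: behead t.2).

Definition tape_move (X : Type) (t : tape X) (d : move) : tape X :=
  match d with
  | None => t
  | Some false => (behead t.1, head None t.1 :: t.2)
  | Some true => (tape_read t :: t.1, behead t.2)
  end.

(* The word that extends from the head to the first blank. *)
Fixpoint nonblank_prefix (X : Type) (r : seq (option X)) : seq X :=
  if r is Some a :: r' then a :: nonblank_prefix r' else [::].

Definition tape_word (X : Type) (t : tape X) : seq X := nonblank_prefix t.2.

Definition config (M : machine) : Type :=
  (state M * {ffun 'I_(last_tape M).+1 -> tape (symbol M)})%type.

Definition init (M : machine) (w : seq (symbol M)) : config M :=
  (start M, [ffun i => if i == ord0 then ([::], map Some w) else ([::], [::])]).

Definition transitions (M : machine) (c : config M) :=
  @delta M c.1 [ffun i => tape_read (c.2 i)].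

Definition step (M : machine) (c c' : config M) : Prop :=
  exists2 act, act \in transitions c &
    c' = (act.1,
          [ffun i => tape_move (tape_write (c.2 i) (act.2 i).1) (act.2 i).2]).

Fixpoint reach (M : machine) (n : nat) (c c' : config M) : Prop :=
  if n is n'.+1 then exists2 d, step c d & reach n' d c' else c = c'.

Definition halted (M : machine) (c : config M) : Prop := transitions c = set0.

Definition accepts (M : machine) (w : seq (symbol M)) : Prop :=
  exists n c, [/\ reach n (init w) c, halted c & c.1 \in accepting M].

Definition runs_within (M : machine) (w : seq (symbol M)) (T : nat) : Prop :=
  forall n c, reach n (init w) c -> n <= T.

(* The output is read on the last tape. *)
Definition outputs (M : machine) (w v : seq (symbol M)) : Prop :=
  exists n c, [/\ reach n (init w) c, halted c & tape_word (c.2 ord_max) = v].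

(* Below, i and o embed the input and output alphabets in the tape alphabet.  *)

Definition in_NP (X : finType) (L : seq X -> Prop) : Prop :=
  exists (M : machine) (i : X -> symbol M) (p : {poly nat}),
    [/\ injective i,
        forall w, runs_within (map i w) p.[size w]%R
      & forall w, L w <-> accepts (map i w)].

Definition polytime (X Y : finType) (f : seq X -> seq Y) : Prop :=
  exists (M : machine) (i : X -> symbol M) (o : Y -> symbol M) (p : {poly nat}),
    [/\ deterministic M, injective i, injective o,
        forall w, runs_within (map i w) p.[size w]%R
      & forall w, outputs (map i w) (map o (f w))].

Definition reduces (X Y : finType) (L : seq X -> Prop) (K : seq Y -> Prop) :=
  exists2 f : seq X -> seq Y, polytime f & forall w, L w <-> K (f w).

Definition NP_complete (Y : finType) (K : seq Y -> Prop) : Prop :=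
  in_NP K /\ forall (X : finType) (L : seq X -> Prop), in_NP L -> reduces L K.

(* Main.v *)
(* Since no variable occurs in two atoms of a term, the quantifiers can be    *)
(* pushed down to the literals, so that a term or its negation becomes a      *)
(* positive Boolean combination of literals, each with a quantifier prefix.   *)
(* Guessing a disjunct at each disjunction leaves a set of literals. After    *)
(* Skolemization these are unit clauses, and over an infinite domain they are *)
(* satisfiable iff no positive one unifies with a negative one; equality only *)
(* depends on whether the domain is a singleton. Unification fails iff two    *)
(* Skolem terms clash or there is a cycle of length two, because the          *)
(* dependencies within each literal are nested. For a model, take the natural *)
(* numbers and play each existential variable above all earlier ones, with a  *)
(* parity that tells positive literals from negative ones.                    *)
(*                                                                            *)
(* Hardness is the Cook-Levin theorem with relation symbols of arity 0 as     *)
(* propositional variables. Tape cells are numbered relatively to the head,   *)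
(* so that a step only shifts and updates them.                               *)
(*                                                                            *)
(* Both algorithms are functions on data coded as binary trees. The class of  *)
(* functions that programs on a stack of trees compute in polynomial time is  *)
(* closed under composition, case analysis and bounded iteration; such        *)
(* programs run on a machine with four stacks, hence on a multitape machine.  *)

From HB Require Import structures.
From mathcomp Require Import all_boot all_algebra.
From mathcomp Require Import zify.
From Stdlib Require Import Classical.
Require Import Defs.

Set Implicit Arguments.
Unset Strict Implicit.
Unset Printing Implicit Defensive.

(** Membership in NP rests on [satisfiable_consistent]. A [Join] splits its list of free variables
    in two, so its arguments depend on disjoint sets of variables, and a quantifier prefix
    distributes over their conjunction ([Q_and]) and over their disjunction ([Q_or]). By induction
    ([Sel_sem]), a term is satisfiable iff one can choose an argument at each [Join] of negative
    polarity so that the remaining literals hold in one model, each on its own under a common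
    prefix.

    Such a literal is a game along the prefix. Suppose that two opposite literals with the same
    symbol hold. If winning plays for both could be made to agree on all arguments, one tuple would
    be both in and out of the relation. Playing the two strategies against each other
    ([playing_finish]) reaches agreement unless two existential variables are matched, or each play
    waits for an existential move that the other has yet to make. Conversely, when every opposite
    pair has such an obstacle, a model on the natural numbers exists ([play_model_sound]):
    existential moves exceed all earlier values and have the parity of the sign, so matched
    existential variables differ in parity and mutual waiting would give a strict cycle. Equality
    literals only need the inner variable to be existential; one-element domains are a separate
    case. The criterion inspects literals and pairs of literals, and the choices take one bit per
    node of the term, so [verify] checks them from one guessed bit per input token ([verifyP]).

    For hardness, nullary relation symbols describe an accepting computation as a set of clauses
    ([tableau_sound], [tableau_complete]), and [cnf_satisfiable] turns clauses into a term.

    Polynomial time is handled by the predicate [pt] on functions between types coded as trees. It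
    is closed under composition, case analysis and iteration with polynomially bounded intermediate
    values ([pt_iter_spine]); [polytime_of_pt] and [in_NP_of_pt] carry it over to Turing
    machines. *)

(** * Simulation of stack machines by Turing machines *)

Section StackMachine.

Variable G : finType.

Definition stacks := {ffun 'I_4 -> seq G}.

Definition upd (s : stacks) (i : 'I_4) (u : seq G) : stacks :=
  [ffun j => if j == i then u else s j].

Inductive sop := Nop | OPush of 'I_4 & G | OPop of 'I_4.

Definition do_op (o : sop) (s : stacks) : stacks :=
  match o with
  | Nop => s
  | OPush i a => upd s i (a :: s i)
  | OPop i => upd s i (behead (s i))
  end.

Definition tops (s : stacks) : {ffun 'I_4 -> option G} :=
  [ffun i => ohead (s i)].

(* A state without successor is an exit. *)
Record smachine := SMachine {
  sm_state : finType;
  sm_start : sm_state;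
  sm_next : sm_state -> {ffun 'I_4 -> option G} -> option (sm_state * sop)
}.

Inductive sm_run (M : smachine) :
    sm_state M -> stacks -> nat -> sm_state M -> stacks -> Prop :=
| SmRun0 q s : sm_run q s 0 q s
| SmRunS q s q1 o n q2 s2 : sm_next q (tops s) = Some (q1, o) ->
    sm_run q1 (do_op o s) n q2 s2 -> sm_run q s n.+1 q2 s2.

Definition sm_halts (M : smachine) (s : stacks) (n : nat) (s' : stacks) :=
  exists q k, [/\ k <= n, sm_run (sm_start M) s k q s'
    & sm_next q (tops s') = None].

Lemma sm_run_cat (M : smachine) (q q1 q2 : sm_state M) s s1 s2 m n :
  sm_run q s m q1 s1 -> sm_run q1 s1 n q2 s2 -> sm_run q s (m + n) q2 s2.
Proof.
by move=> r1 r2; elim: r1 r2 => // {}q {}s q' o k q'' s'' e _ IH /IH;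
  apply: SmRunS.
Qed.

End StackMachine.

Lemma reach_cat (M : machine) m n (c d e : config M) :
  reach m c d -> reach n d e -> reach (m + n) c e.
Proof.
by elim: m c => [|m IH] c /= => [->|[c' cc' /IH r /r]] //; exists c'.
Qed.

Definition dstep (M : machine) (c d : config M) : Prop :=
  exists2 act, transitions c = [set act] &
    d = (act.1, [ffun i => tape_move (tape_write (c.2 i) (act.2 i).1) (act.2 i).2]).

Fixpoint dreach (M : machine) n (c d : config M) : Prop :=
  if n is n'.+1 then exists2 e, dstep c e & dreach n' e d else c = d.

Lemma dreach_cat (M : machine) m n (c d e : config M) :
  dreach m c d -> dreach n d e -> dreach (m + n) c e.
Proof.
by elim: m c => [|m IH] c /= => [->|[c' cc' /IH r /r]] //; exists c'.
Qed.

Lemma dreach_reach (M : machine) n (c d : config M) :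
  dreach n c d -> reach n c d.
Proof.
elim: n c => //= n IH c [e [act ta ->] /IH r].
by eexists; last exact: r; exists act => //; rewrite ta set11.
Qed.

(** Along the first run every configuration has a single transition, so any other run from [c] is an
    initial segment of it. One exhibited run thus yields both the time bound and the only possible
    outcome. *)
Lemma dreach_halted (M : machine) n m (c d e : config M) :
  dreach n c d -> halted d -> reach m c e -> m <= n /\ (halted e -> e = d).
Proof.
move=> cd hd; elim: n m c cd => [|n IH] [|m] c /=.
- by move=> -> <-.
- by move=> -> [x [act]]; rewrite hd in_set0.
- by move=> [x [act tc _] _] <-; rewrite /halted tc; split=> // /setP/(_ act);
    rewrite set11 in_set0.
- move=> [x [act tc xE] xd] [y [act']]; rewrite tc in_set1 => /eqP -> ->.
  by rewrite -xE => /(IH _ _ xd).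
Qed.

Section Simulation.

Variables (X G : finType) (M : smachine G) (ann : X -> {set G}) (one : G).

Let sym := (X + G)%type.
(* inr None copies the annotated input to stack 0; inr (Some b) is final. A   *)
(* push moves the head first, then writes the symbol that is kept in the      *)
(* state.                                                                     *)
Let st := ((sm_state M * option ('I_4 * G)) + option bool)%type.

Definition stack_top (a : option sym) : option G :=
  if a is Some (inr g) then Some g else None.

Definition stack_tops (a : {ffun 'I_5 -> option sym}) :
    {ffun 'I_4 -> option G} :=
  [ffun i => stack_top (a (lift ord0 i))].

Definition act_on (a : {ffun 'I_5 -> option sym}) (i : 'I_5)
    (x : option sym * move) : {ffun 'I_5 -> option sym * move} :=
  [ffun j => if j == i then x else (a j, None)].

Definition copy_act (a : {ffun 'I_5 -> option sym}) (g : G) :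
    {ffun 'I_5 -> option sym * move} :=
  [ffun j => if j == ord0 then (a j, Some true)
             else if j == lift ord0 ord0 then (Some (inr g), Some false)
             else (a j, None)].

Definition op_act (a : {ffun 'I_5 -> option sym}) (q : sm_state M) (o : sop G) :
    st * {ffun 'I_5 -> option sym * move} :=
  match o with
  | Nop => (inl (q, None), [ffun j => (a j, None)])
  | OPush i g => (inl (q, Some (i, g)),
                  act_on a (lift ord0 i) (a (lift ord0 i), Some false))
  | OPop i => (inl (q, None), act_on a (lift ord0 i) (None, Some true))
  end.

Definition tm_delta (q : st) (a : {ffun 'I_5 -> option sym}) :
    {set st * {ffun 'I_5 -> option sym * move}} :=
  match q with
  | inr (Some _) => set0
  | inr None =>
    if a ord0 is Some (inl x) then
      [set (inr None, copy_act a g) | g in ann x]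
    else [set (inl (sm_start M, None),
               act_on a (lift ord0 ord0) (a (lift ord0 ord0), Some true))]
  | inl (q, Some (i, g)) =>
    [set (inl (q, None), act_on a (lift ord0 i) (Some (inr g), None))]
  | inl (q, None) =>
    if sm_next q (stack_tops a) is Some (q', o) then [set op_act a q' o]
    else [set (inr (Some (stack_tops a (inord 1) == Some one)),
               [ffun j => (a j, None)])]
  end.

Definition tm : machine :=
  @Machine st sym 4 (inr None) [set inr (Some true)] tm_delta.

(** Only the right half counts, since a push overwrites whatever lies to the left of the head.
    Trailing blanks appear when the head writes on an empty half. *)
Definition represents (t : tape sym) (u : seq G) : Prop :=
  exists n, t.2 = [seq Some (inr g) | g <- u] ++ nseq n None.

Definition tm_rep (t : {ffun 'I_5 -> tape sym}) (s : stacks G) : Prop :=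
  forall i, represents (t (lift ord0 i)) (s i).

Lemma represents_top t u : represents t u -> stack_top (tape_read t) = ohead u.
Proof. by case=> [[|n]]; rewrite /tape_read => ->; case: u. Qed.

Lemma represents_stay t u :
  represents t u -> represents (tape_move (tape_write t (tape_read t)) None) u.
Proof.
case=> n; rewrite /tape_read /represents /= => ->.
case: u => [|a u] /=; last by exists n.
by case: n => [|n]; [exists 1 | exists n.+1].
Qed.

Lemma represents_pop t u :
  represents t u ->
  represents (tape_move (tape_write t None) (Some true)) (behead u).
Proof.
case=> n; rewrite /represents /= => ->.
by case: u => [|a u] /=; [exists n.-1; case: n | exists n].
Qed.

Lemma represents_push t u g :
  represents t u ->
  represents (tape_move (tape_write
    (tape_move (tape_write t (tape_read t)) (Some false)) (Some (inr g))) None)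
    (g :: u).
Proof.
move/represents_stay => -[n]; rewrite /represents /= => ->.
by exists n.
Qed.

Lemma represents_word t u :
  represents t u -> tape_word t = [seq inr g | g <- u].
Proof.
rewrite /tape_word => -[n ->].
by elim: u => [|a u /= ->] //=; case: n.
Qed.

Definition tm_read (t : {ffun 'I_5 -> tape sym}) := [ffun i => tape_read (t i)].

Lemma tm_rep_tops t s : tm_rep t s -> stack_tops (tm_read t) = tops s.
Proof.
by move=> r; apply/ffunP => i; rewrite !ffunE (represents_top (r i)).
Qed.

Lemma tm_step q o (t : {ffun 'I_5 -> tape sym}) s q' :
  tm_rep t s -> sm_next q (tops s) = Some (q', o) ->
  exists n t', [/\ n <= 2, @dreach tm n (inl (q, None), t) (inl (q', None), t')
    & tm_rep t' (do_op o s)].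
Proof.
move=> r nx.
have tr : @transitions tm (inl (q, None), t) = [set op_act (tm_read t) q' o].
  by rewrite /transitions /= /tm_delta (tm_rep_tops r) nx.
case: o nx tr => [|i g|i] nx tr.
- exists 1, [ffun i => tape_move (tape_write (t i) (tape_read (t i))) None].
  split=> //.
    eexists; last by [].
    eexists; first exact: tr.
    by congr pair; apply/ffunP => j; rewrite !ffunE.
  by move=> j; rewrite ffunE; apply: represents_stay.
- pose t1 := [ffun j : 'I_5 => if j == lift ord0 i
    then tape_move (tape_write (t j) (tape_read (t j))) (Some false)
    else tape_move (tape_write (t j) (tape_read (t j))) None].
  pose t2 := [ffun j : 'I_5 => if j == lift ord0 i
    then tape_move (tape_write (t1 j) (Some (inr g))) None
    else tape_move (tape_write (t1 j) (tape_read (t1 j))) None].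
  exists 2, t2; split=> //.
    eexists.
      eexists; first exact: tr.
      by reflexivity.
    eexists; last by [].
    eexists; first by rewrite /transitions.
    congr pair; apply/ffunP => j; rewrite !ffunE /=.
    by case: ifP => e; rewrite ?ffunE e /= ?e ?(eqP e).
  move=> j; rewrite !ffunE (inj_eq lift_inj).
  case: eqP => [->|_]; first exact: represents_push.
  by apply: represents_stay; apply: represents_stay.
- exists 1, [ffun j : 'I_5 => if j == lift ord0 i
    then tape_move (tape_write (t j) None) (Some true)
    else tape_move (tape_write (t j) (tape_read (t j))) None].
  split=> //.
    eexists; last by [].
    eexists; first exact: tr.
    by congr pair; apply/ffunP => j; rewrite !ffunE; case: ifP.
  move=> j; rewrite !ffunE (inj_eq lift_inj).
  case: eqP => [->|_]; first exact: represents_pop.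
  exact: represents_stay.
Qed.

Lemma tm_run q s n q' s' (t : {ffun 'I_5 -> tape sym}) :
  sm_run q s n q' s' -> tm_rep t s ->
  exists k t', [/\ k <= n.*2, @dreach tm k (inl (q, None), t) (inl (q', None), t')
    & tm_rep t' s'].
Proof.
move=> r; elim: r t => [{}q {}s|{}q {}s q1 o m q2 s2 nx _ IH] t rt.
  by exists 0, t.
have [k [t1 [k2 r1 rt1]]] := tm_step rt nx.
have [k' [t2 [k2' r2 rt2]]] := IH _ rt1.
exists (k + k'), t2; split=> //; last exact: dreach_cat r1 r2.
lia.
Qed.

Lemma tm_halts s n s' (t : {ffun 'I_5 -> tape sym}) :
  sm_halts M s n s' -> tm_rep t s ->
  exists k t', [/\ k <= n.*2.+1,
    @dreach tm k (inl (sm_start M, None), t)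
       (inr (Some (ohead (s' (inord 1)) == Some one)), t')
    & tm_rep t' s'].
Proof.
move=> [q [k [kn r ex]]] rt.
have [k' [t' [k2 r' rt']]] := tm_run r rt.
exists (k' + 1), [ffun i => tape_move (tape_write (t' i) (tape_read (t' i))) None].
split.
- lia.
- apply: dreach_cat r' _; eexists; last by [].
  eexists; first by rewrite /transitions /= -/(tm_read t') (tm_rep_tops rt') ex.
  congr pair; last by apply/ffunP => j; rewrite !ffunE.
  by rewrite /= ffunE.
- by move=> i; rewrite ffunE; apply: represents_stay.
Qed.

Definition input_stacks (v : seq G) : stacks G :=
  [ffun i => if i == ord0 then rev v else [::]].

Definition annotates (w : seq X) (v : seq G) : bool :=
  all2 (fun x g => g \in ann x) w v.

(** Invariant of the copy phase: [w] is still to be read and [u] has been copied. The head of the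
    first stack tape waits on the blank to the left of [u], so the last letter of the input ends on
    top. *)
Definition copying (w : seq X) (u : seq G) (t : {ffun 'I_5 -> tape sym}) :=
  [/\ (t ord0).2 = [seq Some (inl x) | x <- w],
      (t (lift ord0 ord0)).1 = [::],
      head None (t (lift ord0 ord0)).2 = None,
      behead (t (lift ord0 ord0)).2 = [seq Some (inr g) | g <- u]
    & forall i : 'I_4, i != ord0 -> represents (t (lift ord0 i)) [::]].

Lemma neq_lift00 : (lift ord0 ord0 == ord0 :> 'I_5) = false.
Proof. by []. Qed.

Lemma copying_next x w u g t : copying (x :: w) u t ->
  copying w (g :: u)
    [ffun i => tape_move (tape_write (t i) (copy_act (tm_read t) g i).1)
                         (copy_act (tm_read t) g i).2].
Proof.
case=> t0 t1 t1h t1b ti; split; rewrite ?ffunE ?neq_lift00 ?eqxx //=.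
- by rewrite t0.
- by rewrite t1.
- by rewrite t1.
- by rewrite t1b.
- move=> i i0; rewrite !ffunE.
  rewrite (inj_eq lift_inj) (negPf i0) /=.
  by apply: represents_stay; apply: ti.
Qed.

Lemma copying_done u t : copying [::] u t ->
  tm_rep [ffun i => tape_move (tape_write (t i)
    (act_on (tm_read t) (lift ord0 ord0) (tm_read t (lift ord0 ord0), Some true) i).1)
    (act_on (tm_read t) (lift ord0 ord0) (tm_read t (lift ord0 ord0), Some true) i).2]
    (input_stacks (rev u)).
Proof.
case=> t0 t1 t1h t1b ti i; rewrite !ffunE (inj_eq lift_inj) revK.
case: eqP => [->|/eqP i0] /=; last by apply: represents_stay; apply: ti.
by exists 0; rewrite cats0 /= t1b.
Qed.

Lemma copying_end_act u t : copying [::] u t ->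
  @transitions tm (inr None, t) = [set (inl (sm_start M, None),
    act_on (tm_read t) (lift ord0 ord0)
      (tm_read t (lift ord0 ord0), Some true))].
Proof.
case=> t0 _ _ _ _; rewrite /transitions /= -/(tm_read t) /tm_delta.
by have -> : tm_read t ord0 = None by rewrite ffunE /tape_read t0.
Qed.

Lemma copying_act x w u t : copying (x :: w) u t ->
  @transitions tm (inr None, t) =
    [set (inr None, copy_act (tm_read t) g) | g in ann x].
Proof.
case=> t0 _ _ _ _; rewrite /transitions /= -/(tm_read t) /tm_delta.
by have -> : tm_read t ord0 = Some (inl x) by rewrite ffunE /tape_read t0.
Qed.

Lemma copying_init w : copying w [::] (@init tm [seq inl x | x <- w]).2.
Proof.
split; rewrite ?ffunE //= -?map_comp //.
by move=> i i0; rewrite ffunE /=; exists 0.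
Qed.

Lemma copy_reach w u t v :
  copying w u t -> annotates w v ->
  exists t', reach (size w).+1 ((inr None, t) : config tm)
               ((inl (sm_start M, None), t') : config tm)
    /\ tm_rep t' (input_stacks (rev u ++ v)).
Proof.
elim: w u t v => [|x w IH] u t [|g v] //= cp; last case/andP=> gx wv.
- eexists; split; last by rewrite cats0; exact: copying_done cp.
  eexists; last by [].
  exists (inl (sm_start M, None), act_on (tm_read t) (lift ord0 ord0)
    (tm_read t (lift ord0 ord0), Some true)); last by [].
  by rewrite (copying_end_act cp) in_set1.
- have [t' [r rt']] := IH _ _ _ (copying_next g cp) wv.
  exists t'; split; last by rewrite -cat_rcons -rev_cons.
  eexists; last exact: r.
  exists (inr None, copy_act (tm_read t) g); last by [].
  by rewrite (copying_act cp); apply/imsetP; exists g.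
Qed.

(** All guessing happens while copying: a run is either still in that phase, or it has guessed an
    annotation of the whole input and continues as the stack machine. *)
Lemma copy_run w u t m (c : config tm) :
  copying w u t -> reach m ((inr None, t) : config tm) c ->
  c.1 = inr None /\ m <= size w \/
  exists v t' k, [/\ annotates w v, tm_rep t' (input_stacks (rev u ++ v)),
    m = (size w).+1 + k
    & reach k ((inl (sm_start M, None), t') : config tm) c].
Proof.
elim: w u t m => [|x w IH] u t [|m] cp /=.
- by move=> <-; left.
- case=> d [act]; rewrite (copying_end_act cp) in_set1 => /eqP-> -> r; right.
  exists [::]; eexists; exists m; split=> //; last exact: r.
  by rewrite cats0; apply: copying_done.
- by move=> <-; left.
- case=> d [act]; rewrite (copying_act cp); case/imsetP=> g gx -> -> r.
  have [|[v [t' [k [wv rt' -> r']]]]] := IH _ _ _ (copying_next g cp) r.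
    by case=> e ms; left.
  right; exists (g :: v), t', k; split=> //=; first by rewrite gx.
  by rewrite -cat_rcons -rev_cons.
Qed.

Lemma tm_computes w v n s' :
  annotates w v -> sm_halts M (input_stacks v) n s' ->
  exists k (c : config tm), [/\ reach k (@init tm [seq inl x | x <- w]) c, halted c,
    c.1 = inr (Some (ohead (s' (inord 1)) == Some one))
    & tape_word (c.2 ord_max) = [seq inr g | g <- s' ord_max]].
Proof.
move=> wv hl; have [t' [r rt']] := copy_reach (copying_init w) wv.
have [k [t2 [k2 r2 rt2]]] := tm_halts hl rt'.
eexists _, _; split; first exact: reach_cat r (dreach_reach r2).
- by [].
- by [].
- have -> : ord_max = lift ord0 ord_max :> 'I_5 by apply: val_inj.
  exact: represents_word.
Qed.

Lemma tm_runs_within w n :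
  (forall v, annotates w v -> exists s', sm_halts M (input_stacks v) n s') ->
  @runs_within tm [seq inl x | x <- w] ((size w).+2 + n.*2).
Proof.
move=> hl m c r.
have [[_ ms]|[v [t' [k [wv rt' mE r']]]]] := copy_run (copying_init w) r.
  by apply: leq_trans ms _; lia.
have [s' hs'] := hl _ wv.
have [k' [t2 [k2 r2 rt2]]] := tm_halts hs' rt'.
have [] := dreach_halted r2 _ r'; first by [].
lia.
Qed.

Lemma tm_accepts w n (F : seq G -> stacks G) :
  (forall v, annotates w v -> sm_halts M (input_stacks v) n (F v)) ->
  @accepts tm [seq inl x | x <- w] ->
  exists2 v, annotates w v & ohead (F v (inord 1)) = Some one.
Proof.
move=> hl [m [c [r hc ac]]].
have [[c1 _]|[v [t' [k [wv rt' mE r']]]]] := copy_run (copying_init w) r.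
  by move: ac; rewrite c1 in_set1.
have [k' [t2 [k2 r2 rt2]]] := tm_halts (hl _ wv) rt'.
have [//|_ /(_ hc) cE] := dreach_halted r2 _ r'.
exists v => //; move: ac; rewrite cE in_set1 /= => /eqP[] e.
by apply/eqP.
Qed.

Lemma tm_deterministic : (forall x, #|ann x| <= 1) -> deterministic tm.
Proof.
move=> ann1 [[q [[i g]|]]|[b|]] a; rewrite /= /tm_delta ?cards1 ?cards0 //.
  by case: sm_next => [[q' o]|]; rewrite cards1.
case: (a ord0) => [[x|g]|]; rewrite ?cards1 //.
exact: leq_trans (leq_imset_card _ _) (ann1 x).
Qed.

End Simulation.

(** * Structured programs on stacks *)

Section Programs.

Variable G : finType.

Inductive cmd :=
| Skip
| Push of 'I_4 & G
| Pop of 'I_4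
| Seq of cmd & cmd
| Case of 'I_4 & (option G -> cmd)
| While of 'I_4 & pred (option G) & cmd.

(* n is an upper bound on the time. *)
Inductive exec : cmd -> stacks G -> nat -> stacks G -> Prop :=
| ExecSkip s : exec Skip s 0 s
| ExecPush i a s : exec (Push i a) s 1 (upd s i (a :: s i))
| ExecPop i s : exec (Pop i) s 1 (upd s i (behead (s i)))
| ExecSeq c1 c2 s m s1 n s2 :
    exec c1 s m s1 -> exec c2 s1 n s2 -> exec (Seq c1 c2) s (m + n).+1 s2
| ExecCase i f (s : stacks G) n s' : exec (f (ohead (s i))) s n s' -> exec (Case i f) s n.+1 s'
| ExecWhile i (P : pred (option G)) c (s : stacks G) m s1 n s2 : P (ohead (s i)) ->
    exec c s m s1 -> exec (While i P c) s1 n s2 -> exec (While i P c) s (m + n).+2 s2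
| ExecDone i (P : pred (option G)) c (s : stacks G) : ~~ P (ohead (s i)) ->
    exec (While i P c) s 0 s
| ExecLeq c s m n s' : m <= n -> exec c s m s' -> exec c s n s'.

(** Exits of one part are linked to the entry of the next by a [Nop] move. The state [None] of
    [Case] and [While] performs the test. *)
Fixpoint compile (c : cmd) : smachine G :=
  match c with
  | Skip => @SMachine G unit tt (fun _ _ => None)
  | Push i a =>
    @SMachine G bool true (fun q _ => if q then Some (false, OPush i a) else None)
  | Pop i =>
    @SMachine G bool true (fun q _ => if q then Some (false, OPop G i) else None)
  | Seq c1 c2 =>
    let M1 := compile c1 in let M2 := compile c2 in
    @SMachine G (sm_state M1 + sm_state M2)%type (inl (sm_start M1))
      (fun q a => match q with
        | inl q1 => if sm_next q1 a is Some (q', o) then Some (inl q', o)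
                    else Some (inr (sm_start M2), Nop G)
        | inr q2 => if sm_next q2 a is Some (q', o) then Some (inr q', o)
                    else None
        end)
  | Case i f =>
    let M x := compile (f x) in
    @SMachine G (option {x : option G & sm_state (M x)}) None
      (fun q a => match q with
        | None => Some (Some (Tagged (fun x => sm_state (M x)) (sm_start (M (a i)))),
                        Nop G)
        | Some (existT x q1) =>
          if sm_next q1 a is Some (q', o) then
            Some (Some (Tagged (fun x => sm_state (M x)) q'), o)
          else None
        end)
  | While i P c =>
    let M := compile c in
    @SMachine G (option (sm_state M)) None
      (fun q a => match q with
        | None => if P (a i) then Some (Some (sm_start M), Nop G) else None
        | Some q1 => if sm_next q1 a is Some (q', o) then Some (Some q', o)
                     else Some (None, Nop G)
        end)
  end.

Lemma sm_run_lift (M M' : smachine G) (h : sm_state M -> sm_state M') q s n q' s' :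
  (forall q a q' o, sm_next q a = Some (q', o) ->
     sm_next (h q) a = Some (h q', o)) ->
  sm_run q s n q' s' -> sm_run (h q) s n (h q') s'.
Proof.
move=> hM; elim=> [{}q {}s|{}q {}s q1 o m q2 s2 e _ IH]; first exact: SmRun0.
by apply: SmRunS IH; apply: hM.
Qed.

Lemma sm_run_next (M : smachine G) (q q1 q2 : sm_state M) s s1 n :
  sm_run q s n q1 s1 -> sm_next q1 (tops s1) = Some (q2, Nop G) ->
  sm_run q s n.+1 q2 s1.
Proof.
move=> r e; rewrite -addn1; apply: sm_run_cat r _.
by apply: SmRunS e _; apply: SmRun0.
Qed.

Lemma sm_run_test (M : smachine G) (q q1 q2 : sm_state M) s s1 n :
  sm_next q (tops s) = Some (q1, Nop G) -> sm_run q1 s n q2 s1 ->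
  sm_run q s n.+1 q2 s1.
Proof. by move=> e r; apply: SmRunS e r. Qed.

Lemma compile_correct c s n s' : exec c s n s' -> sm_halts (compile c) s n s'.
Proof.
elim=> {c s n s'}.
- by move=> s; exists tt, 0; split=> //; apply: SmRun0.
- move=> i a s; exists false, 1; split=> //.
  by apply: (@SmRunS _ _ _ _ (false : sm_state (compile (Push i a)))) => //=;
    apply: SmRun0.
- move=> i s; exists false, 1; split=> //.
  by apply: (@SmRunS _ _ _ _ (false : sm_state (compile (Pop i)))) => //=;
    apply: SmRun0.
- move=> c1 c2 s m s1 n s2 _ [q1 [k1 [k1m r1 e1]]] _ [q2 [k2 [k2n r2 e2]]].
  exists (inr q2), (k1.+1 + k2); split; [lia | | by rewrite /= e2].
  apply: sm_run_cat.
    apply: (@sm_run_next (compile (Seq c1 c2)) _ (inl q1)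
             (inr (sm_start (compile c2))) _ s1); last by rewrite /= e1.
    by apply: (sm_run_lift (M' := compile (Seq c1 c2)) (h := inl)) r1
      => q a q' o /= ->.
  by apply: (sm_run_lift (M' := compile (Seq c1 c2)) (h := inr)) r2
      => q a q' o /= ->.
- move=> i f s n s' _ [q [k [kn r e]]].
  pose h x (p : sm_state (compile (f x))) : sm_state (compile (Case i f)) :=
    Some (Tagged (fun x => sm_state (compile (f x))) p).
  exists (h _ q), k.+1; split; [lia | | by rewrite /= e].
  apply: (@sm_run_test _ _ (h _ (sm_start _))); first by rewrite /= ffunE.
  by apply: (sm_run_lift (M' := compile (Case i f)) (h := h _)) r
    => q1 a q' o /= ->.
- move=> i P c s m s1 n s2 Ps _ [q1 [k1 [k1m r1 e1]]] _ [q2 [k2 [k2n r2 e2]]].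
  exists q2, (k1.+2 + k2); split; [lia | | by []].
  apply: sm_run_cat r2.
  apply: (@sm_run_next (compile (While i P c)) _ (Some q1) None _ s1);
    last by rewrite /= e1.
  apply: (@sm_run_test (compile (While i P c)) _ (Some (sm_start _)));
    first by rewrite /= ffunE Ps.
  by apply: (sm_run_lift (M' := compile (While i P c)) (h := Some)) r1
    => q a q' o /= ->.
- move=> i P c s Ps; exists None, 0; split=> //; first exact: SmRun0.
  by rewrite /= ffunE (negPf Ps).
- move=> c s m n s' mn _ [q [k [km r e]]].
  by exists q, k; split=> //; apply: leq_trans mn.
Qed.

End Programs.

Arguments Skip {G}.
Arguments Pop {G}.

(** * Trees on a stack *)

Inductive tree := Leaf | Node of tree & tree.

(** The preorder code is prefix-free, so trees can be stacked without separators. *)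
Fixpoint enc (x : tree) : seq bool :=
  if x is Node y z then true :: enc y ++ enc z else [:: false].

Definition treesz (x : tree) : nat := size (enc x).

Section TreePrograms.

Variable U : finType.

Let G := (U + bool)%type.

(** A receives the input, D holds the data and its top decides acceptance, C counts, and B is the
    output on the last tape. A and B also serve as scratch space. *)
Definition tA : 'I_4 := ord0.
Definition tD : 'I_4 := inord 1.
Definition tC : 'I_4 := inord 2.
Definition tB : 'I_4 := ord_max.

Definition stk (a d c b : seq G) : stacks G :=
  [ffun i : 'I_4 => nth [::] [:: a; d; c; b] i].

Lemma stkA a d c b : stk a d c b tA = a. Proof. by rewrite ffunE. Qed.
Lemma stkD a d c b : stk a d c b tD = d.
Proof. by rewrite ffunE inordK. Qed.
Lemma stkC a d c b : stk a d c b tC = c.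
Proof. by rewrite ffunE inordK. Qed.
Lemma stkB a d c b : stk a d c b tB = b. Proof. by rewrite ffunE. Qed.

Lemma updA a d c b x : upd (stk a d c b) tA x = stk x d c b.
Proof. by apply/ffunP; case=> [[|[|[|[|]]]]] // lt; rewrite /upd /stk !ffunE. Qed.
Lemma updD a d c b x : upd (stk a d c b) tD x = stk a x c b.
Proof.
by apply/ffunP; case=> [[|[|[|[|]]]]] // lt;
  rewrite /upd /stk !ffunE -val_eqE /= inordK.
Qed.
Lemma updC a d c b x : upd (stk a d c b) tC x = stk a d x b.
Proof.
by apply/ffunP; case=> [[|[|[|[|]]]]] // lt;
  rewrite /upd /stk !ffunE -val_eqE /= inordK.
Qed.
Lemma updB a d c b x : upd (stk a d c b) tB x = stk a d c x.
Proof. by apply/ffunP; case=> [[|[|[|[|]]]]] // lt; rewrite /upd /stk !ffunE. Qed.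

Definition stkE := (stkA, stkD, stkC, stkB, updA, updD, updC, updB).

Lemma stacks_stk (s : stacks G) : s = stk (s tA) (s tD) (s tC) (s tB).
Proof.
by apply/ffunP; case=> [[|[|[|[|]]]]] // lt; rewrite ffunE /=; congr (s _);
  apply: val_inj; rewrite /= ?inordK.
Qed.

Definition bits (u : seq bool) : seq G := [seq inr b | b <- u].

Lemma bits_cat u v : bits (u ++ v) = bits u ++ bits v.
Proof. exact: map_cat. Qed.

Lemma exec_push i a (s s' : stacks G) : upd s i (a :: s i) = s' ->
  exec (Push i a) s 1 s'.
Proof. by move=> <-; apply: ExecPush. Qed.

Lemma exec_pop i (s s' : stacks G) : upd s i (behead (s i)) = s' ->
  exec (Pop i) s 1 s'.
Proof. by move=> <-; apply: ExecPop. Qed.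

Lemma exec_case i f (s : stacks G) x n s' : ohead (s i) = x ->
  exec (f x) s n s' -> exec (Case i f) s n.+1 s'.
Proof. by move=> <-; apply: ExecCase. Qed.

Definition nonempty : pred (option G) := isSome.

Definition pour_body (i : 'I_4) : cmd G :=
  Case i (fun x => if x is Some (inr b) then Seq (Pop i) (Push tD (inr b))
                   else Skip).

Definition pour (i : 'I_4) : cmd G := While i nonempty (pour_body i).

Lemma exec_pourA u d c b :
  exec (pour tA) (stk (bits u) d c b) (6 * size u) (stk [::] (bits (rev u) ++ d) c b).
Proof.
elim: u d => [|x u IH] d; first by apply: ExecDone; rewrite stkE.
rewrite rev_cons -cats1 bits_cat -catA.
apply: (ExecLeq _ (ExecWhile _ _ (IH (inr x :: d)))); last 2 first.
- by rewrite stkE.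
- apply: exec_case; first by rewrite stkE.
  apply: ExecSeq; first by apply: exec_pop; rewrite !stkE.
  by apply: exec_push; rewrite !stkE.
by rewrite /=; lia.
Qed.

Lemma exec_pourB u a d c :
  exec (pour tB) (stk a d c (bits u)) (6 * size u) (stk a (bits (rev u) ++ d) c [::]).
Proof.
elim: u d => [|x u IH] d; first by apply: ExecDone; rewrite stkE.
rewrite rev_cons -cats1 bits_cat -catA.
apply: (ExecLeq _ (ExecWhile _ _ (IH (inr x :: d)))); last 2 first.
- by rewrite stkE.
- apply: exec_case; first by rewrite stkE.
  apply: ExecSeq; first by apply: exec_pop; rewrite !stkE.
  by apply: exec_push; rewrite !stkE.
by rewrite /=; lia.
Qed.

Lemma exec_unscanA x d c b :
  exec (pour tA) (stk (bits (rev (enc x))) d c b) (6 * treesz x)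
     (stk [::] (bits (enc x) ++ d) c b).
Proof. by have := exec_pourA (rev (enc x)) d c b; rewrite revK size_rev. Qed.

Lemma exec_unscanB x a d c :
  exec (pour tB) (stk a d c (bits (rev (enc x)))) (6 * treesz x)
     (stk a (bits (enc x) ++ d) c [::]).
Proof. by have := exec_pourB (rev (enc x)) a d c; rewrite revK size_rev. Qed.

(* The height of stack C is the number of trees that are still to be read. *)
Definition scan_push (f : bool) (i : 'I_4) (x : bool) : cmd G :=
  if f then Push i (inr x) else Skip.

Definition scan_body (fa fb : bool) : cmd G :=
  Case tD (fun x => if x is Some (inr y) then
    Seq (Pop tD) (Seq (scan_push fa tA y) (Seq (scan_push fb tB y)
      (if y then Push tC (inr true) else Pop tC)))
    else Skip).

Definition scan_loop fa fb : cmd G := While tC nonempty (scan_body fa fb).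

Definition scan fa fb : cmd G := Seq (Push tC (inr true)) (scan_loop fa fb).

Definition keep (f : bool) (u v : seq G) : seq G := if f then u ++ v else v.

Lemma exec_scan_body fa fb a d c b (x y : bool) :
  exec (scan_body fa fb) (stk a (inr x :: d) (inr y :: c) b) 8
     (stk (keep fa [:: inr x] a) d
          (if x then [:: inr true, inr y & c] else c) (keep fb [:: inr x] b)).
Proof.
apply: (@ExecLeq _ _ _ (1 + (fa + (fb + 1).+1).+1).+2); first by case: fa; case: fb.
apply: exec_case; first by rewrite stkE.
apply: ExecSeq; first by apply: exec_pop; rewrite !stkE.
have aE e f : exec (scan_push fa tA x) (stk a e f b) fa
                 (stk (keep fa [:: inr x] a) e f b).
  by case: fa; [apply: exec_push; rewrite !stkE | apply: ExecSkip].
have bE a' e f : exec (scan_push fb tB x) (stk a' e f b) fb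
                 (stk a' e f (keep fb [:: inr x] b)).
  by case: fb; [apply: exec_push; rewrite !stkE | apply: ExecSkip].
apply: ExecSeq; first exact: aE.
apply: ExecSeq; first exact: bE.
by case: x {aE bE}; [apply: exec_push | apply: exec_pop]; rewrite !stkE.
Qed.

(** The rest of the loop is a hypothesis, which lets the induction hypotheses for the two subtrees
    be chained: after a bit [true], stack C demands two trees instead of one. *)
Lemma exec_scan_loop fa fb x a d c b n s' :
  exec (scan_loop fa fb)
     (stk (keep fa (bits (rev (enc x))) a) d c (keep fb (bits (rev (enc x))) b))
     n s' ->
  exec (scan_loop fa fb) (stk a (bits (enc x) ++ d) (inr true :: c) b)
     (10 * treesz x + n) s'.
Proof.
have keep_cat f (u v w : seq G) : keep f u (keep f v w) = keep f (u ++ v) w.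
  by case: f => //=; rewrite catA.
rewrite /treesz; elim: x a d c b n => [|y IHy z IHz] a d c b n h.
  apply: (ExecLeq _ (ExecWhile _ (exec_scan_body fa fb a d c b false true) h));
    last by rewrite stkE.
  by rewrite /=; lia.
rewrite /= bits_cat -catA.
apply: (ExecLeq _ (ExecWhile _ (exec_scan_body fa fb _ _ c b true true) _));
  last 2 first.
- by rewrite stkE.
- apply: IHy; apply: IHz; move: h.
  rewrite /= !keep_cat rev_cons rev_cat -cats1 !bits_cat; exact.
rewrite size_cat; lia.
Qed.

Lemma exec_scan fa fb x a d b :
  exec (scan fa fb) (stk a (bits (enc x) ++ d) [::] b) (10 * treesz x + 2)
     (stk (keep fa (bits (rev (enc x))) a) d [::] (keep fb (bits (rev (enc x))) b)).
Proof.
apply: (ExecLeq _ (ExecSeq (exec_push _) (exec_scan_loop (n := 0) _))); last 2 first.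
- by rewrite !stkE.
- by apply: ExecDone; rewrite stkE.
by lia.
Qed.

Definition dst (ts : seq tree) : stacks G :=
  stk [::] (bits (flatten (map enc ts))) [::] [::].

Lemma dst_cons x ts : dst (x :: ts) =
  stk [::] (bits (enc x) ++ bits (flatten (map enc ts))) [::] [::].
Proof. by rewrite /dst /= bits_cat. Qed.

(** Scanning reverses a tree and pouring restores it. In [swp] the upper tree is poured back first
    and so ends below the other. *)
Definition dup : cmd G := Seq (scan true true) (Seq (pour tA) (pour tB)).
Definition swp : cmd G :=
  Seq (scan true false) (Seq (scan false true) (Seq (pour tA) (pour tB))).
Definition drop1 : cmd G := scan false false.

Lemma exec_dup x ts :
  exec dup (dst (x :: ts)) (22 * treesz x + 4) (dst [:: x, x & ts]).
Proof.
rewrite !dst_cons /= bits_cat -?catA.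
have -> : 22 * treesz x + 4 = (10 * treesz x + 2 + (6 * treesz x + 6 * treesz x).+1).+1.
  lia.
apply: ExecSeq; first exact: exec_scan.
rewrite /keep !cats0.
by apply: ExecSeq; [exact: exec_unscanA | exact: exec_unscanB].
Qed.

Lemma exec_swp x y ts :
  exec swp (dst [:: x, y & ts]) (16 * treesz x + 16 * treesz y + 7)
     (dst [:: y, x & ts]).
Proof.
rewrite !dst_cons /= !bits_cat -?catA.
have -> : 16 * treesz x + 16 * treesz y + 7 = (10 * treesz x + 2 +
   (10 * treesz y + 2 + (6 * treesz x + 6 * treesz y).+1).+1).+1 by lia.
apply: ExecSeq; first exact: exec_scan.
apply: ExecSeq; first exact: exec_scan.
rewrite /keep !cats0.
by apply: ExecSeq; [exact: exec_unscanA | exact: exec_unscanB].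
Qed.

Lemma exec_drop1 x ts :
  exec drop1 (dst (x :: ts)) (10 * treesz x + 2) (dst ts).
Proof. by rewrite dst_cons; apply: exec_scan. Qed.

Fixpoint push_bits (u : seq bool) : cmd G :=
  if u is x :: u' then Seq (push_bits u') (Push tD (inr x)) else Skip.

Lemma exec_push_bits u a d c b :
  exec (push_bits u) (stk a d c b) (2 * size u) (stk a (bits u ++ d) c b).
Proof.
elim: u => [|x u IH] /=; first exact: ExecSkip.
apply: (ExecLeq _ (ExecSeq IH (exec_push _))); last by rewrite !stkE.
lia.
Qed.

Lemma exec_push_tree x ts :
  exec (push_bits (enc x)) (dst ts) (2 * treesz x) (dst (x :: ts)).
Proof. by rewrite dst_cons; apply: exec_push_bits. Qed.

(** In preorder the two subtrees already lie on the stack in the right order, and a single bit joins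
    them. *)
Lemma exec_cons x y ts :
  exec (Push tD (inr true)) (dst [:: x, y & ts]) 1 (dst (Node x y :: ts)).
Proof. by apply: exec_push; rewrite /dst !stkE /= !bits_cat -?catA. Qed.

Definition uncons (c0 c1 : cmd G) : cmd G :=
  Case tD (fun x => Seq (Pop tD) (if x == Some (inr true) then c1 else c0)).

Lemma exec_uncons0 c0 c1 ts n s' : exec c0 (dst ts) n s' ->
  exec (uncons c0 c1) (dst (Leaf :: ts)) n.+3 s'.
Proof.
move=> h; rewrite dst_cons; apply: (@ExecLeq _ _ _ (1 + n).+2); first by [].
apply: exec_case; first by rewrite stkE.
by apply: ExecSeq; first by apply: exec_pop; rewrite !stkE.
Qed.

Lemma exec_uncons1 c0 c1 x y ts n s' : exec c1 (dst [:: x, y & ts]) n s' ->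
  exec (uncons c0 c1) (dst (Node x y :: ts)) n.+3 s'.
Proof.
move=> h; rewrite dst_cons; apply: (@ExecLeq _ _ _ (1 + n).+2); first by [].
apply: exec_case; first by rewrite stkE.
apply: ExecSeq; last exact: h.
by apply: exec_pop; rewrite !stkE /dst /= !bits_cat -?catA.
Qed.

End TreePrograms.

(** * Polynomial-time functions *)

Class Code (A : Type) := code : A -> tree.

Definition sz (A : Type) {cA : Code A} (a : A) : nat := treesz (code a).

(** On codes, this is the value of a number and the length of a list; it serves as the number of
    rounds of an iteration. *)
Fixpoint spine (x : tree) : nat := if x is Node _ z then (spine z).+1 else 0.

(** A nonempty list has the code of the pair of its head and tail, a number that of a list of units,
    and [true] and [Some x] those of pairs with a unit. Constructors then come from pairing by
    [pt_recode], and one case analysis serves all these types. *)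
Instance code_unit : Code unit := fun _ => Leaf.
Instance code_bool : Code bool := fun b => if b then Node Leaf Leaf else Leaf.
Instance code_nat : Code nat := fun n => iter n (Node Leaf) Leaf.
Instance code_prod A B {cA : Code A} {cB : Code B} : Code (A * B) :=
  fun p => Node (code p.1) (code p.2).
Instance code_seq A {cA : Code A} : Code (seq A) :=
  fun s => foldr (fun x t => Node (code x) t) Leaf s.
Instance code_option A {cA : Code A} : Code (option A) :=
  fun o => if o is Some x then Node Leaf (code x) else Leaf.
Instance code_fin (X : finType) : Code X | 10 :=
  fun x => code (enum_rank x : nat).

Lemma treeszE y z : treesz (Node y z) = (treesz y + treesz z).+1.
Proof. by rewrite /treesz /= size_cat. Qed.

Lemma treesz_gt0 x : 0 < treesz x.
Proof. by case: x. Qed.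

Lemma sz_pair A B {cA : Code A} {cB : Code B} (p : A * B) :
  sz p = (sz p.1 + sz p.2).+1.
Proof. exact: treeszE. Qed.

Lemma sz_cons A {cA : Code A} (x : A) s : sz (x :: s) = (sz x + sz s).+1.
Proof. exact: treeszE. Qed.

Lemma sz_nat n : sz n = (2 * n).+1.
Proof.
elim: n => // n IH.
by rewrite (treeszE Leaf (code n) : sz n.+1 = _) -/(sz n) IH /treesz /=; lia.
Qed.

Lemma sz_bool (b : bool) : sz b <= 3.
Proof. by case: b. Qed.

Lemma spine_size x : spine x < treesz x.
Proof. by elim: x => // y _ z IH; rewrite treeszE /=; lia. Qed.

Lemma spine_seq A {cA : Code A} (s : seq A) : spine (code s) = size s.
Proof. by elim: s => //= x s ->. Qed.

Lemma spine_nat n : spine (code n) = n.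
Proof. by elim: n => //= n ->. Qed.

Lemma size_sz A {cA : Code A} (s : seq A) : size s < sz s.
Proof. by rewrite -spine_seq; apply: spine_size. Qed.

(** A normal form for polynomial bounds: as the base is at least 2, a larger exponent absorbs
    constants and sums. *)
Definition pb (A : Type) {cA : Code A} (g : A -> nat) : Prop :=
  exists k, forall a, g a <= (sz a + 2) ^ k.

Section PolynomialBounds.

Context {A : Type} {cA : Code A}.
Implicit Types g h : A -> nat.

Lemma pb_leq g h : (forall a, g a <= h a) -> pb h -> pb g.
Proof.
by move=> gh [k hk]; exists k => a; apply: leq_trans (gh a) (hk a).
Qed.

Lemma pb_const n : pb (fun _ : A => n).
Proof.
exists n => a; apply: leq_trans (ltnW (ltn_expl n (isT : 1 < 2))) _.
by case: n => // n; rewrite leq_exp2r //; lia.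
Qed.

Lemma leq_pexp2 m k l : k <= l -> (m + 2) ^ k <= (m + 2) ^ l.
Proof. by move=> kl; rewrite leq_exp2l //; lia. Qed.

Lemma pb_add g h : pb g -> pb h -> pb (fun a => g a + h a).
Proof.
move=> [k gk] [l hl]; exists (maxn k l).+1 => a.
have := leq_trans (gk a) (leq_pexp2 (sz a) (leq_maxl k l)).
have := leq_trans (hl a) (leq_pexp2 (sz a) (leq_maxr k l)).
rewrite expnS; set e := (_ ^ _); nia.
Qed.

Lemma pb_mul g h : pb g -> pb h -> pb (fun a => g a * h a).
Proof.
move=> [k gk] [l hl]; exists (k + l) => a.
by rewrite expnD; apply: leq_mul.
Qed.

Lemma pb_exp g n : pb g -> pb (fun a => g a ^ n).
Proof.
move=> [k gk]; exists (k * n) => a; rewrite expnM.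
by case: n => // n; rewrite leq_exp2r.
Qed.

Lemma pb_sz : pb (fun a : A => sz a).
Proof. by exists 1 => a; rewrite expn1; lia. Qed.

Lemma pb_S g : pb g -> pb (fun a => (g a).+1).
Proof. by move=> pg; apply: pb_leq (pb_add pg (pb_const 1)) => a; lia. Qed.

Lemma pb_comp (B : Type) {cB : Code B} (f : A -> B) (g : B -> nat) :
  pb (fun a => sz (f a)) -> pb g -> pb (fun a => g (f a)).
Proof.
move=> pf [k gk]; apply: pb_leq (fun a => gk (f a)) _.
by apply: pb_exp; apply: pb_add pf (pb_const 2).
Qed.

End PolynomialBounds.

Ltac pb_auto :=
  repeat first [assumption | apply: pb_const | apply: pb_sz | apply: pb_S
    | apply: pb_add | apply: pb_mul | apply: pb_exp].

(** One program rewrites the top of the data stack from [f a] to [g a] above any [ts]. The parameter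
    [a] need not be on the stack; it is what the time is measured in. *)
Definition does (U : finType) (A : Type) {cA : Code A} (f g : A -> seq tree) :=
  exists c T, pb T /\
    forall a ts, exec c (dst U (f a ++ ts)) (T a) (dst U (g a ++ ts)).

Section Does.

Variable (U : finType).
Context {A : Type} {cA : Code A}.
Implicit Types (f g h r : A -> seq tree) (x y : A -> tree).

Lemma does_trans f g h : does U f g -> does U g h -> does U f h.
Proof.
move=> [c [T [pT cT]]] [c' [T' [pT' cT']]].
exists (Seq c c'), (fun a => (T a + T' a).+1); split; first by pb_auto.
by move=> a ts; apply: ExecSeq.
Qed.

Lemma does_ext f g f' g' :
  f =1 f' -> g =1 g' -> does U f g -> does U f' g'.
Proof.
move=> ff' gg' [c [T [pT cT]]]; exists c, T; split=> // a ts.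
by rewrite -ff' -gg'.
Qed.

Lemma does_id f : does U f f.
Proof.
by exists Skip, (fun _ => 0); split; [pb_auto | move=> a ts; apply: ExecSkip].
Qed.

Lemma does_dup x r : pb (fun a => treesz (x a)) ->
  does U (fun a => x a :: r a) (fun a => [:: x a, x a & r a]).
Proof.
move=> px; exists (dup U), (fun a => 22 * treesz (x a) + 4).
by split; [pb_auto | move=> a ts; apply: exec_dup].
Qed.

Lemma does_swp x y r : pb (fun a => treesz (x a)) -> pb (fun a => treesz (y a)) ->
  does U (fun a => [:: x a, y a & r a]) (fun a => [:: y a, x a & r a]).
Proof.
move=> px py; exists (swp U), (fun a => 16 * treesz (x a) + 16 * treesz (y a) + 7).
by split; [pb_auto | move=> a ts; apply: exec_swp].
Qed.

Lemma does_drop x r : pb (fun a => treesz (x a)) ->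
  does U (fun a => x a :: r a) r.
Proof.
move=> px; exists (drop1 U), (fun a => 10 * treesz (x a) + 2).
by split; [pb_auto | move=> a ts; apply: exec_drop1].
Qed.

Lemma does_push t r : does U r (fun a => t :: r a).
Proof.
exists (push_bits U (enc t)), (fun a => 2 * treesz t).
by split; [pb_auto | move=> a ts; apply: exec_push_tree].
Qed.

Lemma does_cons x y r :
  does U (fun a => [:: x a, y a & r a]) (fun a => Node (x a) (y a) :: r a).
Proof.
exists (Push tD (inr true)), (fun a => 1).
by split; [pb_auto | move=> a ts; apply: exec_cons].
Qed.

(** A value viewed as a pair has the code of that pair, so the size of [(a, p)] is
    [(sz a + sz (h a)).+1]. This turns the time of the second branch into a bound in [a]. *)
Lemma does_case (H V W : Type) {cV : Code V} {cW : Code W} {cH : Code H}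
    (view : H -> option (V * W)) (h : A -> H) f r0 (r1 : A * (V * W) -> seq tree) :
  (forall e, code e = if view e is Some p then code p else Leaf) ->
  pb (fun a => sz (h a)) -> does U f r0 ->
  does U (fun p : A * (V * W) => [:: code p.2.1, code p.2.2 & f p.1]) r1 ->
  does U (fun a => code (h a) :: f a)
         (fun a => if view (h a) is Some p then r1 (a, p) else r0 a).
Proof.
move=> hv ph [c0 [T0 [pT0 cT0]]] [c1 [T1 [[k T1k] cT1]]].
exists (uncons c0 c1),
  (fun a => (T0 a + ((sz a + sz (h a)).+1 + 2) ^ k).+3).
split; first by pb_auto.
move=> a ts; rewrite hv.
have := hv (h a); case: (view (h a)) => [[v w]|] /= hE.
  apply: ExecLeq (exec_uncons1 _ (cT1 (a, (v, w)) ts)).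
  have := T1k (a, (v, w)); rewrite sz_pair /= /sz hE; lia.
by apply: ExecLeq (exec_uncons0 _ (cT0 a ts)); lia.
Qed.

End Does.

(** The bound on the size of the value makes the notion closed under composition. The alphabet [U]
    of additional stack symbols stays arbitrary until the input and output alphabets are known. *)
Definition pt (A B : Type) {cA : Code A} {cB : Code B} (f : A -> B) : Prop :=
  pb (fun a => sz (f a)) /\
  forall U, does U (fun a => [:: code a]) (fun a => [:: code (f a)]).

Lemma pt_sz A B {cA : Code A} {cB : Code B} (f : A -> B) :
  pt f -> pb (fun a => sz (f a)).
Proof. by case. Qed.

Lemma does_app U A B D {cA : Code A} {cB : Code B} {cD : Code D}
    (f : B -> D) (x : A -> B) (r : A -> seq tree) :
  pt f -> pb (fun a => sz (x a)) ->
  does U (fun a => code (x a) :: r a) (fun a => code (f (x a)) :: r a).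
Proof.
move=> [_ /(_ U) [c [T [pT cT]]]] px; exists c, (fun a => T (x a)).
split; first exact: pb_comp px pT.
by move=> a ts; apply: (cT (x a) (r a ++ ts)).
Qed.

Section Basic.

Context {A B D : Type} {cA : Code A} {cB : Code B} {cD : Code D}.

Lemma pt_id : pt (fun a : A => a).
Proof. by split; [apply: pb_sz | move=> U; apply: does_id]. Qed.

Lemma pt_comp (f : B -> D) (g : A -> B) : pt f -> pt g -> pt (fun a => f (g a)).
Proof.
move=> pf pg; split.
  by apply: (pb_comp (g := fun b => sz (f b))); [apply: pt_sz pg | apply: pt_sz pf].
move=> U; case: (pg) => sg /(_ U) dg; apply: does_trans dg _.
exact: does_app pf sg.
Qed.

Lemma pt_const (b : B) : pt (fun _ : A => b).
Proof.
split; first exact: pb_const.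
move=> U; apply: does_trans (does_drop _ _ _) (does_push _ _ _).
exact: pb_sz.
Qed.

Lemma pt_pair (f : A -> B) (g : A -> D) : pt f -> pt g -> pt (fun a => (f a, g a)).
Proof.
move=> pf pg; have sf := pt_sz pf; have sg := pt_sz pg; split.
  by apply: pb_leq (pb_S (pb_add sf sg)) => a; rewrite sz_pair.
move=> U.
apply: does_trans (does_dup _ _ (pb_sz)) _.
apply: does_trans (does_app _ _ pg pb_sz) _.
apply: does_trans (does_swp _ _ sg pb_sz) _.
apply: does_trans (does_app _ _ pf pb_sz) _.
exact: does_cons.
Qed.

Lemma pt_recode (f : A -> B) (g : A -> D) :
  (forall a, code (f a) = code (g a)) -> pt f -> pt g.
Proof.
move=> fg [sf df]; split.
  by apply: pb_leq sf => a; rewrite /sz fg.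
by move=> U; apply: does_ext (df U) => // a; rewrite fg.
Qed.

End Basic.

Lemma pt_ext A B {cA : Code A} {cB : Code B} (f g : A -> B) :
  f =1 g -> pt f -> pt g.
Proof. by move=> fg; apply: pt_recode => a; rewrite fg. Qed.

Section Case.

Context {A B H V W : Type} {cA : Code A} {cB : Code B} {cH : Code H}
  {cV : Code V} {cW : Code W}.

Lemma pt_case (view : H -> option (V * W)) (h : A -> H) (f0 : A -> B)
    (f1 : A * (V * W) -> B) :
  (forall e, code e = if view e is Some p then code p else Leaf) ->
  pt h -> pt f0 -> pt f1 ->
  pt (fun a => if view (h a) is Some p then f1 (a, p) else f0 a).
Proof.
move=> hv ph p0 p1; have sh := pt_sz ph; split.
  have [k f1k] := pt_sz p1.
  apply: (@pb_leq _ _ _ (fun a => sz (f0 a) + ((sz a + sz (h a)).+1 + 2) ^ k)).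
    move=> a; have := hv (h a); case: (view (h a)) => [vw|] hE; last by lia.
    by have := f1k (a, vw); rewrite sz_pair /sz /= hE; lia.
  by have s0 := pt_sz p0; pb_auto.
move=> U.
apply: does_trans (does_dup _ _ pb_sz) _.
apply: does_trans (does_app _ _ ph pb_sz) _.
have d0 := (does_app U (fun _ => [::]) p0 pb_sz).
have d1 : does U (fun p : A * (V * W) => [:: code p.2.1; code p.2.2; code p.1])
    (fun p => [:: code (f1 p)]).
  case: (p1) => _ /(_ U) d1; apply: does_trans d1.
  set x1 := fun p : A * (V * W) => code p.2.1.
  set x2 := fun p : A * (V * W) => code p.2.2.
  have s1 : pb (fun p : A * (V * W) => treesz (x1 p)).
    by apply: pb_leq pb_sz => p; rewrite !sz_pair /x1 /sz; lia.
  have s2 : pb (fun p : A * (V * W) => treesz (x2 p)).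
    by apply: pb_leq pb_sz => p; rewrite !sz_pair /x2 /sz; lia.
  have s0 : pb (fun p : A * (V * W) => sz p.1).
    by apply: pb_leq pb_sz => p; rewrite !sz_pair; lia.
  apply: does_trans (does_cons _ x1 x2 _) _.
  have s12 : pb (fun p : A * (V * W) => treesz (Node (x1 p) (x2 p))).
    by apply: pb_leq (pb_S (pb_add s1 s2)) => p; rewrite treeszE.
  apply: does_trans (does_swp _ _ s12 s0) _.
  exact: does_cons.
apply: (does_ext _ _ (does_case (f := fun a => [:: code a]) hv sh d0 d1)) => //.
by move=> a; case: (view (h a)).
Qed.

End Case.

Section Iteration.

Context {A L S : Type} {cA : Code A} {cL : Code L} {cS : Code S}.

(** Limited recursion in the sense of Cobham: without the bound [N] on all intermediate values,
    iterating [g] could make them exponentially large. The counter is a tree that loses one node of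
    its right spine in each round. *)
Lemma pt_iter_spine (l : A -> L) (s : A -> S) (g : S -> S) (N : A -> nat) :
  pt l -> pt s -> pt g -> pb N ->
  (forall a i, i <= spine (code (l a)) -> sz (iter i g (s a)) <= N a) ->
  pt (fun a => iter (spine (code (l a))) g (s a)).
Proof.
move=> pl ps pg pN bN; have sl := pt_sz pl; have ss := pt_sz ps; split.
  by apply: pb_leq pN => a; apply: bN.
move=> U.
apply: does_trans (does_dup _ _ pb_sz) _.
apply: does_trans (does_app _ _ ps pb_sz) _.
apply: does_trans (does_swp _ _ ss pb_sz) _.
apply: does_trans (does_app _ _ pl pb_sz) _.
have [_ /(_ U) [c [T [[k Tk] cT]]]] := pg.
pose body := Seq (Pop tD) (Seq (drop1 U) (Seq (swp U) (Seq c (swp U)))).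
(* Time of one round: the power for the program of [g], the multiple of [sz (l a)] for dropping the
   head of the counter, the next term for the two swaps, and a constant for the rest. *)
pose (B := fun a : A => (N a + 2) ^ k + 10 * sz (l a) + 32 * (N a + sz (l a)) + 30).
exists (Seq (While tD (fun x => x == Some (inr true)) body) (Pop tD)),
  (fun a => sz (l a) * B a + 10).
split; first by rewrite /B; pb_auto.
move=> a ts.
enough (loop : forall t i, i + spine t = spine (code (l a)) -> treesz t <= sz (l a) ->
    exec (While tD (fun x => x == Some (inr true)) body)
     (dst U [:: t, code (iter i g (s a)) & ts]) (spine t * B a)
     (dst U [:: Leaf, code (iter (spine (code (l a))) g (s a)) & ts])).
  have := loop (code (l a)) 0 erefl (leqnn _) => h.
  apply: (ExecLeq _ (ExecSeq h (exec_pop _))); last by rewrite /dst !stkE.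
  have : spine (code (l a)) * B a <= sz (l a) * B a.
    by rewrite leq_mul2r (ltnW (spine_size _)) orbT.
  lia.
elim=> [|u _ t IH] i it tl.
  by rewrite -it addn0; apply: ExecDone; rewrite dst_cons stkE.
rewrite /= in it; rewrite treeszE in tl.
have Ti : T (iter i g (s a)) <= (N a + 2) ^ k.
  apply: leq_trans (Tk _) _; case: (k) => // k'; rewrite leq_exp2r // leq_add2r.
  apply: bN; lia.
have iN : sz (iter i g (s a)) <= N a by apply: bN; lia.
have i1N : sz (iter i.+1 g (s a)) <= N a by apply: bN; lia.
have step : exec body (dst U [:: Node u t, code (iter i g (s a)) & ts]) (B a - 2)
     (dst U [:: t, code (iter i.+1 g (s a)) & ts]).
  rewrite iterS in i1N *; move: {IH} (iter i g (s a)) Ti iN i1N => y Ti iN i1N.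
  apply: (ExecLeq _ (ExecSeq (exec_pop _) (ExecSeq (exec_drop1 U u _)
    (ExecSeq (exec_swp U _ _ _) (ExecSeq (cT _ (t :: ts)) (exec_swp U _ _ _))))));
    last by rewrite /dst !stkE /= !bits_cat -!catA.
  by move: iN i1N tl Ti; rewrite /B /sz; lia.
rewrite dst_cons.
apply: (ExecLeq _ (ExecWhile _ _ (IH i.+1 _ _))); last 3 first.
- by rewrite -dst_cons; exact: step.
- by lia.
- by lia.
- by rewrite /= mulSn /B; lia.
- by rewrite stkE.
Qed.

End Iteration.

(** * Input and output of words, and transfer to Turing machines *)

Section InputOutput.

Variables (A Y : finType).
Context {cA : Code A}.

Let U := (A + Y)%type.
Let G := (U + bool)%type.

Definition in_sym (a : A) : G := inl (inl a).
Definition out_sym (y : Y) : G := inl (inr y).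

Definition load_body : cmd G :=
  Case tA (fun x => if x is Some (inl (inl a)) then
    Seq (Pop tA) (Seq (push_bits U (enc (code a))) (Push tD (inr true)))
    else Skip).

(** The last letter of the word is on top of stack A, so prefixing the letters to a list as they are
    popped restores the word. The bit pushed first is the code of the empty list. *)
Definition load : cmd G :=
  Seq (Push tD (inr false)) (While tA (@nonempty U) load_body).

Lemma exec_load v :
  exec load (input_stacks [seq in_sym a | a <- v]) (5 * sz v + 2)
     (dst U [:: code v]).
Proof.
have -> : input_stacks [seq in_sym a | a <- v] =
    stk (rev [seq in_sym a | a <- v]) [::] [::] [::].
  by rewrite [LHS]stacks_stk /tA /tB /input_stacks !ffunE /= -!val_eqE /= !inordK.
have loop u : forall w : seq A,
    exec (While tA (@nonempty U) load_body)
      (stk [seq in_sym a | a <- u] (bits U (enc (code w))) [::] [::])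
      (5 * sz (rev u)) (stk [::] (bits U (enc (code (catrev u w)))) [::] [::]).
  elim: u => [|a u IH] w.
    by apply: (@ExecLeq _ _ _ 0) => //; apply: ExecDone; rewrite stkE.
  apply: (ExecLeq _ (ExecWhile _ _ (IH (a :: w)))); last 2 first.
  - by rewrite stkE.
  - apply: exec_case; first by rewrite stkE.
    apply: ExecSeq; first by apply: exec_pop; rewrite !stkE.
    apply: ExecSeq; first exact: exec_push_bits.
    by apply: exec_push; rewrite !stkE -bits_cat.
  have sz_rcons (x : A) s : sz (rcons s x) = (sz x + sz s).+1.
    by elim: s => [|y s IHs]; rewrite ?rcons_cons !sz_cons ?IHs ?/sz //=; lia.
  have a0 : 0 < sz a by apply: treesz_gt0.
  by rewrite rev_cons sz_rcons -/(treesz (code a)) -/(sz a); lia.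
have := loop (rev v) [::]; rewrite catrevE revK cats0 => h.
have -> : dst U [:: code v] = stk [::] (bits U (enc (code v))) [::] [::].
  by rewrite /dst /= cats0.
apply: (ExecLeq _ (ExecSeq (exec_push _) h)); last by rewrite map_rev !stkE.
lia.
Qed.

(** The letters of a finite alphabet have codes of bounded size, so bounds in the size of the code
    become bounds in the length of the word. *)
Lemma sz_seq_fin : exists K, forall v : seq A, sz v <= K * size v + 1.
Proof.
exists (\max_(a : A) sz a).+1; elim=> [|a v IH]; first by rewrite muln0.
rewrite sz_cons mulnS.
have am : sz a <= \max_(b : A) sz b by apply: (leq_bigmax (F := fun a : A => sz a)).
move: IH am; set K := (\max_b _); set e := K.+1 * _; lia.
Qed.

Lemma pb_seq_fin (g : seq A -> nat) : pb g ->
  exists c k, forall v, g v <= (c * size v + c) ^ k.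
Proof.
move=> [k gk]; have [K hK] := sz_seq_fin; exists (K + 3), k => v.
apply: leq_trans (gk v) _; case: (k) => // k'; rewrite leq_exp2r //.
by have := hK v; nia.
Qed.

Definition output (i : nat) : cmd G :=
  if onth (enum Y) i is Some y then Push tB (out_sym y) else Skip.

(* Finite types are coded in unary. *)
Fixpoint decode (n i : nat) : cmd G :=
  if n is n'.+1 then
    Case tD (fun x => Seq (Pop tD) (if x == Some (inr true)
      then Seq (Pop tD) (decode n' i.+1) else output i))
  else Skip.

Lemma exec_decode n i (r : nat) d b : r < n ->
  exec (decode n i) (stk [::] (bits U (enc (code r)) ++ d) [::] b) (5 * r + 4)
     (stk [::] d [::] (if onth (enum Y) (i + r) is Some y then out_sym y :: b else b)).
Proof.
elim: n i r => // n IH i [|r] rn.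
  apply: (@ExecLeq _ _ _ (1 + 1).+2) => //.
  apply: exec_case; first by rewrite stkE.
  apply: ExecSeq; first by apply: exec_pop; rewrite !stkE.
  rewrite addn0 /output /=; case: onth => [y|].
    by apply: exec_push; rewrite !stkE.
  by apply: (@ExecLeq _ _ _ 0) => //; apply: ExecSkip.
apply: (@ExecLeq _ _ _ (1 + (1 + (5 * r + 4)).+1).+2); first by lia.
apply: exec_case; first by rewrite stkE.
apply: ExecSeq; first by apply: exec_pop; rewrite !stkE.
apply: ExecSeq; first by apply: exec_pop; rewrite !stkE.
by rewrite -[i + r.+1]addSnnS; apply: IH.
Qed.

Definition unload : cmd G :=
  While tD (fun x => x == Some (inr true)) (Seq (Pop tD) (decode #|Y|.+1 0)).

Lemma exec_unload (w : seq Y) b :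
  exec unload (stk [::] (bits U (enc (code w))) [::] b) (10 * sz w)
     (stk [::] (bits U (enc Leaf)) [::] ([seq out_sym y | y <- rev w] ++ b)).
Proof.
elim: w b => [|y w IH] b.
  by apply: (@ExecLeq _ _ _ 0) => //; apply: ExecDone; rewrite stkE.
rewrite rev_cons map_rcons cat_rcons.
apply: (ExecLeq _ (ExecWhile _ _ (IH _))); last 2 first.
- by rewrite stkE.
- apply: ExecSeq; first by apply: exec_pop; rewrite !stkE.
  have yE : onth (enum Y) (0 + enum_rank y) = Some y.
    by rewrite add0n onthE (nth_map y) ?nth_enum_rank -?cardE ?ltn_ord.
  have yY : enum_rank y < #|Y|.+1 by apply: leq_trans (ltn_ord _) _.
  pose proof (exec_decode 0 (bits U (enc (code w))) b yY) as h.
  by rewrite yE -bits_cat in h; exact: h.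
have yE : sz y = (2 * enum_rank y).+1 by apply: sz_nat.
by rewrite sz_cons; lia.
Qed.

End InputOutput.

Lemma power_poly (a b c k : nat) :
  exists p : {poly nat}, forall n, p.[n]%R = n + a + b * (c * n + c) ^ k.
Proof.
exists ('X + a%:P + b%:P * (c%:P * 'X + c%:P) ^+ k)%R => n.
by rewrite !hornerE.
Qed.

Lemma sm_halts_leq (G : finType) (M : smachine G) s m n s' :
  m <= n -> sm_halts M s m s' -> sm_halts M s n s'.
Proof.
by move=> mn [q [k [km r e]]]; exists q, k; split=> //; apply: leq_trans mn.
Qed.

(** Unloading pushes the first letter of its list first, so that letter ends at the bottom of the
    output stack. Hence the program has to produce the reversed word. *)
Lemma polytime_of_pt (X Y : finType) (f : seq X -> seq Y) :
  pt (fun w => rev (f w)) -> polytime f.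
Proof.
move=> [[k fk] /(_ (X + Y)%type) [c [T [pT cT]]]].
pose G := ((X + Y) + bool)%type.
pose (prog := Seq (load Y) (Seq c (unload X Y))).
pose ann (x : X) : {set G} := [set in_sym Y x].
pose one : G := inr true.
pose M := tm (compile prog) ann one.
pose (n := fun w => (5 * sz w + 2 + (T w + 10 * sz (rev (f w))).+1).+1).
have [c0 [k0 nk]] : exists c0 k0, forall v : seq X, n v <= (c0 * size v + c0) ^ k0.
  apply: pb_seq_fin; rewrite /n.
  have pf : pb (fun w => sz (rev (f w))) by exists k.
  by pb_auto.
have [p pE] := power_poly 2 2 c0 k0.
have annE w v : annotates ann w v -> v = [seq in_sym Y x | x <- w].
  elim: w v => [|x w IH] [|g v] //= /andP[]; rewrite in_set1 => /eqP-> /IH ->.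
  by [].
have annw w : annotates ann w [seq in_sym Y x | x <- w].
  by elim: w => //= x w ->; rewrite set11.
have hl w : sm_halts (compile prog) (input_stacks [seq in_sym Y x | x <- w])
    ((c0 * size w + c0) ^ k0)
    (stk [::] (bits (X + Y)%type (enc Leaf)) [::] [seq out_sym X y | y <- f w]).
  apply: (sm_halts_leq (nk w)); apply: compile_correct.
  apply: ExecSeq; first exact: exec_load.
  apply: ExecSeq; first exact: (cT w [::]).
  pose proof (exec_unload (A := X) (rev (f w)) [::]) as h.
  by rewrite revK cats0 in h; rewrite /dst /= cats0; exact: h.
exists M, inl, (fun y => inr (out_sym X y)), p; split.
- by apply: tm_deterministic => x; rewrite cards1.
- by move=> x y [].
- by move=> x y [].
- move=> w; rewrite pE.
  have := @tm_runs_within X G (compile prog) ann one w ((c0 * size w + c0) ^ k0).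
  move=> h m d r; apply: leq_trans (h _ m d r) _.
    by move=> v /annE ->; eexists; exact: hl.
  by lia.
- move=> w.
  have [m [d [r hd _ o]]] := tm_computes one (annw w) (hl w).
  exists m, d; split=> //; rewrite o -/tB stkB.
  by rewrite -map_comp.
Qed.

(** The certificate has one bit per letter, guessed while that letter is copied: [ann x] contains
    [x] paired with either bit. *)
Lemma in_NP_of_pt (X : finType) (L : seq X -> Prop) (V : seq (X * bool) -> bool) :
  pt V ->
  (forall w, L w <-> exists2 bs : seq bool, size bs = size w & V (zip w bs)) ->
  in_NP L.
Proof.
move=> [[k fk] /(_ (X * bool + bool)%type) [c [T [pT cT]]]] LV.
pose G := ((X * bool + bool) + bool)%type.
pose (prog := Seq (load (A := (X * bool)%type) bool) c).
pose ann (x : X) : {set G} := [set in_sym bool (x, b) | b : bool].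
pose one : G := inr true.
pose M := tm (compile prog) ann one.
pose (n := fun w => (5 * sz w + 2 + T w).+1).
have [c0 [k0 nk]] : exists c0 k0, forall v : seq (X * bool), n v <= (c0 * size v + c0) ^ k0.
  by apply: pb_seq_fin; rewrite /n; pb_auto.
have [p pE] := power_poly 2 2 c0 k0.
have annE w v : annotates ann w v -> exists2 bs, size bs = size w &
    v = [seq in_sym bool x | x <- zip w bs].
  elim: w v => [|x w IH] [|g v] //=; first by exists [::].
  case/andP=> /imsetP[b _ ->] /IH[bs sb ->].
  by exists (b :: bs); rewrite /= ?sb.
have annw w bs : size bs = size w -> annotates ann w [seq in_sym bool x | x <- zip w bs].
  elim: w bs => [|x w IH] [|b bs] //= [/IH] h; rewrite /annotates /= in h *.
  by rewrite h andbT; apply/imsetP; exists b.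
have hl w : sm_halts (compile prog) (input_stacks [seq in_sym bool x | x <- w])
    ((c0 * size w + c0) ^ k0) (dst (X * bool + bool)%type [:: code (V w)]).
  apply: (sm_halts_leq (nk w)); apply: compile_correct.
  by apply: ExecSeq; [exact: exec_load | exact: (cT w [::])].
have topE w : (ohead (dst (X * bool + bool)%type [:: code (V w)] tD) == Some one) = V w.
  by rewrite stkD; case: (V w).
exists M, inl, p; split.
- by move=> x y [].
- move=> w; rewrite pE.
  have := @tm_runs_within X G (compile prog) ann one w ((c0 * size w + c0) ^ k0).
  move=> h m d r; apply: leq_trans (h _ m d r) _.
    move=> v /annE[bs sb ->]; eexists; have := hl (zip w bs).
    by rewrite size_zip sb minnn; exact.
  by lia.
move=> w; rewrite LV; split.
- move=> [bs sb Vw].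
  have [m [d [r hd st _]]] := tm_computes one (annw _ _ sb) (hl (zip w bs)).
  by exists m, d; split=> //; rewrite st -/tD topE Vw in_set1.
(* [tm_accepts] wants the final stacks as a function of arbitrary stack contents, so the tagged
   letters are first translated back. *)
- pose unsym (g : G) : option (X * bool) := if g is inl (inl a) then Some a else None.
  pose (F := fun v : seq G => dst (X * bool + bool)%type [:: code (V (pmap unsym v))]).
  have FE u : F [seq in_sym bool x | x <- u] = dst (X * bool + bool)%type [:: code (V u)].
    by rewrite /F; congr (dst _ [:: code (V _)]); elim: u => //= x u ->.
  move/(@tm_accepts X G (compile prog) ann one w ((c0 * size w + c0) ^ k0) F).
  case=> [v /annE[bs sb ->]|v /annE[bs sb ->]].
    by rewrite FE; have := hl (zip w bs); rewrite size_zip sb minnn.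
  by rewrite FE -/tD => /eqP; rewrite topE => Vw; exists bs.
Qed.

(** * A library of polynomial-time operations *)

Lemma pb_leq_sz A {cA : Code A} (g : A -> nat) : (forall a, g a <= sz a) -> pb g.
Proof. by move=> h; apply: pb_leq h pb_sz. Qed.

Lemma sz_nil A {cA : Code A} : sz (@nil A) = 1.
Proof. by []. Qed.

Section Projections.

Context {A B D : Type} {cA : Code A} {cB : Code B} {cD : Code D}.

(** The code of a pair is always a [Node], so both projections are case analyses with [Some] as
    view. *)
Lemma pt_proj (f : A -> B * D) :
  pt f -> pt (fun a => (f a).1) /\ pt (fun a => (f a).2).
Proof.
move=> pf.
have s1 : pb (fun p : B * D => sz p.1).
  by apply: pb_leq_sz => p; rewrite sz_pair; lia.
have s2 : pb (fun p : B * D => sz p.2).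
  by apply: pb_leq_sz => p; rewrite sz_pair; lia.
have ss : pb (fun p : B * D => sz p) by apply: pb_sz.
have t1 : pb (fun p : B * D * (B * D) => sz p.2.1).
  by apply: pb_leq_sz => p; rewrite !sz_pair; lia.
have t2 : pb (fun p : B * D * (B * D) => sz p.2.2).
  by apply: pb_leq_sz => p; rewrite !sz_pair; lia.
split; (apply: pt_comp; last exact: pf); split=> // U.
- apply: (does_ext _ _ (does_case (view := Some) (f := fun _ => [::])
    (r0 := fun _ => [::]) (r1 := fun p => [:: code p.2.1]) _ ss _ _)) => //.
    exact: does_id.
  apply: does_trans (does_swp _ _ t1 t2) _.
  exact: does_drop t2.
- apply: (does_ext _ _ (does_case (view := Some) (f := fun _ => [::])
    (r0 := fun _ => [::]) (r1 := fun p => [:: code p.2.2]) _ ss _ _)) => //.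
    exact: does_id.
  exact: does_drop t1.
Qed.

Lemma pt_fst (f : A -> B * D) : pt f -> pt (fun a => (f a).1).
Proof. by case/pt_proj. Qed.

Lemma pt_snd (f : A -> B * D) : pt f -> pt (fun a => (f a).2).
Proof. by case/pt_proj. Qed.

End Projections.

Section Constructors.

Context {A B D : Type} {cA : Code A} {cB : Code B} {cD : Code D}.

Lemma pt_cons (x : A -> B) (s : A -> seq B) :
  pt x -> pt s -> pt (fun a => x a :: s a).
Proof.
by move=> px ps; apply: (pt_recode (f := fun a => (x a, s a))); last exact: pt_pair.
Qed.

Lemma pt_some (x : A -> B) : pt x -> pt (fun a => Some (x a)).
Proof.
move=> px; apply: (pt_recode (f := fun a => (tt, x a))) => //.
exact: pt_pair (pt_const tt) px.
Qed.

Lemma pt_succn (n : A -> nat) : pt n -> pt (fun a => (n a).+1).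
Proof.
move=> pn; apply: (pt_recode (f := fun a => (tt, n a))) => //.
exact: pt_pair (pt_const tt) pn.
Qed.

Lemma pt_case_seq (l : A -> seq B) (f0 : A -> D) (f1 : A -> B -> seq B -> D) :
  pt l -> pt f0 -> pt (fun u : A * (B * seq B) => f1 u.1 u.2.1 u.2.2) ->
  pt (fun a => if l a is x :: s then f1 a x s else f0 a).
Proof.
move=> pl p0 p1.
apply: (pt_ext _ (pt_case (view := fun s : seq B => if s is x :: s' then Some (x, s')
  else None) _ pl p0 p1)).
  by move=> a; case: (l a).
by case.
Qed.

Lemma pt_case_nat (n : A -> nat) (f0 : A -> D) (f1 : A -> nat -> D) :
  pt n -> pt f0 -> pt (fun u : A * nat => f1 u.1 u.2) ->
  pt (fun a => if n a is m.+1 then f1 a m else f0 a).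
Proof.
move=> pn p0 p1.
have p1' : pt (fun u : A * (unit * nat) => f1 u.1 u.2.2).
  by apply: (pt_comp (g := fun u : A * (unit * nat) => (u.1, u.2.2)) p1);
    apply: pt_pair; [apply: pt_fst | do 2!apply: pt_snd]; apply: pt_id.
apply: (pt_ext _ (pt_case (view := fun m => if m is m'.+1 then Some (tt, m')
  else None) _ pn p0 p1')).
  by move=> a; case: (n a).
by case.
Qed.

Lemma pt_case_option (o : A -> option B) (f0 : A -> D) (f1 : A -> B -> D) :
  pt o -> pt f0 -> pt (fun u : A * B => f1 u.1 u.2) ->
  pt (fun a => if o a is Some x then f1 a x else f0 a).
Proof.
move=> po p0 p1.
have p1' : pt (fun u : A * (unit * B) => f1 u.1 u.2.2).
  by apply: (pt_comp (g := fun u : A * (unit * B) => (u.1, u.2.2)) p1);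
    apply: pt_pair; [apply: pt_fst | do 2!apply: pt_snd]; apply: pt_id.
apply: (pt_ext _ (pt_case (view := fun x : option B => if x is Some y then Some (tt, y)
  else None) _ po p0 p1')).
  by move=> a; case: (o a).
by case.
Qed.

Lemma pt_if (b : A -> bool) (f1 f0 : A -> D) :
  pt b -> pt f1 -> pt f0 -> pt (fun a => if b a then f1 a else f0 a).
Proof.
move=> pb p1 p0.
have p1' : pt (fun u : A * (unit * unit) => f1 u.1).
  by apply: (pt_comp p1); apply: pt_fst; apply: pt_id.
apply: (pt_ext _ (pt_case (view := fun x : bool => if x then Some (tt, tt)
  else None) _ pb p0 p1')).
  by move=> a; case: (b a).
by case.
Qed.

End Constructors.

(** A hook for [pt_step], redefined once the list and number operations are available. *)
Ltac pt_more := fail.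

Ltac pt_step := first [match goal with
  | H : pt ?f |- pt ?f => exact: H
  | |- pt (fun a => a) => exact: pt_id
  | |- pt fst => exact: (pt_fst pt_id)
  | |- pt snd => exact: (pt_snd pt_id)
  | |- pt (fun _ => ?b) => exact: (pt_const b)
  | |- pt (fun a => (@?f a, @?g a)) => apply: (pt_pair (f := f) (g := g))
  | |- pt (fun a => fst (@?f a)) => apply: (pt_fst (f := f))
  | |- pt (fun a => snd (@?f a)) => apply: (pt_snd (f := f))
  | |- pt (fun a => @?f a :: @?g a) => apply: (pt_cons (x := f) (s := g))
  | |- pt (fun a => Some (@?f a)) => apply: (pt_some (x := f))
  | |- pt (fun a => S (@?f a)) => apply: (pt_succn (n := f))
  | |- pt (fun a => if _ then _ else _) => apply: pt_if
  end | pt_more].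

Ltac pt_auto := repeat (pt_step; cbv beta).

(** Each value of the index may have a program of its own, selected by nested case analyses; [minn]
    lets all numbers from [N] on share the last program. *)
Lemma pt_dispatch A B {cA : Code A} {cB : Code B} (F : nat -> A -> B) (n : A -> nat) N :
  (forall i, pt (F i)) -> pt n -> pt (fun a => F (minn (n a) N) a).
Proof.
elim: N A cA F n => [|N IH] A cA F n pF pn.
  by apply: pt_ext (pF 0) => a; rewrite minn0.
have pF' : pt (fun u : A * nat => F (minn u.2 N).+1 u.1).
  apply: (IH _ _ (fun i u => F i.+1 u.1) (fun u => u.2)); last by pt_auto.
  by move=> i; apply: (pt_comp (g := fun u : A * nat => u.1) (pF i.+1)); pt_auto.
apply: (pt_ext _ (pt_case_nat (f1 := fun a m => F (minn m N).+1 a) pn (pF 0) pF')).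
by move=> a; case: (n a) => [|m]; rewrite ?min0n // minnSS.
Qed.

Lemma pt_fin A B (X : finType) {cA : Code A} {cB : Code B} (F : X -> A -> B)
    (x : A -> X) :
  (forall y, pt (F y)) -> pt x -> pt (fun a => F (x a) a).
Proof.
move=> pF px.
have pn : pt (fun a => enum_rank (x a) : nat) by apply: pt_recode px.
(* If [X] is empty then so is [A], and any program will do. *)
have [y0 _|noX] := pickP (xpredT : pred X); last first.
  have noA : A -> False by move=> a; move: (noX (x a)).
  split; first by exists 0 => a; case: (noA a).
  by move=> U; exists Skip, (fun _ => 0); split=> [|a]; [pb_auto | case: (noA a)].
have pF' i : pt (F (nth y0 (enum X) i)) by apply: pF.
apply: (pt_ext _ (pt_dispatch #|X| pF' pn)) => a.
by rewrite (minn_idPl _) ?nth_enum_rank // ltnW.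
Qed.

Section Iterate.

Context {A : Type} {cA : Code A}.

Lemma pt_iter S {cS : Code S} (n : A -> nat) (s : A -> S) (g : S -> S) (N : A -> nat) :
  pt n -> pt s -> pt g -> pb N ->
  (forall a i, i <= n a -> sz (iter i g (s a)) <= N a) ->
  pt (fun a => iter (n a) g (s a)).
Proof.
move=> pn ps pg pN bN.
have bN' a i : i <= spine (code (n a)) -> sz (iter i g (s a)) <= N a.
  by rewrite spine_nat; apply: bN.
apply: pt_ext (pt_iter_spine pn ps pg pN bN') => a.
by rewrite spine_nat.
Qed.

Context {X Z : Type} {cX : Code X} {cZ : Code Z}.

(** The state carries the parameter [a] because the body of an iteration sees nothing but the
    state. *)
Definition fold_step (g : A * (Z * X) -> Z) (u : A * (Z * seq X)) :=
  if u.2.2 is x :: s then (u.1, (g (u.1, (u.2.1, x)), s)) else u.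

Lemma iter_fold_step g i a z s : iter i (fold_step g) (a, (z, s)) =
  (a, (foldl (fun z x => g (a, (z, x))) z (take i s), drop i s)).
Proof.
elim: i z s => [|i IH] z s; first by rewrite take0 drop0.
rewrite iterSr; case: s => [|x s]; rewrite /fold_step /=; last exact: IH.
by rewrite IH /=.
Qed.

Lemma sz_drop i (s : seq X) : sz (drop i s) <= sz s.
Proof.
elim: s i => [|x s IH] [|i] //=; rewrite sz_cons.
by apply: leq_trans (IH i) _; lia.
Qed.

Lemma pt_foldl (g : A -> Z -> X -> Z) (z : A -> Z) (s : A -> seq X) (N : A -> nat) :
  pt (fun u : A * (Z * X) => g u.1 u.2.1 u.2.2) -> pt z -> pt s -> pb N ->
  (forall a i, i <= size (s a) -> sz (foldl (g a) (z a) (take i (s a))) <= N a) ->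
  pt (fun a => foldl (g a) (z a) (s a)).
Proof.
move=> pg pz ps pN bN.
set gu := fun u : A * (Z * X) => g u.1 u.2.1 u.2.2.
have pstep : pt (fold_step gu).
  apply: (@pt_case_seq _ X _ _ _ _ (fun u : A * (Z * seq X) => u.2.2)
    (fun u => u) (fun u x s => (u.1, (g u.1 u.2.1 x, s)))).
  - by pt_auto.
  - by pt_auto.
  - apply: pt_pair; first by pt_auto.
    apply: pt_pair; last by pt_auto.
    apply: (pt_comp (g := fun u : A * (Z * seq X) * (X * seq X) =>
      (u.1.1, (u.1.2.1, u.2.1))) pg).
    by pt_auto.
have ss := pt_sz ps.
have bstep a i : i <= spine (code (s a)) ->
    sz (iter i (fold_step gu) (a, (z a, s a))) <= (sz a + (N a + sz (s a)).+1).+1.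
  rewrite spine_seq => /bN h; rewrite iter_fold_step !sz_pair /=.
  have d : sz (drop i (s a)) <= sz (s a) by apply: sz_drop.
  rewrite -[foldl (g a) _ _]/(foldl (fun z x => gu (a, (z, x))) _ _) in h.
  by lia.
have pN' : pb (fun a => (sz a + (N a + sz (s a)).+1).+1) by pb_auto.
have pini : pt (fun a => (a, (z a, s a))) by pt_auto.
have pit := pt_iter_spine ps pini pstep pN' bstep.
apply: (pt_ext _ (pt_fst (pt_snd pit))) => a.
by rewrite spine_seq iter_fold_step take_size.
Qed.

Lemma pt_foldl_add (g : A -> Z -> X -> Z) (z : A -> Z) (s : A -> seq X) (B : A -> nat) :
  pt (fun u : A * (Z * X) => g u.1 u.2.1 u.2.2) -> pt z -> pt s -> pb B ->
  (forall a z x, sz x <= sz (s a) -> sz (g a z x) <= sz z + B a) ->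
  pt (fun a => foldl (g a) (z a) (s a)).
Proof.
move=> pg pz ps pB gB; have sz' := pt_sz pz; have ss := pt_sz ps.
apply: (pt_foldl (N := fun a => sz (z a) + sz (s a) * B a)) => //.
  by pb_auto.
move=> a i _; set y := z a.
have sB (u : seq X) : size u * B a <= sz u * B a.
  by rewrite leq_mul2r (ltnW (size_sz u)) orbT.
have : sz (take i (s a)) <= sz (s a).
  elim: (s a) i => [|x u IH] [|i] //=; rewrite ?sz_nil ?sz_cons //.
  by have := IH i; lia.
move: (take i (s a)) => u us; apply: (@leq_trans (sz y + size u * B a)); last first.
  rewrite leq_add2l; apply: leq_trans (sB u) _.
  by rewrite leq_mul2r us orbT.
elim: u y us => [|x u IH] y /=; first by rewrite addn0.
rewrite sz_cons => us.
apply: leq_trans (IH _ _) _; first by lia.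
have xs : sz x <= sz (s a) by lia.
by have := gB a y x xs; rewrite mulSn; lia.
Qed.

End Iterate.

Lemma pt_rev A X {cA : Code A} {cX : Code X} (s : A -> seq X) : pt s -> pt (fun a => rev (s a)).
Proof.
move=> ps; have ss := pt_sz ps.
apply: (pt_ext (f := fun a => foldl (fun z x => x :: z) [::] (s a))).
  by move=> a; rewrite -[in LHS](revK (s a)) foldl_rev; elim: (rev _) => //= x u ->.
apply: (pt_foldl_add (B := fun a => (sz (s a)).+1)) => //; try by pt_auto.
  by pb_auto.
by move=> a z x xs; rewrite sz_cons; lia.
Qed.

Lemma pt_cat A X {cA : Code A} {cX : Code X} (s t : A -> seq X) : pt s -> pt t -> pt (fun a => s a ++ t a).
Proof.
move=> ps pt'; have prs := pt_rev ps; have ss := pt_sz prs.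
apply: (pt_ext (f := fun a => foldl (fun z x => x :: z) (t a) (rev (s a)))).
  by move=> a; rewrite foldl_rev; elim: (s a) => //= x u ->.
apply: (pt_foldl_add (B := fun a => (sz (rev (s a))).+1)) => //; try by pt_auto.
  by pb_auto.
by move=> a z x xs; rewrite sz_cons; lia.
Qed.

Lemma pt_map A B X {cA : Code A} {cB : Code B} {cX : Code X} (f : A -> X -> B) (s : A -> seq X) :
  pt (fun u : A * X => f u.1 u.2) -> pt s -> pt (fun a => [seq f a x | x <- s a]).
Proof.
move=> pf ps; have prs := pt_rev ps; have ss := pt_sz prs.
have [k fk] := pt_sz pf.
apply: (pt_ext (f := fun a => foldl (fun z x => f a x :: z) [::] (rev (s a)))).
  by move=> a; rewrite foldl_rev; elim: (s a) => //= x u ->.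
apply: (pt_foldl_add (B := fun a => (((sz a + sz (rev (s a))).+1 + 2) ^ k).+1)) => //.
- apply: pt_cons; last by pt_auto.
  by apply: (pt_comp (g := fun u : A * (seq B * X) => (u.1, u.2.2)) pf); pt_auto.
- by pt_auto.
- by pb_auto.
move=> a z x xs; rewrite sz_cons.
have := fk (a, x); rewrite sz_pair /= => h.
apply: (@leq_trans (((sz a + sz x).+1 + 2) ^ k + sz z).+1); first by lia.
have : ((sz a + sz x).+1 + 2) ^ k <= ((sz a + sz (rev (s a))).+1 + 2) ^ k.
  by case: (k) => // k'; rewrite leq_exp2r //; lia.
lia.
Qed.

Lemma sz_cat X {cX : Code X} (s t : seq X) : sz (s ++ t) <= sz s + sz t.
Proof. by elim: s => [|y u IH] /=; rewrite ?sz_cons; lia. Qed.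

Lemma pt_flatten A X {cA : Code A} {cX : Code X} (s : A -> seq (seq X)) : pt s -> pt (fun a => flatten (s a)).
Proof.
move=> ps; have prs := pt_rev ps; have ss := pt_sz prs.
apply: (pt_ext (f := fun a => foldl (fun z x => x ++ z) [::] (rev (s a)))).
  by move=> a; rewrite foldl_rev.
apply: (pt_foldl_add (B := fun a => sz (rev (s a)))) => //; try by pt_auto.
  by apply: pt_cat; pt_auto.
move=> a z x xs.
by apply: leq_trans (sz_cat x z) _; lia.
Qed.

Lemma pt_size A X {cA : Code A} {cX : Code X} (s : A -> seq X) : pt s -> pt (fun a => size (s a)).
Proof.
move=> ps; apply: (pt_recode (f := fun a => [seq tt | _ <- s a])).
  by move=> a; elim: (s a) => //= x u IH; congr Node.
by apply: pt_map ps; pt_auto.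
Qed.

Lemma pt_units A {cA : Code A} (n : A -> nat) : pt n -> pt (fun a => nseq (n a) tt).
Proof. by apply: pt_recode => a; elim: (n a) => //= m IH; congr Node. Qed.

Lemma pt_nseq A X {cA : Code A} {cX : Code X} (n : A -> nat) (x : A -> X) :
  pt n -> pt x -> pt (fun a => nseq (n a) (x a)).
Proof.
move=> pn px; apply: (pt_ext (f := fun a => [seq x a | _ <- nseq (n a) tt])).
  by move=> a; elim: (n a) => //= m ->.
apply: pt_map (pt_units pn).
by apply: (pt_comp (g := fun u : A * unit => u.1) px); pt_auto.
Qed.

Lemma pt_addn A {cA : Code A} (m n : A -> nat) : pt m -> pt n -> pt (fun a => m a + n a).
Proof.
move=> pm pn; apply: (pt_ext (f := fun a => size (nseq (m a) tt ++ nseq (n a) tt))).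
  by move=> a; rewrite size_cat !size_nseq.
by apply: pt_size; apply: pt_cat; apply: pt_units.
Qed.

Lemma pt_muln A {cA : Code A} (m n : A -> nat) : pt m -> pt n -> pt (fun a => m a * n a).
Proof.
move=> pm pn.
apply: (pt_ext (f := fun a => size (flatten (nseq (m a) (nseq (n a) tt))))).
  by move=> a; elim: (m a) => //= k; rewrite size_cat size_nseq mulSn => ->.
by apply: pt_size; apply: pt_flatten; apply: pt_nseq => //; apply: pt_units.
Qed.

(** The list under construction is its own counter: its length is the next number to be prefixed. *)
Lemma pt_iota A {cA : Code A} (m n : A -> nat) : pt m -> pt n -> pt (fun a => iota (m a) (n a)).
Proof.
move=> pm pn; have sn := pt_sz pn.
apply: (pt_ext (f := fun a => [seq m a + i | i <- rev (iter (n a) (fun z => size z :: z) [::])])).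
  move=> a; rewrite -[in RHS](addn0 (m a)) iotaDl; congr map.
  elim: (n a) => // k IH; rewrite iterS rev_cons {}IH.
  have -> : size (iter k (fun z => size z :: z) [::]) = k.
    by elim: (k) => //= i ->.
  by rewrite -cats1 -[in RHS](addn1 k) iotaD.
apply: pt_map.
  apply: pt_addn; last by pt_auto.
  by apply: (pt_comp (g := fun u : A * nat => u.1) pm); pt_auto.
apply: pt_rev.
apply: (pt_iter (N := fun a => sz (n a) * (2 * sz (n a) + 2) + 1)) => //.
- by pt_auto.
- by apply: pt_cons; [apply: pt_size | ]; pt_auto.
- by pb_auto.
move=> a i ni; rewrite (sz_nat (n a)).
apply: (@leq_trans (i * (2 * i + 2) + 1)); last by nia.
elim: i {ni} => // i IH; rewrite iterS sz_cons.
have -> : size (iter i (fun z => size z :: z) [::]) = i.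
  by elim: (i) => //= j ->.
by rewrite sz_nat; nia.
Qed.

Lemma pt_predn A {cA : Code A} (n : A -> nat) : pt n -> pt (fun a => (n a).-1).
Proof.
move=> pn; apply: (pt_ext (f := fun a => if n a is m.+1 then m else 0)).
  by move=> a; case: (n a).
by apply: (pt_case_nat (f1 := fun _ m => m) pn); pt_auto.
Qed.

Lemma pt_subn A {cA : Code A} (m n : A -> nat) : pt m -> pt n -> pt (fun a => m a - n a).
Proof.
move=> pm pn; have sm := pt_sz pm.
have subE a i : iter i predn (m a) = m a - i.
  by elim: i => [|i IH]; rewrite ?subn0 // iterS IH subnS.
apply: (pt_ext (f := fun a => iter (n a) predn (m a))) => [a|].
  by rewrite subE.
apply: (pt_iter (N := fun a => sz (m a))) => //.
  by apply: pt_predn; pt_auto.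
by move=> a i _; rewrite subE !sz_nat; lia.
Qed.

Lemma pt_eq0 A {cA : Code A} (n : A -> nat) : pt n -> pt (fun a => n a == 0).
Proof.
move=> pn; apply: (pt_ext (f := fun a => if n a is m.+1 then false else true)).
  by move=> a; case: (n a).
by apply: (pt_case_nat (f1 := fun _ m => false) pn); pt_auto.
Qed.

Lemma pt_leq A {cA : Code A} (m n : A -> nat) : pt m -> pt n -> pt (fun a => m a <= n a).
Proof. by move=> pm pn; apply: pt_eq0; apply: pt_subn. Qed.

Lemma pt_andb A {cA : Code A} (b c : A -> bool) : pt b -> pt c -> pt (fun a => b a && c a).
Proof. by move=> pb pc; apply: pt_if => //; pt_auto. Qed.

Lemma pt_orb A {cA : Code A} (b c : A -> bool) : pt b -> pt c -> pt (fun a => b a || c a).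
Proof. by move=> pb pc; apply: pt_if => //; pt_auto. Qed.

Lemma pt_negb A {cA : Code A} (b : A -> bool) : pt b -> pt (fun a => ~~ b a).
Proof. by move=> pb; apply: pt_if => //; pt_auto. Qed.

Lemma pt_eqn A {cA : Code A} (m n : A -> nat) : pt m -> pt n -> pt (fun a => m a == n a).
Proof.
move=> pm pn; apply: (pt_ext (f := fun a => (m a <= n a) && (n a <= m a))).
  by move=> a; rewrite eqn_leq.
by apply: pt_andb; apply: pt_leq.
Qed.

Lemma pt_all A X {cA : Code A} {cX : Code X} (p : A -> X -> bool) (s : A -> seq X) :
  pt (fun u : A * X => p u.1 u.2) -> pt s -> pt (fun a => all (p a) (s a)).
Proof.
move=> pp ps.
apply: (pt_ext (f := fun a => foldl (fun z x => z && p a x) true (s a))).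
  move=> a; have h b : foldl (fun z x => z && p a x) b (s a) = b && all (p a) (s a).
    elim: (s a) b => [|x u IH] b /=; first by rewrite andbT.
    by rewrite IH andbA.
  by rewrite h.
apply: (pt_foldl (N := fun _ => 3)); try by pt_auto.
- apply: pt_andb; first by pt_auto.
  by apply: (pt_comp (g := fun u : A * (bool * X) => (u.1, u.2.2)) pp); pt_auto.
- by pb_auto.
- by move=> a i _; apply: sz_bool.
Qed.

Lemma pt_has A X {cA : Code A} {cX : Code X} (p : A -> X -> bool) (s : A -> seq X) :
  pt (fun u : A * X => p u.1 u.2) -> pt s -> pt (fun a => has (p a) (s a)).
Proof.
move=> pp ps; apply: (pt_ext (f := fun a => ~~ all (fun x => ~~ p a x) (s a))).
  by move=> a; rewrite -[LHS]/(~~ all (predC (p a)) (s a)) all_predC negbK.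
by apply: pt_negb; apply: pt_all => //; apply: pt_negb.
Qed.

Lemma pt_zip A X Y {cA : Code A} {cX : Code X} {cY : Code Y} (s : A -> seq X) (t : A -> seq Y) :
  pt s -> pt t -> pt (fun a => zip (s a) (t a)).
Proof.
move=> ps pt'; have ss := pt_sz ps.
pose g (z : seq Y * seq (X * Y)) (x : X) :=
  if z.1 is y :: u then (u, (x, y) :: z.2) else z.
apply: (pt_ext (f := fun a => rev (foldl g (t a, [::]) (s a)).2)).
  move=> a; have h v : rev (foldl g (t a, v) (s a)).2 = rev v ++ zip (s a) (t a).
    elim: (s a) (t a) v => [|x u IH] [|y w] v /=; rewrite ?cats0 //.
      by rewrite [g _ _]/= IH; case: (u) => [|? ?]; rewrite /= cats0.
    by rewrite [g _ _]/= IH rev_cons cat_rcons.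
  exact: h.
apply: pt_rev; apply: pt_snd.
apply: (pt_foldl_add (B := fun a => (sz (s a)).+1)) => //.
- apply: (@pt_case_seq _ Y _ _ _ _
    (fun u : A * ((seq Y * seq (X * Y)) * X) => u.2.1.1) (fun u => u.2.1)
    (fun u y w => (w, (u.2.2, y) :: u.2.1.2))); by pt_auto.
- by pt_auto.
- by pb_auto.
move=> a [[|y u] v] x xs; rewrite /g !sz_pair /=; first by lia.
by rewrite !sz_cons sz_pair /=; lia.
Qed.

Lemma pt_take A X {cA : Code A} {cX : Code X} (n : A -> nat) (s : A -> seq X) :
  pt n -> pt s -> pt (fun a => take (n a) (s a)).
Proof.
move=> pn ps; apply: (pt_ext (f := fun a => [seq p.1 | p <- zip (s a) (nseq (n a) tt)])).
  by move=> a; elim: (s a) (n a) => [|x u IH] [|m] //=; rewrite IH.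
apply: pt_map; first by pt_auto.
by apply: pt_zip => //; apply: pt_units.
Qed.

Lemma pt_behead A X {cA : Code A} {cX : Code X} (s : A -> seq X) : pt s -> pt (fun a => behead (s a)).
Proof.
move=> ps; apply: (pt_ext (f := fun a => if s a is _ :: u then u else [::])).
  by move=> a; case: (s a).
by apply: (pt_case_seq (f1 := fun _ _ u => u) ps); pt_auto.
Qed.

Lemma pt_drop A X {cA : Code A} {cX : Code X} (n : A -> nat) (s : A -> seq X) :
  pt n -> pt s -> pt (fun a => drop (n a) (s a)).
Proof.
move=> pn ps; have ss := pt_sz ps.
have dropE a i : iter i behead (s a) = drop i (s a).
  by elim: i (s a) => [|i IH] u; rewrite ?drop0 // iterSr IH; case: u.
apply: (pt_ext (f := fun a => iter (n a) behead (s a))) => //.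
apply: (pt_iter (N := fun a => sz (s a))) => //.
  by apply: pt_behead; pt_auto.
by move=> a i _; rewrite dropE; apply: sz_drop.
Qed.

(** Here [s] is a fixed list, not data, and each of its elements may have its own program. It is
    meant for enumerations of states, actions and symbols of a fixed machine. *)
Lemma pt_map_const A B (T : Type) {cA : Code A} {cB : Code B} (f : T -> A -> B)
    (s : seq T) :
  (forall x, pt (f x)) -> pt (fun a => [seq f x a | x <- s]).
Proof.
move=> pf; elim: s => [|x s IH] /=; first by pt_auto.
exact: pt_cons.
Qed.

Lemma pt_nth A X {cA : Code A} {cX : Code X} (x0 : X) (s : A -> seq X) (n : A -> nat) :
  pt s -> pt n -> pt (fun a => nth x0 (s a) (n a)).
Proof.
move=> ps pn; apply: (pt_ext (f := fun a => if drop (n a) (s a) is x :: _ then x else x0)).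
  by move=> a; elim: (s a) (n a) => [|x u IH] [|m] //=; rewrite ?IH ?drop0 //.
by apply: (pt_case_seq (f1 := fun _ x _ => x)); [exact: pt_drop | |]; pt_auto.
Qed.

Lemma pt_eq_bits A {cA : Code A} (s t : A -> seq bool) :
  pt s -> pt t -> pt (fun a => s a == t a).
Proof.
move=> ps pt'.
apply: (pt_ext (f := fun a => (size (s a) == size (t a)) &&
    all (fun p => if p.1 then p.2 else ~~ p.2) (zip (s a) (t a)))).
  move=> a; elim: (s a) (t a) => [|x u IH] [|y v] //=; rewrite eqSS eqseq_cons -IH.
  by case: x; case: y; rewrite ?andbF.
apply: pt_andb; first by apply: pt_eqn; apply: pt_size.
apply: pt_all; last exact: pt_zip.
by pt_auto; apply: pt_negb; pt_auto.
Qed.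

Ltac pt_more ::= match goal with
  | |- pt (fun a => rev (@?f a)) => apply: (pt_rev (s := f))
  | |- pt (fun a => @?f a ++ @?g a) => apply: (pt_cat (s := f) (t := g))
  | |- pt (fun a => flatten (@?f a)) => apply: (pt_flatten (s := f))
  | |- pt (fun a => size (@?f a)) => apply: (pt_size (s := f))
  | |- pt (fun a => nseq (@?f a) (@?g a)) => apply: (pt_nseq (n := f) (x := g))
  | |- pt (fun a => iota (@?f a) (@?g a)) => apply: (pt_iota (m := f) (n := g))
  | |- pt (fun a => zip (@?f a) (@?g a)) => apply: (pt_zip (s := f) (t := g))
  | |- pt (fun a => take (@?f a) (@?g a)) => apply: (pt_take (n := f) (s := g))
  | |- pt (fun a => drop (@?f a) (@?g a)) => apply: (pt_drop (n := f) (s := g))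
  | |- pt (fun a => behead (@?f a)) => apply: (pt_behead (s := f))
  | |- pt (fun a => addn (@?f a) (@?g a)) => apply: (pt_addn (m := f) (n := g))
  | |- pt (fun a => muln (@?f a) (@?g a)) => apply: (pt_muln (m := f) (n := g))
  | |- pt (fun a => subn (@?f a) (@?g a)) => apply: (pt_subn (m := f) (n := g))
  | |- pt (fun a => leq (@?f a) (@?g a)) => apply: (pt_leq (m := f) (n := g))
  | |- pt (fun a => andb (@?f a) (@?g a)) => apply: (pt_andb (b := f) (c := g))
  | |- pt (fun a => orb (@?f a) (@?g a)) => apply: (pt_orb (b := f) (c := g))
  | |- pt (fun a => negb (@?f a)) => apply: (pt_negb (b := f))
  | |- pt (fun a => map (fun x => @?f a x) _) => apply: (pt_map (f := f))
  | |- pt (fun a => all (fun x => @?f a x) _) => apply: (pt_all (p := f))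
  | |- pt (fun a => has (fun x => @?f a x) _) => apply: (pt_has (p := f))
  | |- pt (fun a => nth _ (@?f a) (@?g a)) => apply: (pt_nth _ (s := f) (n := g))
  | |- pt (fun a => predn (@?f a)) => apply: (pt_predn (n := f))
  | |- pt (fun a => eq_op (@?f a) 0) => apply: (pt_eq0 (n := f))
  | |- pt (fun a => eq_op (@?f a) (@?g a)) =>
      first [apply: (pt_eqn (m := f) (n := g)) | apply: (pt_eq_bits (s := f) (t := g))]
  | |- pt (fun a => match _ with Some _ => _ | None => _ end) => apply: pt_case_option
  | |- pt (fun a => match _ with nil => _ | cons _ _ => _ end) => apply: pt_case_seq
  end.

(** * Semantics of terms on sequences *)

Fixpoint ar (t : term) : nat :=
  match t with
  | Rel k _ => k
  | Equ => 2
  | Perm t | Swap t | Neg t => ar t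
  | Join t u => ar t + ar u
  | Ex t => (ar t).-1
  end.

(** Each operator is read backwards, reducing membership of [s] to membership of a rearranged
    sequence in the argument. Sequences avoid casts between tuple types, and the conditions on sizes
    confine each value to its arity. *)
Fixpoint sem (m : model) (t : term) (s : seq (dom m)) : Prop :=
  match t with
  | Rel k w => exists2 x : k.-tuple (dom m), interp w x & tval x = s
  | Equ => exists a, s = [:: a; a]
  | Perm t => size s = ar t /\ sem t (rot 1 s)
  | Swap t => size s = ar t /\ sem t (swap_last s)
  | Neg t => size s = ar t /\ ~ sem t s
  | Join t u => size s = ar t + ar u /\
      (sem t (take (ar t) s) /\ sem u (drop (ar t) s))
  | Ex t => size s = (ar t).-1 /\
      (if ar t == 0 then sem t s else exists a, sem t (rcons s a))
  end.

Lemma size_swap_last A (s : seq A) : size (swap_last s) = size s.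
Proof.
rewrite /swap_last; case E: (rev s) => [|a [|b u]] //.
by rewrite -(size_rev s) E size_rev.
Qed.

Lemma swap_lastK A : involutive (@swap_last A).
Proof.
move=> s; rewrite {2}/swap_last; case E: (rev s) => [|a [|b u]].
- by rewrite /swap_last E.
- by rewrite /swap_last E.
- by rewrite /swap_last revK -E revK.
Qed.

Definition holds (A : Type) (r : adrel A) (s : seq A) : Prop :=
  exists2 x, ad_rel (a := r) x & tval x = s.

Lemma holds_size (A : Type) (r : adrel A) s : holds r s -> size s = ad_arity r.
Proof. by move=> [x _ <-]; apply: size_tuple. Qed.

Lemma ar_value m t : ad_arity (value m t) = ar t.
Proof. by elim: t => //= [t -> u ->|t ->]. Qed.

Lemma holds_sem m t s : holds (value m t) s <-> sem t s.
Proof.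
elim: t s => [k w||t IH|t IH|t IH|t IHt u IHu|t IH] s /=.
- by split.
- split=> [[x [a ->] <-]|[a ->]]; first by exists a.
  by exists [tuple a; a] => //; exists a.
- rewrite -IH -(ar_value m); split.
    move=> [x [y yt xE] <-]; split; first by rewrite size_tuple.
    by exists y => //; rewrite xE rotrK.
  move=> [sz [y yt yE]]; exists (Tuple (introT eqP sz)) => //.
  by exists y => //; rewrite yE /= rotK.
- rewrite -IH -(ar_value m); split.
    move=> [x [y yt xE] <-]; split; first by rewrite size_tuple.
    by exists y => //; rewrite xE swap_lastK.
  move=> [sz [y yt yE]]; exists (Tuple (introT eqP sz)) => //.
  by exists y => //; rewrite yE /= swap_lastK.
- rewrite -IH -(ar_value m); split.
    move=> [x xt <-]; split; first by rewrite size_tuple.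
    by move=> [y yt /val_inj yx]; apply: xt; rewrite -yx.
  move=> [sz nt]; exists (Tuple (introT eqP sz)) => //= xt.
  by apply: nt; eexists; first exact: xt.
- rewrite -IHt -IHu -!(ar_value m); split.
    move=> [x [y [z [yt zu xE]]] <-]; split; first by rewrite size_tuple.
    rewrite xE take_size_cat ?size_tuple // drop_size_cat ?size_tuple //.
    by split; [exists y | exists z].
  move=> [sz [[y yt yE] [z zu zE]]]; exists (Tuple (introT eqP sz)) => //=.
  by exists y, z; split=> //=; rewrite yE zE cat_take_drop.
- rewrite -(ar_value m); split.
    move=> [x [y yt xE] <-]; split; first by rewrite size_tuple.
    rewrite xE; case: eqP => [a0|/eqP a0].
      by apply/IH; exists y => //; rewrite take_oversize // size_tuple a0.
    have sy := size_tuple y.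
    have [yE|[z [a yE]]] : tval y = [::] \/ exists z a, tval y = rcons z a.
      by case/lastP: (tval y) => [|z a]; [left | right; exists z, a].
      by move: sy; rewrite yE => /= e; rewrite -e in a0.
    move: sy; rewrite yE size_rcons => <- /=; exists a; apply/IH; exists y => //=.
    by rewrite -!cats1 take_size_cat // yE cats1.
  move=> [sz]; case: eqP => [a0 /IH[y yt yE]|/eqP a0 [a /IH[y yt yE]]].
    exists (Tuple (introT eqP sz)) => //=; exists y => //=.
    by rewrite yE take_oversize // sz a0.
  exists (Tuple (introT eqP sz)) => //=; exists y => //=.
  by rewrite yE -cats1 take_size_cat.
Qed.

Lemma sem_size m t s : sem (m := m) t s -> size s = ar t.
Proof. by move/holds_sem/holds_size; rewrite ar_value. Qed.

Lemma satisfiable_sem t : satisfiable t <-> exists m s, sem (m := m) t s.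
Proof.
split=> [[m [x xt]]|[m [s /holds_sem[x xt _]]]]; last by exists m, x.
by exists m, x; apply/holds_sem; exists x.
Qed.

(** * The tableau of a computation *)

(** Premises and conclusions: the conjunction of the former implies the disjunction of the
    latter. *)
Definition clause := (seq (seq bool) * seq (seq bool))%type.

Definition csat (v : seq bool -> Prop) (c : clause) : Prop :=
  (forall x, x \in c.1 -> v x) -> exists2 x, x \in c.2 & v x.

(** This term of arity 0 says that the domain is nonempty, hence holds in every model; it is the
    unit of [Join] seen as conjunction. *)
Definition true_term : term := Ex (Ex Equ).

Definition conj_term (ts : seq term) : term := foldr Join true_term ts.

Definition clause_term (c : clause) : term :=
  Neg (conj_term ([seq Rel 0 x | x <- c.1] ++ [seq Neg (Rel 0 x) | x <- c.2])).

Definition cnf_term (f : seq clause) : term := conj_term (map clause_term f).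

Lemma ar_conj ts : (forall t, List.In t ts -> ar t = 0) -> ar (conj_term ts) = 0.
Proof.
elim: ts => //= t ts IH h; rewrite h ?IH; [by [] | | by left].
by move=> u uts; apply: h; right.
Qed.

Lemma sem_conj m ts : (forall t, List.In t ts -> ar t = 0) ->
  sem (m := m) (conj_term ts) [::] <-> forall t, List.In t ts -> sem (m := m) t [::].
Proof.
elim: ts => [|t ts IH] h.
  split=> // _; split=> //; case: (dom_inhabited m) => a.
  by exists a; split=> //; exists a, a.
have ht := h t (or_introl erefl).
have hts u : List.In u ts -> ar u = 0 by move=> uts; apply: h; right.
rewrite /= ht (ar_conj hts) (IH hts); split.
  by move=> [_ [st sts]] u [<- //|/sts].
move=> st; split=> //; split; first by apply: st; left.
by move=> u uts; apply: st; right.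
Qed.

Definition valuation (m : model) (x : seq bool) : Prop := @interp m 0 x [tuple].

Lemma sem_var m x : sem (m := m) (Rel 0 x) [::] <-> valuation m x.
Proof.
split=> [[y yx _]|vx]; last by exists [tuple].
by rewrite /valuation -(tuple0 y).
Qed.

Lemma in_mapP (A : eqType) B (f : A -> B) (s : seq A) y :
  List.In y [seq f x | x <- s] <-> exists2 x, x \in s & y = f x.
Proof.
elim: s => [|a s IH] /=; first by split=> // -[].
rewrite IH; split=> [[<-|[x xs ->]]|[x]].
- by exists a; rewrite ?mem_head.
- by exists x; rewrite // in_cons xs orbT.
- by rewrite in_cons => /orP[/eqP->|xs] ->; [left | right; exists x].
Qed.

Lemma sem_clause m c : sem (m := m) (clause_term c) [::] <-> csat (valuation m) c.
Proof.
have h0 t : List.In t ([seq Rel 0 x | x <- c.1] ++ [seq Neg (Rel 0 x) | x <- c.2]) ->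
    ar t = 0.
  by move/List.in_app_iff; rewrite !in_mapP => -[] [x _ ->].
rewrite /= (sem_conj m h0) (ar_conj h0); split.
  move=> [_ nc] hp; apply: NNPP => nq; apply: nc => t.
  move/List.in_app_iff; rewrite !in_mapP => -[] [x xc ->].
    by apply/sem_var; apply: hp.
  by split=> // /sem_var vx; apply: nq; exists x.
move=> hc; split=> // hall.
have [x xc /sem_var vx] : exists2 x, x \in c.2 & valuation m x.
  apply: hc => x xc; apply/sem_var; apply: hall.
  by apply/List.in_app_iff; left; apply/in_mapP; exists x.
have [] : sem (m := m) (Neg (Rel 0 x)) [::].
  by apply: hall; apply/List.in_app_iff; right; apply/in_mapP; exists x.
by move=> _; apply.
Qed.

Lemma cnf_satisfiable f :
  satisfiable (cnf_term f) <-> exists v, forall c, c \in f -> csat v c.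
Proof.
have h0 t : List.In t (map clause_term f) -> ar t = 0.
  move/in_mapP=> [c _ ->]; apply: ar_conj => u.
  by move/List.in_app_iff; rewrite !in_mapP => -[] [x _ ->].
rewrite satisfiable_sem; split=> [[m [s sc]]|[v vf]].
  have s0 : s = [::] by apply: size0nil; rewrite (sem_size sc) (ar_conj h0).
  rewrite {}s0 in sc; exists (valuation m) => c cf; apply/sem_clause.
  by apply: (proj1 (sem_conj m h0) sc); apply/in_mapP; exists c.
pose m := @Model unit (inhabits tt) (fun _ x _ => v x).
exists m, [::]; apply/(sem_conj m h0) => t /in_mapP[c cf ->].
by apply/sem_clause; apply: vf.
Qed.

Section Tableau.

Variables (X : finType) (M : machine) (i : X -> symbol M).

Let tapes := 'I_(last_tape M).+1.
Let reads := {ffun tapes -> option (symbol M)}.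
Definition action := (state M * {ffun 'I_(last_tape M).+1 -> option (symbol M) * move})%type.
Definition fact := (state M + action + 'I_(last_tape M).+1 * option (symbol M))%type.

(** Unary numbers with separators: injective, and of polynomial length for the times and cells that
    occur. *)
Definition name (x : fact) (t j : nat) : seq bool :=
  nseq (enum_rank x) true ++ false :: nseq t true ++ false :: nseq j true.

Definition vState q t := name (inl (inl q)) t 0.
Definition vAct a t := name (inl (inr a)) t 0.
Definition vCell k s t j := name (inr (k, s)) t j.

Lemma unary_inj m n u v :
  nseq m true ++ false :: u = nseq n true ++ false :: v -> m = n /\ u = v.
Proof. by elim: m n => [|m IH] [|n] //= [] => [->|/IH[-> ->]]. Qed.

Lemma name_inj x t j x' t' j' :
  name x t j = name x' t' j' -> [/\ x = x', t = t' & j = j'].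
Proof.
move/unary_inj=> [/val_inj/enum_rank_inj-> /unary_inj[-> /(congr1 size)]].
by rewrite !size_nseq => ->.
Qed.

(* Cell j of a tape is counted relatively to the head, which is on the cell   *)
(* n.+1; only the cells below (n.+1).*2 are considered.                       *)
Variable n : nat.

Definition cell (t : tape (symbol M)) (j : nat) : option (symbol M) :=
  if n < j then nth None t.2 (j - n.+1) else nth None t.1 (n - j).

(* The number of cell j.+1 after a head movement. *)
Definition shift (d : move) (j : nat) : nat :=
  match d with None => j.+1 | Some true => j | Some false => j.+2 end.

Lemma cell_head t : cell t n.+1 = tape_read t.
Proof. by rewrite /cell ltnSn subnn nth0. Qed.

Lemma cell_written t s d :
  cell (tape_move (tape_write t s) d) (shift d n) = s.
Proof.
rewrite /cell; case: d => [[]|]; rewrite /shift.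
- by rewrite ltnn subnn.
- have -> : n < n.+2 by lia.
  by have -> : n.+2 - n.+1 = 1 by lia.
- by rewrite ltnSn subnn.
Qed.

(** Away from the head, a step changes only the numbering. Using [j.+1] for the old number avoids
    subtraction, and [j = n] is the cell under the head. *)
Lemma cell_shifted t s d j : j != n ->
  cell (tape_move (tape_write t s) d) (shift d j) = cell t j.+1.
Proof.
move=> jn; rewrite /cell.
have nth_head (u : seq (option (symbol M))) : head None u = nth None u 0 by case: u.
case: d => [[]|]; rewrite /shift /tape_move /tape_write.
- case: (ltngtP n j) jn => // nj _.
    have -> : n < j.+1 by lia.
    by rewrite /= nth_behead; congr nth; lia.
  have -> : (n < j.+1) = false by lia.
  by have -> : n - j = (n - j.+1).+1 by lia.
- case: (ltngtP n j) jn => // nj _.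
    have [-> ->] : n < j.+2 /\ n < j.+1 by lia.
    have -> : j.+2 - n.+1 = (j - n.+1).+2 by lia.
    by rewrite /= nth_behead; congr nth; lia.
  have -> : (n < j.+1) = false by lia.
  case: ltnP => h; last by rewrite /= nth_behead; congr nth; lia.
  have -> : j.+1 = n by lia.
  by rewrite !subnn /= nth_head.
- case: (ltngtP n j) jn => // nj _.
    have -> : n < j.+1 by lia.
    have -> : j.+1 - n.+1 = (j - n.+1).+1 by lia.
    by rewrite -[RHS]nth_behead.
  by have -> : (n < j.+1) = false by lia.
Qed.

Definition situation := (state M * {ffun 'I_(last_tape M).+1 -> option (symbol M)})%type.

(** Some applicable action is taken. Without applicable actions the clause has no conclusion, so it
    refutes a halt; accepting halts are exempted in [state_clauses]. *)
Definition state_clause t (qa : situation) : clause :=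
  (vState qa.1 t :: [seq vCell k (qa.2 k) t n.+1 | k <- enum 'I_(last_tape M).+1],
   [seq vAct a t | a <- enum (@delta M qa.1 qa.2)]).

Definition accepting_halt (qa : situation) : bool :=
  (@delta M qa.1 qa.2 == set0) && (qa.1 \in accepting M).

Definition write_clause t (ak : action * 'I_(last_tape M).+1) : clause :=
  ([:: vAct ak.1 t],
   [:: vCell ak.2 (ak.1.2 ak.2).1 t.+1 (shift (ak.1.2 ak.2).2 n)]).

Definition shift_clause t j
    (x : action * 'I_(last_tape M).+1 * option (symbol M)) : clause :=
  ([:: vAct x.1.1 t; vCell x.1.2 x.2 t j.+1],
   [:: vCell x.1.2 x.2 t.+1 (shift (x.1.1.2 x.1.2).2 j)]).

Definition state_clauses t : seq clause :=
  [seq state_clause t qa | qa <- enum {: situation} & ~~ accepting_halt qa].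

Definition act_clauses t : seq clause :=
  [seq ([:: vAct a t], [:: vState a.1 t.+1]) | a <- enum {: action}] ++
  [seq write_clause t ak | ak <- enum {: action * 'I_(last_tape M).+1}].

Definition shift_clauses t j : seq clause :=
  [seq shift_clause t j x
  | x <- enum {: action * 'I_(last_tape M).+1 * option (symbol M)}].

(** The index [n] is skipped because cell [n.+1] is under the head and is covered by the write
    clauses. *)
Definition step_clauses t : seq clause :=
  (state_clauses t ++ act_clauses t) ++
  flatten [seq shift_clauses t j | j <- iota 0 n ++ iota n.+1 n].

Definition input_cells (w : seq X) : seq (option (symbol M)) :=
  nseq n.+1 None ++ [seq Some (i x) | x <- w] ++ nseq n.+1 None.

Definition init_clauses (w : seq X) : seq clause :=
  ([::], [:: vState (start M) 0]) ::
  [seq ([::], [:: vCell ord0 js.2 0 js.1])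
    | js <- zip (iota 0 (n.+1 + n.+1)) (input_cells w)] ++
  flatten [seq [seq ([::], [:: vCell k None 0 j]) | k <- enum 'I_(last_tape M).+1 & k != ord0]
    | j <- iota 0 (n.+1 + n.+1)].

Definition tableau (w : seq X) (T : nat) : seq clause :=
  init_clauses w ++ flatten [seq step_clauses t | t <- iota 0 T.+1].

Definition next (c : config M) (a : action) : config M :=
  (a.1, [ffun k => tape_move (tape_write (c.2 k) (a.2 k).1) (a.2 k).2]).

Lemma reach_sequence m (c d : config M) : reach m c d ->
  exists (cs : nat -> config M) (acts : nat -> action),
  [/\ cs 0 = c, cs m = d & forall t, t < m ->
    acts t \in transitions (cs t) /\ cs t.+1 = next (cs t) (acts t)].
Proof.
elim: m c => [|m IH] c /=.
  by move=> ->; exists (fun _ => d), (fun _ => (start M, [ffun=> (None, None)])).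
case=> e [a at_ eE] /IH[cs [acts [cs0 csm h]]].
exists (fun t => if t is t'.+1 then cs t' else c),
  (fun t => if t is t'.+1 then acts t' else a); split=> // -[|t] tm.
  by split=> //; rewrite cs0.
exact: h.
Qed.

Lemma reachS m (c d : config M) a : reach m c d -> a \in transitions d ->
  reach m.+1 c (next d a).
Proof.
elim: m c => [|m IH] c /=.
  by move=> -> ad; exists (next d a) => //; exists a.
by case=> e ce /IH h /h; exists e.
Qed.

Lemma size_input_cells w : n.+1 + n.+1 <= size (input_cells w).
Proof. by rewrite /input_cells !size_cat !size_nseq; lia. Qed.

Lemma nth_input_cells w j : nth None (input_cells w) j =
  cell ((init [seq i x | x <- w]).2 ord0 : tape (symbol M)) j.
Proof.
rewrite ffunE eqxx /cell /input_cells nth_cat size_nseq -map_comp.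
case: (ltnP n j) => h; last by rewrite ltnS h nth_nseq ltnS h nth_nil.
rewrite ltnNge h [~~ _]/= nth_cat size_map; case: ltnP => // h'.
by rewrite nth_nseq if_same [RHS]nth_default ?size_map.
Qed.

Lemma input_cellP w j s : (j, s) \in zip (iota 0 (n.+1 + n.+1)) (input_cells w) <->
  j < n.+1 + n.+1 /\ s = cell ((init [seq i x | x <- w]).2 ord0 : tape (symbol M)) j.
Proof.
have sz : size (zip (iota 0 (n.+1 + n.+1)) (input_cells w)) = n.+1 + n.+1.
  by rewrite size_zip size_iota (minn_idPl (size_input_cells w)).
have nE j' : j' < n.+1 + n.+1 ->
    nth (0, None) (zip (iota 0 (n.+1 + n.+1)) (input_cells w)) j' =
    (j', cell ((init [seq i x | x <- w]).2 ord0 : tape (symbol M)) j').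
  by move=> lt; rewrite nth_zip_cond sz lt nth_iota // add0n nth_input_cells.
split=> [/(nthP (0, None))[j']|[lt ->]].
  by rewrite sz => lt; rewrite nE // => -[<- <-].
by rewrite -nE // mem_nth // sz.
Qed.

Lemma init_cell w k j : j < n.+1 + n.+1 ->
  ([::], [:: vCell k (cell ((init [seq i x | x <- w]).2 k) j) 0 j]) \in init_clauses w.
Proof.
move=> jn; rewrite in_cons; apply/orP; right; rewrite mem_cat.
have [->|k0] := eqVneq k ord0; apply/orP; [left | right].
  apply/mapP; eexists; first by apply/input_cellP; split; [exact: jn | reflexivity].
  by [].
apply/flattenP; eexists.
  by apply/mapP; exists j; first by rewrite mem_iota.
apply/mapP; exists k; first by rewrite mem_filter k0 mem_enum.
by rewrite ffunE (negPf k0) /cell /= !nth_nil if_same.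
Qed.

(** The actions that [v] makes true are followed as a run. The window of cells known to be described
    correctly loses one cell on each side per step, but contains the head up to time [n]. Either the
    run halts and accepts, or it reaches [T.+1] steps against the time bound. *)
Lemma tableau_sound w T v : T <= n -> @runs_within M [seq i x | x <- w] T ->
  (forall c, c \in tableau w T -> csat v c) -> accepts [seq i x | x <- w].
Proof.
move=> Tn hT hv.
have hstep t c : t <= T -> c \in step_clauses t -> csat v c.
  move=> tT ct; apply: hv; rewrite mem_cat; apply/orP; right.
  by apply/flattenP; exists (step_clauses t); rewrite // map_f // mem_iota.
have unit_clause x : csat v ([::], [:: x]) -> v x.
  by case=> // y; rewrite in_cons orbF => /eqP->.
have imp1 x y : csat v ([:: x], [:: y]) -> v x -> v y.
  move=> h vx; case: h => [z|z]; rewrite in_cons orbF => /eqP-> //.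
have run t : t <= T.+1 -> accepts [seq i x | x <- w] \/
  exists c : config M, [/\ reach t (init [seq i x | x <- w]) c, v (vState c.1 t)
    & forall k j, t < j -> j + t < n.+1 + n.+1 -> v (vCell k (cell (c.2 k) j) t j)].
  elim: t => [|t IH] tT.
    right; exists (init [seq i x | x <- w]); split=> //.
      apply: unit_clause; apply: hv; rewrite mem_cat; apply/orP; left.
      by rewrite mem_head.
    move=> k j j0 jn; apply: unit_clause; apply: hv; rewrite mem_cat.
    by apply/orP; left; apply: init_cell; rewrite -(addn0 j).
  case: IH => [|ac|[c [rc vq vc]]]; [lia | by left |].
  pose r : {ffun 'I_(last_tape M).+1 -> option (symbol M)} := [ffun k => tape_read (c.2 k)].
  have [fin|nfin] := boolP (accepting_halt (c.1, r)).
    left; exists t, c; case/andP: fin => /eqP fin ac; split=> //.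
  have [x] : exists2 x, x \in (state_clause t (c.1, r)).2 & v x.
    have cl : csat v (state_clause t (c.1, r)).
      apply: (hstep t); first by lia.
      rewrite !mem_cat; do 2!(apply/orP; left).
      by apply/mapP; exists (c.1, r); rewrite // mem_filter nfin mem_enum.
    apply: cl => y; rewrite in_cons => /orP[/eqP->|/mapP[k _ ->]] //.
    by rewrite ffunE -cell_head; apply: vc; lia.
  case/mapP=> a; rewrite mem_enum => ad -> va; right; exists (next c a); split.
  - exact: reachS.
  - apply: imp1 va; apply: (hstep t); first by lia.
    rewrite mem_cat; apply/orP; left; rewrite mem_cat; apply/orP; right.
    by rewrite mem_cat; apply/orP; left; apply/mapP; exists a; rewrite ?mem_enum.
  move=> k j tj jn; rewrite /= ffunE.
  set d := (a.2 k).2; set s := (a.2 k).1.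
  (* Cell [j] of the new configuration had the number [j0.+1] before the move. *)
  pose j0 := if d is Some b then (if b then j else j.-2) else j.-1.
  have jE : j = shift d j0 by rewrite /j0; case: (d) => [[]|] /=; lia.
  rewrite jE; have [->|j0n] := eqVneq j0 n.
    rewrite cell_written; apply: imp1 va; apply: (hstep t); first by lia.
    rewrite mem_cat; apply/orP; left; rewrite mem_cat; apply/orP; right.
    by rewrite mem_cat; apply/orP; right; apply/mapP; exists (a, k); rewrite ?mem_enum.
  rewrite cell_shifted //.
  have vk : v (vCell k (cell (c.2 k) j0.+1) t j0.+1).
    by apply: vc; move: jE jn tj; rewrite /shift; case: (d) => [[]|] /=; lia.
  have [y|y] : csat v (shift_clause t j0 (a, k, cell (c.2 k) j0.+1)).
  - apply: (hstep t); first by lia.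
    rewrite mem_cat; apply/orP; right; apply/flattenP.
    exists (shift_clauses t j0).
      apply: map_f; rewrite mem_cat !mem_iota.
      move: jE jn tj j0n; rewrite /shift; case: (d) => [[]|] /=; lia.
    by apply/mapP; exists (a, k, cell (c.2 k) j0.+1); rewrite ?mem_enum.
  - by rewrite !in_cons orbF => /orP[] /eqP->.
  - by rewrite in_cons orbF => /eqP->.
have [//|[c [rc _ _]]] := run T.+1 (leqnn _).
by have := hT _ _ rc; rewrite ltnn.
Qed.

(** The true variables are exactly the facts of an accepting run up to its last time [m]. Step
    clauses for later times have a false premise, and the last situation has no state clause because
    it is an accepting halt. *)
Lemma tableau_complete w T : accepts [seq i x | x <- w] ->
  exists v, forall c, c \in tableau w T -> csat v c.
Proof.
move=> [m [d [r hd ad]]].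
have [cs [acts [cs0 csm csS]]] := reach_sequence r.
pose v x := [\/ exists2 t, t <= m & x = vState (cs t).1 t,
  exists2 t, t < m & x = vAct (acts t) t
  | exists t k j, t <= m /\ x = vCell k (cell ((cs t).2 k) j) t j].
have vS q t : v (vState q t) -> t <= m /\ q = (cs t).1.
  by case=> [[t' tm]|[t' tm]|[t' [k [j [tm]]]]] /name_inj[] // [->] ->.
have vA a t : v (vAct a t) -> t < m /\ a = acts t.
  by case=> [[t' tm]|[t' tm]|[t' [k [j [tm]]]]] /name_inj[] // [->] ->.
have vC k s t j : v (vCell k s t j) -> t <= m /\ s = cell ((cs t).2 k) j.
  by case=> [[t' tm]|[t' tm]|[t' [k' [j' [tm]]]]] /name_inj[] // [-> ->] -> ->.
have csat1 x y : (v x -> v y) -> csat v ([:: x], [:: y]).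
  by move=> h h'; exists y; rewrite ?mem_head //; apply: h; apply: h'; rewrite mem_head.
exists v => c; rewrite mem_cat => /orP[|/flattenP[cl /mapP[t _ ->]]].
  have vinit k j : v (vCell k (cell ((init [seq i x | x <- w]).2 k) j) 0 j).
    by apply: Or33; exists 0, k, j; rewrite cs0.
  rewrite in_cons => /orP[/eqP-> _|].
    by exists (vState (start M) 0); rewrite ?mem_head //; apply: Or31; exists 0; rewrite ?cs0.
  rewrite mem_cat => /orP[/mapP[[j s] js ->] _|/flattenP[cl /mapP[j _ ->] /mapP[k]]].
    exists (vCell ord0 s 0 j); rewrite ?mem_head //.
    by case/input_cellP: js => _ ->.
  rewrite mem_filter => /andP[k0 _] -> _; eexists; first exact: mem_head.
  by have := vinit k j; rewrite ffunE (negPf k0) /cell /= !nth_nil if_same.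
rewrite mem_cat => /orP[|/flattenP[cl' /mapP[j0 jr ->] /mapP[[[a k] s] _ ->]]]; last first.
  move=> hp; have [tm ->] : t < m /\ a = acts t by apply: vA; apply: hp; rewrite mem_head.
  have [_ ->] : t <= m /\ s = cell ((cs t).2 k) j0.+1.
    by apply: vC; apply: hp; rewrite !in_cons eqxx orbT.
  eexists; first exact: mem_head.
  apply: Or33; exists t.+1, k, (shift ((acts t).2 k).2 j0); split=> //.
  have [_ ->] := csS _ tm; rewrite ffunE cell_shifted //.
  by move: jr; rewrite mem_cat !mem_iota; lia.
rewrite mem_cat => /orP[/mapP[[q r'] qr ->] hp|].
  have [tm qE] : t <= m /\ q = (cs t).1 by apply: vS; apply: hp; rewrite mem_head.
  have rE : r' = [ffun k => tape_read ((cs t).2 k)].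
    apply/ffunP => k; rewrite ffunE -cell_head.
    have [|_ ->] // := vC k (r' k) t n.+1.
    by apply: hp; rewrite in_cons; apply/orP; right; apply: map_f; rewrite mem_enum.
  move: qr; rewrite mem_filter qE rE /accepting_halt => /andP[nac _].
  move: tm; rewrite leq_eqVlt => /orP[/eqP tm|tm].
    have hd' : delta d.1 [ffun k => tape_read (d.2 k)] = set0 := hd.
    by move: nac; rewrite tm csm /= ad andbT hd' eqxx.
  exists (vAct (acts t) t); last by apply: Or32; exists t.
  by apply: map_f; rewrite mem_enum; case: (csS _ tm).
rewrite mem_cat => /orP[] /mapP[].
  move=> a _ ->; apply: csat1 => /vA[tm ->]; apply: Or31; exists t.+1 => //.
  by have [_ ->] := csS _ tm.
move=> [a k] _ ->; apply: csat1 => /vA[tm ->].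
apply: Or33; exists t.+1, k, (shift ((acts t).2 k).2 n); split=> //.
by have [_ ->] := csS _ tm; rewrite ffunE cell_written.
Qed.

End Tableau.

(** * The reduction in polynomial time *)

Lemma pt_horner A {cA : Code A} (p : {poly nat}) (n : A -> nat) :
  pt n -> pt (fun a => p.[n a]%R).
Proof.
move=> pn; rewrite /horner; elim: (polyseq p) => [|c s IH] /=; first by pt_auto.
by apply: pt_addn; [apply: pt_muln | pt_auto].
Qed.

Definition token_of_bit (b : bool) : token := if b then tBit1 else tBit0.

Definition enc_name (x : seq bool) : seq token :=
  tRel :: map token_of_bit x ++ [:: tEnd].

Definition enc_clause (c : clause) : seq token :=
  tNeg :: flatten ([seq tJoin :: enc_name x | x <- c.1] ++
                   [seq tJoin :: tNeg :: enc_name x | x <- c.2]) ++ encode true_term.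

Definition enc_cnf (f : seq clause) : seq token :=
  flatten [seq tJoin :: enc_clause c | c <- f] ++ encode true_term.

Lemma encode_conj ts :
  encode (conj_term ts) = flatten [seq tJoin :: encode t | t <- ts] ++ encode true_term.
Proof. by elim: ts => //= t ts ->; rewrite -catA. Qed.

(** Terms are not given codes as trees; the reduction computes the word directly from the
    clauses. *)
Lemma encode_cnf f : encode (cnf_term f) = enc_cnf f.
Proof.
rewrite encode_conj /enc_cnf -map_comp; congr (flatten _ ++ _).
apply: eq_map => c /=; congr [:: _, _ & _].
by rewrite encode_conj map_cat -!map_comp.
Qed.

Lemma pt_enc_name A {cA : Code A} (x : A -> seq bool) : pt x -> pt (fun a => enc_name (x a)).
Proof. by move=> px; rewrite /enc_name /token_of_bit; pt_auto. Qed.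

Lemma pt_enc_cnf A {cA : Code A} (f : A -> seq clause) : pt f -> pt (fun a => enc_cnf (f a)).
Proof.
move=> pf; rewrite /enc_cnf /enc_clause; pt_auto; apply: pt_enc_name; pt_auto.
Qed.

Lemma pt_option_fin A B (X : finType) {cA : Code A} {cB : Code B}
    (F : option X -> A -> B) (x : A -> option X) :
  (forall s, pt (F s)) -> pt x -> pt (fun a => F (x a) a).
Proof.
move=> pF px.
apply: (pt_ext (f := fun a => if x a is Some y then F (Some y) a else F None a)).
  by move=> a; case: (x a).
apply: (pt_case_option (f1 := fun a y => F (Some y) a)) => //.
apply: (pt_fin (F := fun y (u : A * X) => F (Some y) u.1) (x := fun u : A * X => u.2));
  last by pt_auto.
by move=> y; apply: (pt_comp (g := fun u : A * X => u.1) (pF (Some y))); pt_auto.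
Qed.

Section Tableau.

Variables (X : finType) (M : machine) (i : X -> symbol M).

Lemma pt_name A {cA : Code A} (x : fact M) (t j : A -> nat) :
  pt t -> pt j -> pt (fun a => name x (t a) (j a)).
Proof. by move=> pt' pj; rewrite /name; pt_auto. Qed.

Lemma pt_shift A {cA : Code A} d (j : A -> nat) : pt j -> pt (fun a => shift d (j a)).
Proof. by case: d => [[]|] pj; rewrite /shift; pt_auto. Qed.

Ltac pt_names := repeat first [pt_step | apply: pt_name | apply: pt_shift].

Context {A : Type} {cA : Code A}.

Lemma pt_step_clauses (n t : A -> nat) :
  pt n -> pt t -> pt (fun a => step_clauses M (n a) (t a)).
Proof.
move=> pn pt'; rewrite /step_clauses; apply: pt_cat; [apply: pt_cat|].
- apply: pt_map_const => qa; rewrite /state_clause /vState /vCell /vAct.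
  by apply: pt_pair; [apply: pt_cons; [|apply: pt_map_const => k] | apply: pt_map_const => k];
    pt_names.
- rewrite /act_clauses; apply: pt_cat; apply: pt_map_const => x;
    rewrite /write_clause /vState /vCell /vAct; pt_names.
apply: pt_flatten; apply: pt_map; last by pt_names.
apply: pt_map_const => x; rewrite /shift_clause /vCell /vAct.
have pt1 : pt (fun u : A * nat => t u.1) by apply: (pt_comp (g := fun u => u.1) pt'); pt_auto.
by pt_names.
Qed.

Lemma pt_init_clauses (n : A -> nat) (w : A -> seq X) :
  pt n -> pt w -> pt (fun a => init_clauses i (n a) (w a)).
Proof.
move=> pn pw; rewrite /init_clauses /vState /vCell.
have pi : pt (fun a => [seq Some (i x) | x <- w a]).
  apply: pt_map => //; apply: pt_some.
  by apply: (pt_fin (F := fun x _ => i x) (x := fun u : A * X => u.2)); [move=> y /=|]; pt_auto.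
apply: pt_cons; first by pt_names.
apply: pt_cat; last first.
  apply: pt_flatten; apply: pt_map; last by pt_names.
  by apply: pt_map_const => k; pt_names.
apply: pt_map.
  apply: pt_pair; first by pt_names.
  apply: pt_cons; last by pt_names.
  apply: (pt_option_fin (F := fun s (u : A * (nat * option (symbol M))) =>
    name (inr (ord0, s)) 0 u.2.1) (x := fun u : A * (nat * option (symbol M)) => u.2.2)).
    by move=> s; pt_names.
  by pt_names.
apply: pt_zip; first by pt_names.
rewrite /input_cells; apply: pt_cat; first by pt_names.
by apply: pt_cat; pt_names.
Qed.

End Tableau.

Lemma pt_tableau (X : finType) (M : machine) (i : X -> symbol M) (p : {poly nat}) :
  pt (fun w : seq X => tableau i p.[size w]%R w p.[size w]%R).
Proof.
have pT : pt (fun w : seq X => p.[size w]%R).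
  by apply: (pt_horner p (n := fun w : seq X => size w)); pt_auto.
rewrite /tableau; apply: pt_cat; first by apply: pt_init_clauses; pt_auto.
apply: pt_flatten; apply: pt_map; last by pt_auto.
apply: pt_step_clauses; last by pt_auto.
by apply: (pt_comp (g := fun u => u.1) pT); pt_auto.
Qed.

Lemma NP_reduces_to_gra_sat (X : finType) (L : seq X -> Prop) :
  in_NP L -> reduces L gra_sat.
Proof.
move=> [M [i [p [_ within Lw]]]].
pose f (w : seq X) := tableau i p.[size w]%R w p.[size w]%R.
exists (fun w => encode (cnf_term (f w))).
  apply: polytime_of_pt; apply: pt_rev.
  apply: (pt_ext (f := fun w => enc_cnf (f w))).
    by move=> w; rewrite encode_cnf.
  by apply: pt_enc_cnf; apply: pt_tableau.
move=> w; rewrite Lw.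
have -> : gra_sat (encode (cnf_term (f w))) <-> satisfiable (cnf_term (f w)).
  by split=> [[t /encode_inj->]|] //; exists (cnf_term (f w)).
rewrite cnf_satisfiable; split=> [ac|[v vf]].
  exact: tableau_complete.
by apply: tableau_sound vf; [exact: leqnn | exact: within].
Qed.

(** * Quantifier prefixes *)

Section Prefix.

Variables (D : Type) (d : D).
Implicit Types (P : seq bool) (s : seq D).

(* true stands for an existential quantifier, false for a universal one. *)
Fixpoint Q P (F : seq D -> Prop) : Prop :=
  match P with
  | [::] => F [::]
  | true :: P' => exists a, Q P' (fun s => F (a :: s))
  | false :: P' => forall a, Q P' (fun s => F (a :: s))
  end.

Lemma Q_mono P (F F' : seq D -> Prop) :
  (forall s, size s = size P -> F s -> F' s) -> Q P F -> Q P F'.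
Proof.
elim: P F F' => [|[] P IH] F F' h /=; first exact: h.
- by case=> a qa; exists a; apply: IH qa => s sP; apply: h; rewrite /= sP.
- by move=> qa a; apply: IH (qa a) => s sP; apply: h; rewrite /= sP.
Qed.

Lemma Q_ext P (F F' : seq D -> Prop) :
  (forall s, size s = size P -> F s <-> F' s) -> Q P F <-> Q P F'.
Proof. by move=> h; split; apply: Q_mono => s /h[]. Qed.

Lemma Q_all P (F : seq D -> Prop) :
  (forall s, size s = size P -> F s) -> Q P F.
Proof.
elim: P F => [|[] P IH] F h /=; first exact: h.
- by exists d; apply: IH => s sP; apply: h; rewrite /= sP.
- by move=> a; apply: IH => s sP; apply: h; rewrite /= sP.
Qed.

Lemma Q_witness P (F : seq D -> Prop) :
  Q P F -> exists2 s, size s = size P & F s.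
Proof.
elim: P F => [|[] P IH] F /=; first by exists [::].
- by case=> a /IH[s sP Fs]; exists (a :: s); rewrite //= sP.
- by move/(_ d)/IH=> [s sP Fs]; exists (d :: s); rewrite //= sP.
Qed.

Definition depends (I : pred nat) (F : seq D -> Prop) :=
  forall s s', (forall i, I i -> nth d s i = nth d s' i) -> F s -> F s'.

Lemma depends_cons I F a : depends I F -> depends (fun i => I i.+1) (fun s => F (a :: s)).
Proof. by move=> h s s' ss'; apply: h => -[|i] //; apply: ss'. Qed.

Lemma depends_head I F P a a' : depends I F -> ~~ I 0 ->
  Q P (fun s => F (a :: s)) -> Q P (fun s => F (a' :: s)).
Proof. by move=> h I0; apply: Q_mono => s _; apply: h => -[|i]; rewrite ?(negPf I0). Qed.

Arguments depends_head {I F P} a {a'}.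

(** Each variable matters to at most one of the two formulas, so an existential witness for that one
    also serves the other. *)
Lemma Q_and (I1 I2 : pred nat) F1 F2 P :
  (forall i, ~~ (I1 i && I2 i)) -> depends I1 F1 -> depends I2 F2 ->
  Q P (fun s => F1 s /\ F2 s) <-> Q P F1 /\ Q P F2.
Proof.
move=> I12 d1 d2; split.
  by move=> h; split; apply: Q_mono h => s _ [].
elim: P I1 I2 F1 F2 I12 d1 d2 => [|b P IH] I1 I2 F1 F2 I12 d1 d2 //=.
have {}IH a : Q P (fun s => F1 (a :: s)) -> Q P (fun s => F2 (a :: s)) ->
    Q P (fun s => F1 (a :: s) /\ F2 (a :: s)).
  move=> h1 h2; by apply: (IH _ _ _ _ (fun i => I12 i.+1) (depends_cons d1) (depends_cons d2)).
case: b; last by move=> [h1 h2] a; apply: IH.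
move=> [[a h1] [a' h2]]; have := I12 0; rewrite negb_and => /orP[n1|n2].
- by exists a'; apply: IH => //; apply: (depends_head _ d1 n1) h1.
- by exists a; apply: IH => //; apply: (depends_head _ d2 n2) h2.
Qed.

(** The dual fact. At a universal variable that one formula ignores, excluded middle decides that
    formula at a single value, and hence at all values. *)
Lemma Q_or (I1 I2 : pred nat) F1 F2 P :
  (forall i, ~~ (I1 i && I2 i)) -> depends I1 F1 -> depends I2 F2 ->
  Q P (fun s => F1 s \/ F2 s) <-> Q P F1 \/ Q P F2.
Proof.
move=> I12 d1 d2; split; last first.
  by case; apply: Q_mono => s _; [left | right].
elim: P I1 I2 F1 F2 I12 d1 d2 => [|b P IH] I1 I2 F1 F2 I12 d1 d2 //=.
have {}IH a : Q P (fun s => F1 (a :: s) \/ F2 (a :: s)) ->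
    Q P (fun s => F1 (a :: s)) \/ Q P (fun s => F2 (a :: s)).
  exact: (IH _ _ _ _ (fun i => I12 i.+1) (depends_cons d1) (depends_cons d2)).
case: b; first by case=> a /IH[]; [left | right]; exists a.
move=> h; have := I12 0; rewrite negb_and => /orP[n1|n2].
- have [h1|h1] := classic (Q P (fun s => F1 (d :: s))).
    by left=> a; apply: (depends_head _ d1 n1) h1.
  by right=> a; case: (IH a (h a)) => // q; case: h1; apply: (depends_head a d1 n1) q.
- have [h2|h2] := classic (Q P (fun s => F2 (d :: s))).
    by right=> a; apply: (depends_head _ d2 n2) h2.
  by left=> a; case: (IH a (h a)) => // q; case: h2; apply: (depends_head a d2 n2) q.
Qed.

Lemma Q_const P F : depends pred0 F -> Q P F <-> F [::].
Proof.
move=> dF; split=> [/Q_witness[s _]|F0]; first exact: dF.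
by apply: Q_all => s _; apply: dF F0.
Qed.

Lemma Q_cat P P' F : depends (fun i => i < size P) F ->
  Q (P ++ P') F <-> Q P F.
Proof.
elim: P F => [|b P IH] F dF /=; first exact: Q_const.
have {}IH a : Q (P ++ P') (fun s => F (a :: s)) <-> Q P (fun s => F (a :: s)).
  by apply: IH; apply: depends_cons dF.
case: b {dF}; first by split=> -[a /IH h]; exists a.
by split=> h a; apply/IH.
Qed.

Lemma Q_rcons P b F : Q (rcons P b) F <->
  Q P (fun s => if b then exists a, F (rcons s a) else forall a, F (rcons s a)).
Proof.
elim: P F => [|c P IH] F /=; first by case: b.
have {}IH a := IH (fun s => F (a :: s)).
case: c; first by split=> -[a /IH h]; exists a.
by split=> h a; apply/IH.
Qed.

(** A universal variable may take any value [y] after the earlier moves [s] are fixed. The default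
    [true] makes the hypothesis imply that [j] lies within the prefix. *)
Lemma Q_last P j F : nth true P j = false -> Q P F ->
  exists s, forall y, exists2 s', F s' &
    nth d s' j = y /\ forall i, i < j -> nth d s' i = nth d s i.
Proof.
elim: P j F => [|b P IH] [|j] F //=.
  move=> ->; move=> h; exists [::] => y.
  by have [s _ Fs] := Q_witness (h y); exists (y :: s).
move=> Pj h; have [a {}h] : exists a, Q P (fun s => F (a :: s)).
  by case: b h => // /(_ d); exists d.
have [s hs] := IH _ _ Pj h; exists (a :: s) => y.
have [s' Fs' [s'j ss']] := hs y; exists (a :: s') => //; split=> // -[|i] //=.
exact: ss'.
Qed.

(** A strategy that matters only at one existential position, where it answers with a function [g]
    of the earlier values. *)
Lemma Q_choose P j (g : seq D -> D) F : nth false P j ->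
  (forall s, size s = size P -> nth d s j = g (take j s) -> F s) -> Q P F.
Proof.
elim: P j g F => [|b P IH] [|j] g F //=.
  move=> -> h; exists (g [::]); apply: Q_all => s sP.
  by apply: h; rewrite /= ?sP ?take0.
move=> Pj h.
have {}IH a : Q P (fun s => F (a :: s)).
  apply: (IH _ (fun u => g (a :: u)) _ Pj) => s sP sj.
  by apply: h; rewrite /= ?sP.
by case: b h => _; [exists d | move=> a].
Qed.

Definition val s (env : seq nat) := [seq nth d s i | i <- env].

Lemma depends_val env (F : seq D -> Prop) : depends (mem env) (fun s => F (val s env)).
Proof.
by move=> s s' ss'; rewrite (_ : val s env = val s' env) //; apply/eq_in_map.
Qed.

Lemma depends_sub (I J : pred nat) F :
  (forall i, I i -> J i) -> depends I F -> depends J F.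
Proof. by move=> IJ dF s s' ss'; apply: dF => i /IJ; apply: ss'. Qed.

Lemma val_iota s : val s (iota 0 (size s)) = s.
Proof.
apply: (@eq_from_nth _ d); rewrite size_map size_iota // => i is_.
by rewrite (nth_map 0) ?size_iota // nth_iota.
Qed.

Lemma Q_exists k (F : seq D -> Prop) : Q (nseq k true) F <-> exists2 s, size s = k & F s.
Proof.
split=> [/Q_witness[s]|[s]]; first by rewrite size_nseq; exists s.
elim: k F s => [|k IH] F [|a s] //= [sk] Fs.
by exists a; apply: (IH _ s).
Qed.

End Prefix.

Arguments depends_val {D} d env F.

(* Two winning strategies for the same prefix are played against each other;  *)
(* the pairs in Z are indices at which both plays must agree.                 *)
Section Play.

Variables (D : Type) (d : D) (P : seq bool).

Let E := nth false P.

(** Both plays are winning so far and agree on the matched positions that both have reached. A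
    position whose partner is already played is universal, so the partner's value can be copied
    there. *)
Record playing (Z : seq (nat * nat)) (F F' : seq D -> Prop) (s s' : seq D) : Prop := Playing {
  play_left : size s <= size P /\ Q (drop (size s) P) (fun r => F (s ++ r));
  play_right : size s' <= size P /\ Q (drop (size s') P) (fun r => F' (s' ++ r));
  play_both : forall i i', (i, i') \in Z -> i < size s -> i' < size s' ->
    nth d s i = nth d s' i';
  play_ahead : forall i i', (i, i') \in Z -> i < size s -> size s' <= i' -> ~~ E i';
  play_behind : forall i i', (i, i') \in Z -> size s <= i -> i' < size s' -> ~~ E i
}.

Definition swap_pairs (Z : seq (nat * nat)) := [seq (p.2, p.1) | p <- Z].

Lemma mem_swap_pairs Z i i' : ((i, i') \in swap_pairs Z) = ((i', i) \in Z).
Proof. by apply/mapP/idP => [[[j j'] h [-> ->]] //|h]; exists (i', i). Qed.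

Lemma playing_sym Z F F' s s' : playing Z F F' s s' -> playing (swap_pairs Z) F' F s' s.
Proof.
case=> pl pr pb pa ph; split=> // i i'; rewrite mem_swap_pairs.
- by move=> Zi si si'; rewrite (pb _ _ Zi).
- by move=> Zi si si'; apply: ph Zi _ _.
- by move=> Zi si si'; apply: pa Zi _ _.
Qed.

Definition partial_inj (Z : seq (nat * nat)) :=
  (forall i j j', (i, j) \in Z -> (i, j') \in Z -> j = j') /\
  (forall i i' j, (i, j) \in Z -> (i', j) \in Z -> i = i').

(** The next variable is universal, but its partner is an existential one still to be played: its
    value has to wait for the other strategy. *)
Definition stuck (Z : seq (nat * nat)) (n n' : nat) :=
  ~~ E n /\ exists2 i', (n, i') \in Z & n' <= i' /\ E i'.

Lemma playing_move Z F F' s s' : partial_inj Z ->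
  (forall i i', (i, i') \in Z -> ~~ (E i && E i')) ->
  playing Z F F' s s' -> size s < size P -> ~ stuck Z (size s) (size s') ->
  exists a, playing Z F F' (rcons s a) s'.
Proof.
move=> [inj1 inj2] nE [[sP q] pr pb pa ph] lt nst.
have rcons_playing a : Q (drop (size s).+1 P) (fun r => F (rcons s a ++ r)) ->
    (forall i', (size s, i') \in Z -> i' < size s' -> a = nth d s' i') ->
    (forall i', (size s, i') \in Z -> size s' <= i' -> ~~ E i') ->
    playing Z F F' (rcons s a) s'.
  move=> qa h1 h2; split=> //; rewrite ?size_rcons //.
  - move=> i i' Zi; rewrite ltnS leq_eqVlt nth_rcons => /orP[/eqP iE|si] si'.
      by rewrite iE ltnn eqxx; apply: h1; rewrite -?iE.
    by rewrite si; apply: pb.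
  - move=> i i' Zi; rewrite ltnS leq_eqVlt => /orP[/eqP iE|si]; last exact: pa Zi si.
    by apply: h2; rewrite -iE.
  - by move=> i i' Zi si; apply: ph Zi (ltnW si).
have cat_cons a r : rcons s a ++ r = s ++ a :: r by rewrite cat_rcons.
move: q; rewrite (drop_nth false lt) -[nth false P _]/(E (size s)).
case En: (E (size s)) => /= q.
  case: q => a qa; exists a; apply: rcons_playing; first by apply: Q_mono qa => r _; rewrite cat_cons.
    by move=> i' Zi si'; have := ph _ _ Zi (leqnn _) si'; rewrite En.
  by move=> i' Zi _; have := nE _ _ Zi; rewrite En.
have qa a : Q (drop (size s).+1 P) (fun r => F (rcons s a ++ r)).
  by apply: Q_mono (q a) => r _; rewrite cat_cons.
have [[i' Zi' si']|none] := classic (exists2 i', (size s, i') \in Z & i' < size s').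
  exists (nth d s' i'); apply: rcons_playing => // j' Zj'; have := inj1 _ _ _ Zi' Zj'.
    by move=> ->.
  by move=> <-; rewrite leqNgt si'.
exists d; apply: rcons_playing => // i' Zi' si'; first by case: none; exists i'.
apply/negP => Ei'; apply: nst; split; first by rewrite En.
by exists i'.
Qed.

(** A play that is not stuck can be extended. If both are stuck, the two pairs involved form the
    cycle of length two that the hypothesis excludes; longer cycles need no consideration because
    each play proceeds in the order of the prefix. *)
Lemma playing_finish Z F F' : partial_inj Z ->
  (forall i i', (i, i') \in Z -> [/\ i < size P, i' < size P & ~~ (E i && E i')]) ->
  (forall i i' j j', (i, i') \in Z -> (j, j') \in Z ->
     ~~ E i -> E j -> i < j -> ~~ E j' -> E i' -> j' < i' -> False) ->
  Q P F -> Q P F' ->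
  exists s s', [/\ F s, F' s' & forall i i', (i, i') \in Z -> nth d s i = nth d s' i'].
Proof.
move=> injZ ZE acyc QF QF'.
have play0 : playing Z F F' [::] [::] by split=> //; rewrite ?drop0.
have injZ' : partial_inj (swap_pairs Z).
  case: injZ => i1 i2; split=> [i j j'|i i' j]; rewrite !mem_swap_pairs; [exact: i2 | exact: i1].
have nE i i' : (i, i') \in Z -> ~~ (E i && E i') by case/ZE.
have nE' i i' : (i, i') \in swap_pairs Z -> ~~ (E i && E i').
  by rewrite mem_swap_pairs andbC; apply: nE.
have swapK : swap_pairs (swap_pairs Z) = Z.
  by rewrite /swap_pairs -map_comp map_id_in // => -[].
suff h k s s' : (size P - size s) + (size P - size s') = k -> playing Z F F' s s' ->
    exists s s', playing Z F F' s s' /\ size s = size P /\ size s' = size P.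
  have [s [s' [[[_ ql] [_ qr] pb _ _] [sP s'P]]]] := h _ _ _ erefl play0.
  move: ql qr; rewrite sP s'P !drop_size /= !cats0 => Fs F's'.
  exists s, s'; split=> // i i' Zi; have [iP i'P _] := ZE _ _ Zi.
  by apply: pb; rewrite ?sP ?s'P.
elim: k s s' => [|k IH] s s' sk pl.
  exists s, s'; split=> //; case: pl => [[sP _] [s'P _] _ _ _]; lia.
have [sP s'P] : size s <= size P /\ size s' <= size P by case: pl => [[]? _ []].
have movel : size s < size P -> ~ stuck Z (size s) (size s') ->
    exists s s', playing Z F F' s s' /\ size s = size P /\ size s' = size P.
  move=> lt nst; have [a pa] := playing_move injZ nE pl lt nst.
  by apply: (IH _ _ _ pa); rewrite size_rcons; lia.
have mover : size s' < size P -> ~ stuck (swap_pairs Z) (size s') (size s) ->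
    exists s s', playing Z F F' s s' /\ size s = size P /\ size s' = size P.
  move=> lt nst; have [a /playing_sym pa] := playing_move injZ' nE' (playing_sym pl) lt nst.
  rewrite swapK in pa; apply: (IH _ _ _ pa); rewrite size_rcons; lia.
have [lt|ge] := ltnP (size s) (size P); last first.
  apply: mover; first by lia.
  move=> [_ [i']]; rewrite mem_swap_pairs => /ZE[i'P _ _] [si' _]; lia.
have [st|] := classic (stuck Z (size s) (size s')); last exact: movel.
have lt' : size s' < size P.
  case: st => _ [i' /ZE[_ i'P _] [si' _]]; lia.
have [st'|] := classic (stuck (swap_pairs Z) (size s') (size s)); last exact: mover.
case: st => nEs [i' Zi' [si' Ei']]; case: st' => nEs' [i].
rewrite mem_swap_pairs => Zi [si Ei]; exfalso.
apply: (acyc _ _ _ _ Zi' Zi) => //.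
  by rewrite ltn_neqAle si andbT; apply: contra nEs => /eqP->.
by rewrite ltn_neqAle si' andbT; apply: contra nEs' => /eqP->.
Qed.

End Play.

(** * Literals *)

(* A literal consists of its sign, its relation symbol (None for equality)    *)
(* and the indices of its variables in the quantifier prefix.                 *)
Definition lit := (bool * (option (nat * seq bool) * seq nat))%type.

(** The prenex prefix of the term or of its negation: an [Ex] that binds a variable contributes its
    polarity. *)
Fixpoint kinds (t : term) (b : bool) : seq bool :=
  match t with
  | Rel _ _ | Equ => [::]
  | Perm t | Swap t => kinds t b
  | Neg t => kinds t (~~ b)
  | Join t u => kinds t b ++ kinds u b
  | Ex t => if ar t == 0 then kinds t b else b :: kinds t b
  end.

(* ls is a list of literals that jointly imply t (if b) or its negation (if   *)
(* not b); it is empty unless alive. The free variables of t have the indices *)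
(* env, and n is the number of variables quantified so far.                   *)
Fixpoint Sel (t : term) (b alive : bool) (env : seq nat) (n : nat) (ls : seq lit) : Prop :=
  match t with
  | Rel k w => ls = if alive then [:: (b, (Some (k, w), env))] else [::]
  | Equ => ls = if alive then [:: (b, (None, env))] else [::]
  | Perm t => Sel t b alive (rot 1 env) n ls
  | Swap t => Sel t b alive (swap_last env) n ls
  | Neg t => Sel t (~~ b) alive env n ls
  | Join t u => exists c l1 l2, [/\ ls = l1 ++ l2,
      Sel t b (alive && (b || c)) (take (ar t) env) n l1 &
      Sel u b (alive && (b || ~~ c)) (drop (ar t) env) (n + size (kinds t b)) l2]
  | Ex t => if ar t == 0 then Sel t b alive env n ls
            else Sel t b alive (rcons env n) n.+1 ls
  end.

Lemma Sel_dead t b env n ls : Sel t b false env n ls <-> ls = [::].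
Proof.
elim: t b env n ls => [k w||t IH|t IH|t IH|t IHt u IHu|t IH] b env n ls //=.
  split=> [[c [l1 [l2 [-> /IHt-> /IHu->]]]]|->] //.
  by exists true, [::], [::]; split=> //; [apply/IHt | apply/IHu].
by case: eqP => _; apply: IH.
Qed.

Definition signed (b : bool) (F : Prop) : Prop := if b then F else ~ F.

Lemma signed_andl b (F F' : Prop) : F -> signed b (F /\ F') <-> signed b F'.
Proof. by case: b => f /=; tauto. Qed.

Definition atom_sem (m : model) (r : option (nat * seq bool)) (v : seq (dom m)) : Prop :=
  if r is Some kw then sem (m := m) (Rel kw.1 kw.2) v else sem (m := m) Equ v.

Definition lit_sem (m : model) (d : dom m) (l : lit) (s : seq (dom m)) : Prop :=
  signed l.1 (atom_sem l.2.1 (val d s l.2.2)).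

Lemma size_val (D : Type) (d : D) s env : size (val d s env) = size env.
Proof. exact: size_map. Qed.

Lemma swap_last_map (A B : Type) (f : A -> B) s : swap_last (map f s) = map f (swap_last s).
Proof.
rewrite /swap_last -map_rev; case: (rev s) => [|a [|b u]] //=.
by rewrite map_rev.
Qed.

Lemma perm_swap_last (A : eqType) (s : seq A) : perm_eq (swap_last s) s.
Proof.
rewrite /swap_last; case E: (rev s) => [|a [|b u]] //.
rewrite -[X in perm_eq _ X]revK E perm_rev perm_sym perm_rev.
by rewrite -[X in perm_eq X]cat1s -[X in perm_eq _ X]cat1s -[b :: u]cat1s -[a :: u]cat1s perm_catCA.
Qed.

Definition wf_env (n : nat) (env : seq nat) := uniq env && all (fun i => i < n) env.

Section Semantics.

Variables (m : model) (d : dom m) (P : seq bool).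

(** The formula uses only variables from [pre], so its own quantifier can be taken to be the next
    one of the prefix; all later quantifiers are vacuous for it. *)
Lemma Q_signed_ex t b env pre ext : P = rcons pre b ++ ext -> ar t != 0 ->
  all (fun i => i < size pre) env -> size env = (ar t).-1 ->
  Q P (fun s => signed b (sem (m := m) (Ex t) (val d s env))) <->
  Q P (fun s => signed b (sem t (val d s (rcons env (size pre))))).
Proof.
move=> -> t0 /allP envn szenv.
have dep (F : seq (dom m) -> Prop) : depends d (fun i => i < size pre) (fun s => F (val d s env)).
  by apply: depends_sub (depends_val d env F) => i /envn.
rewrite (Q_cat (d := d)); last first.
  apply: (depends_sub _ (dep (fun v => signed b (sem (Ex t) v)))) => i.
  by rewrite size_rcons; apply: ltnW.
rewrite (Q_cat (d := d)); last first.
  apply: (depends_sub _ (depends_val d (rcons env (size pre)) (fun v => signed b (sem t v)))).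
  move=> i; rewrite /= mem_rcons in_cons size_rcons => /orP[/eqP->//|/envn/ltnW//].
rewrite -cats1 (Q_cat (d := d)); last exact: (dep (fun v => signed b (sem (Ex t) v))).
rewrite cats1 Q_rcons; apply: Q_ext => s ss.
have vE a : val d (rcons s a) (rcons env (size pre)) = rcons (val d s env) a.
  rewrite /val map_rcons nth_rcons ss ltnn eqxx; congr rcons.
  by apply/eq_in_map => i /envn ilt; rewrite nth_rcons ss ilt.
have ex : sem (Ex t) (val d s env) <-> exists a, sem t (rcons (val d s env) a).
  by rewrite /= (negPf t0) size_val szenv; split=> [[]|].
case: b {dep} => /=.
  by rewrite -/(sem (Ex t) _) ex; split=> -[a]; exists a; rewrite ?vE // -vE.
rewrite -/(sem (Ex t) _) ex; split=> [h a|h [a]]; first by rewrite vE => ta; apply: h; exists a.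
by rewrite -vE; apply: h.
Qed.

(** The quantifiers are distributed down to the literals. At a [Join] the two halves of [env] are
    disjoint because [env] has no repetition, so [Q_and] applies for positive polarity and [Q_or]
    for negative polarity. *)
Lemma Sel_sem t b env pre ext : P = pre ++ kinds t b ++ ext ->
  size env = ar t -> wf_env (size pre) env ->
  Q P (fun s => signed b (sem (m := m) t (val d s env))) <->
  exists2 ls, Sel t b true env (size pre) ls &
    forall l, l \in ls -> Q P (lit_sem d l).
Proof.
elim: t b env pre ext => [k w||t IH|t IH|t IH|t IHt u IHu|t IH] b env pre ext PE szenv wf.
- split=> [h|[ls -> h]]; last exact: (h _ (mem_head _ _)).
  by exists [:: (b, (Some (k, w), env))] => // l; rewrite in_cons orbF => /eqP->.
- split=> [h|[ls -> h]]; last exact: (h _ (mem_head _ _)).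
  by exists [:: (b, (None, env))] => // l; rewrite in_cons orbF => /eqP->.
- rewrite -(IH _ _ _ _ PE) ?size_rot //; last first.
    by move: wf; rewrite /wf_env rot_uniq (eq_all_r (mem_rot 1 env)).
  apply: Q_ext => s _; rewrite /= /val map_rot size_map szenv.
  exact: signed_andl.
- rewrite -(IH _ _ _ _ PE) ?size_swap_last //; last first.
    move: wf; rewrite /wf_env (perm_uniq (perm_swap_last env)).
    by rewrite (eq_all_r (perm_mem (perm_swap_last env))).
  apply: Q_ext => s _; rewrite /= /val swap_last_map size_map szenv.
  exact: signed_andl.
- rewrite -(IH _ _ _ _ PE) //; apply: Q_ext => s _ /=.
  rewrite size_val szenv; case: b {PE} => /=; first by split=> // -[].
  split=> [h|h [_]//]; apply: NNPP => h'; exact: h.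
- case/andP: wf => ue /allP envn.
  have szt : size (take (ar t) env) = ar t by rewrite size_takel // szenv leq_addr.
  have szu : size (drop (ar t) env) = ar u by rewrite size_drop szenv addKn.
  have wft : wf_env (size pre) (take (ar t) env).
    by rewrite /wf_env take_uniq //; apply/allP => i /mem_take/envn.
  have wfu : wf_env (size (pre ++ kinds t b)) (drop (ar t) env).
    rewrite /wf_env drop_uniq //; apply/allP => i /mem_drop/envn.
    by rewrite size_cat; lia.
  have PEt : P = pre ++ kinds t b ++ (kinds u b ++ ext) by rewrite PE /= -catA.
  have PEu : P = (pre ++ kinds t b) ++ kinds u b ++ ext by rewrite PE /= -!catA.
  have {}IHt := IHt _ _ _ _ PEt szt wft; have {}IHu := IHu _ _ _ _ PEu szu wfu.
  rewrite size_cat in IHu.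
  set Ft := fun s => signed b (sem t (val d s (take (ar t) env))) in IHt.
  set Fu := fun s => signed b (sem u (val d s (drop (ar t) env))) in IHu.
  have disj i : ~~ ((mem (take (ar t) env)) i && (mem (drop (ar t) env)) i).
    apply/negP => /andP[it iu]; move: ue; rewrite -(cat_take_drop (ar t) env) cat_uniq.
    by case/and3P=> _ /hasPn/(_ _ iu)/negP.
  have depF := depends_val d _ (fun v => signed b (sem _ v)).
  have semE s : sem (Join t u) (val d s env) <->
      sem t (val d s (take (ar t) env)) /\ sem u (val d s (drop (ar t) env)).
    by rewrite /= size_val szenv /val map_take map_drop; split=> [[]|].
  case: b @Ft @Fu IHt IHu depF {PE PEt PEu wfu} => Ft Fu IHt IHu depF.
    have -> : Q P (fun s => signed true (sem (Join t u) (val d s env))) <->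
              Q P (fun s => Ft s /\ Fu s) by apply: Q_ext => s _; apply: semE.
    rewrite (Q_and _ disj (depF _ _) (depF _ _)) IHt IHu; split.
      move=> [[l1 s1 h1] [l2 s2 h2]]; exists (l1 ++ l2); first by exists true, l1, l2.
      by move=> l; rewrite mem_cat => /orP[/h1|/h2].
    move=> [ls [c [l1 [l2 [-> s1 s2]]]] h].
    by split; [exists l1 | exists l2] => // l ll; apply: h; rewrite mem_cat ll ?orbT.
  have -> : Q P (fun s => signed false (sem (Join t u) (val d s env))) <->
            Q P (fun s => Ft s \/ Fu s).
    apply: Q_ext => s _; rewrite /Ft /Fu /signed semE.
    by split=> [/not_and_or|] // /or_not_and.
  rewrite (Q_or _ disj (depF _ _) (depF _ _)) IHt IHu; split.
    case=> -[l s1 h]; exists l => //.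
      by exists true, l, [::]; rewrite cats0 /=; split=> //; apply/Sel_dead.
    by exists false, [::], l; split=> //; apply/Sel_dead.
  move=> [ls [[] [l1 [l2 [-> s1 s2]]]] h]; [left | right]; [exists l1 | exists l2] => //.
    by move=> l ll; apply: h; rewrite mem_cat ll.
  by move=> l ll; apply: h; rewrite mem_cat ll orbT.
- have [t0|t0] := eqVneq (ar t) 0.
    move: PE; rewrite /= t0 /= => PE.
    rewrite -(IH _ _ _ _ PE) //; last by rewrite szenv /= t0.
    apply: Q_ext => s _; rewrite size_val szenv /= t0.
    exact: signed_andl.
  case/andP: wf => ue envn.
  have PE' : P = rcons pre b ++ kinds t b ++ ext by rewrite PE /= (negPf t0) cat_rcons.
  rewrite (Q_signed_ex PE') // /Sel -/Sel (negPf t0) -(size_rcons pre b).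
  have sz' : size (rcons env (size pre)) = ar t.
    by rewrite size_rcons szenv /= prednK // lt0n.
  have wf' : wf_env (size (rcons pre b)) (rcons env (size pre)).
    rewrite /wf_env rcons_uniq ue andbT size_rcons all_rcons ltnSn /=.
    apply/andP; split; first by apply/negP => /(allP envn); rewrite ltnn.
    by apply: sub_all envn => i; apply: ltnW.
  exact: (IH _ _ _ _ PE' sz' wf').
Qed.

End Semantics.

Lemma Sel_wf t b alive env n ls l N : Sel t b alive env n ls ->
  size env = ar t -> wf_env n env -> n + size (kinds t b) <= N -> l \in ls ->
  wf_env N l.2.2 /\ size l.2.2 = (if l.2.1 is Some kw then kw.1 else 2).
Proof.
have wf_leq n' e : n' <= N -> wf_env n' e -> wf_env N e.
  by move=> h /andP[ue en]; rewrite /wf_env ue; apply: sub_all en => i; lia.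
elim: t b alive env n ls => [k w||t IH|t IH|t IH|t IHt u IHu|t IH] b alive env n ls /=.
- case: alive => -> // sz wf le; rewrite in_cons orbF => /eqP-> /=.
  by split=> //; apply: wf_leq wf; lia.
- case: alive => -> // sz wf le; rewrite in_cons orbF => /eqP-> /=.
  by split=> //; apply: wf_leq wf; lia.
- move=> sl sz wf; apply: (IH _ _ _ _ _ sl); rewrite ?size_rot //.
  by move: wf; rewrite /wf_env rot_uniq (eq_all_r (mem_rot 1 env)).
- move=> sl sz wf; apply: (IH _ _ _ _ _ sl); rewrite ?size_swap_last //.
  move: wf; rewrite /wf_env (perm_uniq (perm_swap_last env)).
  by rewrite (eq_all_r (perm_mem (perm_swap_last env))).
- exact: IH.
- move=> [c [l1 [l2 [-> s1 s2]]]] sz /andP[ue /allP en].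
  rewrite size_cat mem_cat => le /orP[] ll.
    apply: (IHt _ _ _ _ _ s1) ll; [by rewrite size_takel // sz leq_addr | | lia].
    by rewrite /wf_env take_uniq //; apply/allP => i /mem_take/en.
  apply: (IHu _ _ _ _ _ s2) ll; [by rewrite size_drop sz addKn | | lia].
  by rewrite /wf_env drop_uniq //; apply/allP => i /mem_drop/en; lia.
- case: eqP => [t0|/eqP t0] sl sz wf /=.
    by apply: (IH _ _ _ _ _ sl) => //; rewrite sz t0.
  move=> le; apply: (IH _ _ _ _ _ sl); last by lia.
    by rewrite size_rcons sz prednK // lt0n.
  case/andP: wf => ue en; rewrite /wf_env rcons_uniq ue all_rcons ltnSn andbT /=.
  apply/andP; split; first by apply/negP => /(allP en); rewrite ltnn.
  by apply: sub_all en => i; apply: ltnW.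
Qed.

Definition prefix_of (t : term) : seq bool := nseq (ar t) true ++ kinds t true.

Lemma satisfiable_Sel t : satisfiable t <->
  exists ls m (d : dom m), Sel t true true (iota 0 (ar t)) (ar t) ls /\
    forall l, l \in ls -> Q (prefix_of t) (lit_sem d l).
Proof.
have wf : wf_env (size (nseq (ar t) true)) (iota 0 (ar t)).
  by rewrite /wf_env iota_uniq size_nseq; apply/allP => i; rewrite mem_iota.
have PE : prefix_of t = nseq (ar t) true ++ kinds t true ++ [::] by rewrite cats0.
have main m (d : dom m) : Q (prefix_of t) (fun s => sem t (val d s (iota 0 (ar t)))) <->
    exists2 s, size s = ar t & sem (m := m) t s.
  rewrite (Q_cat (d := d)); last first.
    apply: depends_sub (depends_val d _ (fun v => sem t v)) => i.
    by rewrite /= mem_iota size_nseq.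
  rewrite (Q_exists d).
  have vE s : size s = ar t -> val d s (iota 0 (ar t)) = s by move=> <-; apply: val_iota.
  by split=> -[s ss]; [rewrite vE // | move=> st]; exists s; rewrite ?vE.
have eqv m (d : dom m) := Sel_sem d PE (size_iota 0 (ar t)) wf.
rewrite satisfiable_sem; split.
  move=> [m [s st]]; case: (dom_inhabited m) => d.
  have ex : exists2 s, size s = ar t & sem (m := m) t s.
    by exists s; rewrite ?(sem_size st).
  have [ls sl h] := proj1 (eqv m d) (proj2 (main m d) ex).
  by exists ls, m, d; split=> //; rewrite size_nseq in sl.
move=> [ls [m [d [sl h]]]].
have ex : exists2 ls, Sel t true true (iota 0 (ar t)) (size (nseq (ar t) true)) ls &
    forall l, l \in ls -> Q (prefix_of t) (lit_sem d l).
  by exists ls; rewrite ?size_nseq.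
have [s _ st] := proj1 (main m d) (proj2 (eqv m d) ex).
by exists m, s.
Qed.

(** * The consistency criterion for sets of literals *)

Definition same_symbol (r r' : option (nat * seq bool)) : bool :=
  if r is Some x then
    if r' is Some y then (x.1 == y.1) && (x.2 == y.2) else false
  else false.

Definition consistent_with (eq_ok : bool -> seq nat -> bool)
    (ok : seq nat -> seq nat -> bool) (ls : seq lit) : bool :=
  all (fun l => if l.2.1 is Some _ then true else eq_ok l.1 l.2.2) ls &&
  all (fun l => all (fun l' =>
    ~~ ((l.1 && ~~ l'.1) && same_symbol l.2.1 l'.2.1) || ok l.2.2 l'.2.2) ls) ls.

Lemma mem_zip (u v : seq nat) i i' : (i, i') \in zip u v -> i \in u /\ i' \in v.
Proof.
elim: u v => [|a u IH] [|a' v] //=; rewrite !in_cons => /orP[/eqP[-> ->]|/IH[-> ->]].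
  by rewrite !eqxx.
by rewrite !orbT.
Qed.

Lemma eq_map_zip (A : Type) (f g : nat -> A) (u v : seq nat) : size u = size v ->
  (forall i i', (i, i') \in zip u v -> f i = g i') -> map f u = map g v.
Proof.
elim: u v => [|a u IH] [|a' v] //= [sz] h.
rewrite (h a a') ?mem_head // (IH v) // => j j' jj; apply: h.
by rewrite in_cons jj orbT.
Qed.

Lemma partial_inj_zip u v : uniq u -> uniq v -> partial_inj (zip u v).
Proof.
elim: u v => [|a u IH] [|a' v] //= /andP[au uu] /andP[av uv].
have [IH1 IH2] := IH _ uu uv; split=> i j j'; rewrite !in_cons.
  case/orP=> [/eqP[-> ->]|h1]; case/orP=> [/eqP[]|h2] //; last exact: IH1 h1 h2.
    by case: (mem_zip h2) => a2; rewrite a2 in au.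
  by case: (mem_zip h1) => a2 _ ia; rewrite -ia a2 in au.
case/orP=> [/eqP[-> ->]|h1]; case/orP=> [/eqP[]|h2] //; last exact: IH2 h1 h2.
  by case: (mem_zip h2) => _ a2; rewrite a2 in av.
by case: (mem_zip h1) => _ a2 _ ia; rewrite -ia a2 in av.
Qed.

Section Consistency.

Variable P : seq bool.

(** With at least two elements, an equality or inequality of two distinct variables is winnable iff
    the later of them, the one with the greater index, is existential. *)
Definition innermost_exists (env : seq nat) : bool :=
  nth false P (maxn (nth 0 env 0) (nth 0 env 1)).

(* Skolem terms clash in the first case. In the second one, the term for      *)
(* q.1 contains the variable p.1 and the term for p.2 contains q.2.           *)
Definition non_unifiable (env env' : seq nat) : bool :=
  has (fun p => nth false P p.1 && nth false P p.2) (zip env env') ||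
  has (fun p => has (fun q =>
    ((~~ nth false P p.1 && nth false P q.1) && (p.1 < q.1)) &&
    ((~~ nth false P q.2 && nth false P p.2) && (q.2 < p.2))) (zip env env'))
    (zip env env').

(* The two disjuncts correspond to one-element domains and to larger domains. *)
Definition consistent (ls : seq lit) : bool :=
  consistent_with (fun b _ => b) (fun _ _ => false) ls ||
  consistent_with (fun _ => innermost_exists) non_unifiable ls.

Definition wf_lit (l : lit) : Prop :=
  wf_env (size P) l.2.2 /\ size l.2.2 = (if l.2.1 is Some kw then kw.1 else 2).

Lemma same_symbolP r r' :
  reflect (exists2 x, r = Some x & r' = Some x) (same_symbol r r').
Proof.
apply: (iffP idP) => [|[x -> ->]]; last by rewrite /= !eqxx.
case: r r' => [[k w]|] // [[k' w']|] //= /andP[/eqP-> /eqP->].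
by exists (k', w').
Qed.

Lemma consistent_withP (eq_ok : bool -> seq nat -> bool)
    (ok : seq nat -> seq nat -> bool) (ls : seq lit) : reflect
  ((forall b env, (b, (None, env)) \in ls -> eq_ok b env) /\
   (forall x env env', (true, (Some x, env)) \in ls -> (false, (Some x, env')) \in ls ->
      ok env env'))
  (consistent_with eq_ok ok ls).
Proof.
apply: (iffP andP) => -[h1 h2]; split.
- by move=> b env /(allP h1).
- move=> x env env' /(allP h2)/allP h /h /=.
  by rewrite !eqxx /=.
- by apply/allP => -[b [[x|] env]] //= /h1.
- apply/allP => -[b [r env]] l1; apply/allP => -[b' [r' env']] l2 /=.
  case: b l1 => //= l1; case: b' l2 => //= l2.
  case: same_symbolP => //= -[x rE r'E]; rewrite rE r'E in l1 l2.
  exact: h2 l1 l2.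
Qed.

Lemma sem_rel m k w v : sem (m := m) (Rel k w) v <->
  exists2 x : k.-tuple (dom m), interp w x & tval x = v.
Proof. by []. Qed.

Section Completeness.

Variables (m : model) (d : dom m) (ls : seq lit).
Hypothesis wf : forall l, l \in ls -> wf_lit l.
Hypothesis hQ : forall l, l \in ls -> Q P (lit_sem d l).

Lemma consistent_singleton : (forall a b : dom m, a = b) ->
  consistent_with (fun b _ => b) (fun _ _ => false) ls.
Proof.
move=> D1; have val_eq s s' env env' : size env = size env' -> val d s env = val d s' env'.
  move=> e; apply: (@eq_from_nth _ d); rewrite !size_val // => i _; exact: D1.
apply/consistent_withP; split.
  case=> // env el; have [s _] := Q_witness d (hQ el); case.
  have [_ /=] := wf el; case: env {el} => [|i [|j [|]]] // _.
  by exists (nth d s i); rewrite /= (D1 (nth d s j) (nth d s i)).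
move=> x env env' el el'; have [s _ h] := Q_witness d (hQ el).
have [s' _ h'] := Q_witness d (hQ el').
have [_ /= sz] := wf el; have [_ /= sz'] := wf el'.
by case: h'; rewrite /= (val_eq _ s _ env) // sz sz'.
Qed.

(** The universal variable is chosen after the other one: two different values refute an equality,
    and the value of the other variable refutes an inequality. *)
Lemma Q_eq_universal a1 a2 b o j : a1 <> a2 :> dom m -> o < j ->
  nth true P j = false -> Q P (fun s => signed b (nth d s o = nth d s j)) -> False.
Proof.
move=> a12 oj Pj h; have [s hs] := Q_last d Pj h.
have {}hs y : signed b (nth d s o = y).
  by have [s' hs' [<- <-]] := hs y.
by case: b hs {h} => hs; [apply: a12; rewrite -(hs a1) -(hs a2) | apply: (hs (nth d s o))].
Qed.

Lemma sem_eq i j s : sem (m := m) Equ (val d s [:: i; j]) <-> nth d s i = nth d s j.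
Proof. by split=> [[a [-> ->]]|/= ->] //; exists (nth d s j). Qed.

Lemma eq_innermost a1 a2 b env : a1 <> a2 :> dom m -> (b, (None, env)) \in ls ->
  innermost_exists env.
Proof.
move=> a12 el; have [/andP[ue /allP en] /=] := wf el; have := hQ el.
rewrite /lit_sem /innermost_exists.
case: env ue en {el} => [|i [|j [|]]] //; rewrite /= in_cons orbF andbT => ij en h _.
apply: contraT => ne; exfalso.
have [iP jP] : i < size P /\ j < size P by split; apply: en; rewrite !in_cons eqxx ?orbT.
have Pm : nth true P (maxn i j) = false.
  by rewrite (set_nth_default false) ?(negPf ne) // gtn_max iP.
case: (ltngtP i j) ij Pm => // lt _ Pm.
  apply: (Q_eq_universal (b := b) a12 lt Pm); apply: Q_mono h => s _.
  by case: b => /= [/sem_eq|h /sem_eq/h].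
apply: (Q_eq_universal (b := b) a12 lt Pm); apply: Q_mono h => s _.
by case: b => /= [/sem_eq|h e]; [|apply: h; apply/sem_eq].
Qed.

(** Otherwise [playing_finish] would produce two winning plays with the same tuple of arguments,
    which would be both in the relation and outside it. *)
Lemma opposite_non_unifiable x env env' :
  (true, (Some x, env)) \in ls -> (false, (Some x, env')) \in ls ->
  non_unifiable env env'.
Proof.
move=> el el'; apply: contraT; rewrite /non_unifiable negb_or => /andP[/hasPn h1 /hasPn h2].
have [/andP[ue /allP en] /= sz] := wf el; have [/andP[ue' /allP en'] /= sz'] := wf el'.
have [s [s' [hs hs' ss']]] : exists s s', [/\
    lit_sem d (true, (Some x, env)) s, lit_sem d (false, (Some x, env')) s' &
    forall i i', (i, i') \in zip env env' -> nth d s i = nth d s' i'].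
  apply: (playing_finish d _ _ _ (hQ el) (hQ el')).
  - exact: partial_inj_zip.
  - move=> i i' ii; have [ie ie'] := mem_zip ii.
    by split; [apply: en | apply: en' | exact: (h1 _ ii)].
  move=> i i' j j' ii jj Ei Ej ij Ej' Ei' ji.
  have /hasPn/(_ _ jj) := h2 _ ii.
  by rewrite /= Ei Ej ij Ej' Ei' ji.
exfalso; apply: hs'; rewrite /lit_sem /= in hs *.
rewrite (_ : val d s' env' = val d s env) //; symmetry.
by apply: eq_map_zip => //; rewrite sz sz'.
Qed.

Lemma consistent_complete : consistent ls.
Proof.
apply/orP; have [D1|D2] := classic (forall a b : dom m, a = b).
  by left; apply: consistent_singleton.
have [a1 D3] := not_all_ex_not _ _ D2; have [a2 a12] := not_all_ex_not _ _ D3.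
right; apply/consistent_withP; split; first by move=> b env; apply: (eq_innermost a12).
exact: opposite_non_unifiable.
Qed.

End Completeness.

Section Soundness.

Variable ls : seq lit.
Hypothesis wf : forall l, l \in ls -> wf_lit l.

(** The canonical strategy on natural numbers: every existential move exceeds all earlier values and
    has parity [b], the sign of the literal. *)
Definition follows (b : bool) (s : seq nat) : Prop :=
  forall i, nth false P i -> odd (nth 0 s i) = b /\
    forall j, j < i -> nth 0 s j < nth 0 s i.

Lemma Q_follows b (F : seq nat -> Prop) :
  (forall s, size s = size P -> follows b s -> F s) -> Q P F.
Proof.
suff gen P' N (F' : seq nat -> Prop) : (forall s, size s = size P' ->
    (forall i, nth false P' i -> [/\ odd (nth 0 s i) = b, N <= nth 0 s i &
       forall j, j < i -> nth 0 s j < nth 0 s i]) -> F' s) -> Q P' F'.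
  move=> h; apply: (gen _ 0) => s sP fs; apply: h => // i Pi.
  by have [? _ ?] := fs i Pi.
elim: P' N F' => [|c P' IH] N F' h /=; first by apply: h => // i; rewrite nth_nil.
have step a : (c -> odd a = b /\ N <= a) -> Q P' (fun s => F' (a :: s)).
  move=> ca; apply: (IH (maxn N a.+1)) => s sP fs; apply: h; rewrite /= ?sP // => -[|i] /=.
    by move/ca => [-> ->].
  move=> Pi; have [-> le lt] := fs i Pi; split=> //; first by lia.
  by move=> [|j] /=; [lia | apply: lt].
case: c step {h} => step; last by move=> a; apply: step.
(* A number of parity [b] that is at least [N], where [N] exceeds all earlier values. *)
exists (N.*2 + b); apply: step => _; rewrite oddD odd_double oddb; split=> //; lia.
Qed.

Definition unit_model : model := @Model unit (inhabits tt)
  (fun k w _ => exists env, (true, (Some (k, w), env)) \in ls).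

(** The least relations that make the canonical strategy win for every positive literal. *)
Definition play_model : model := @Model nat (inhabits 0)
  (fun k w x => exists env s, [/\ (true, (Some (k, w), env)) \in ls,
     follows true s & tval x = val 0 s env]).

Lemma unit_model_sound l : consistent_with (fun b _ => b) (fun _ _ => false) ls ->
  l \in ls -> Q P (lit_sem (m := unit_model) tt l).
Proof.
move=> /consistent_withP[h1 h2] lls; apply: (Q_all tt) => s _.
have [_] := wf lls; move: lls; case: l => [b [[[k w]|] env]] lls /= sz; rewrite /lit_sem.
  case: b lls => lls; last first.
    move=> [x [env' e'] _]; by have := h2 _ _ _ e' lls.
  apply/sem_rel; have szv : size (val tt s env) == k by rewrite size_val sz.
  by exists (Tuple szv) => //; exists env.
have := h1 _ _ lls; case: b lls => // lls _.
case: env lls sz => [|i [|j [|]]] // _ _.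
by exists tt; rewrite /val /=; case: (nth _ _ i); case: (nth _ _ j).
Qed.

(** Two matched existential values would have opposite parities. In a cycle, the value at [p] would
    be smaller than the one at [q] in the play [s] and larger in [s']. *)
Lemma follows_non_unifiable env env' s s' : non_unifiable env env' ->
  size env = size env' ->
  follows true s -> follows false s' -> val 0 s env = val 0 s' env' -> False.
Proof.
move=> nu sz fs fs' vE.
have zipE p : p \in zip env env' -> nth 0 s p.1 = nth 0 s' p.2.
  elim: env env' sz vE {nu} => [|a e IH] [|a' e'] //= [sz] [ae vE].
  by rewrite in_cons => /orP[/eqP->|/IH]; [|apply].
case/orP: nu => /hasP[p pz].
  by case/andP=> /fs[o _] /fs'[o' _]; move: o; rewrite (zipE _ pz) o'.
case/hasP=> q qz /andP[/andP[/andP[_ Eq] pq] /andP[/andP[_ Ep] qp]].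
have [_ /(_ _ pq)] := fs _ Eq; have [_ /(_ _ qp)] := fs' _ Ep.
by rewrite (zipE _ pz) (zipE _ qz) => lt1 lt2; move: (ltn_trans lt1 lt2); rewrite ltnn.
Qed.

(** Relation literals use the canonical strategy, and a negative one can only fail against a
    positive one, by a coincidence that [follows_non_unifiable] excludes. For an equality the inner
    variable copies the outer one; for an inequality it is played above it. *)
Lemma play_model_sound l : consistent_with (fun _ => innermost_exists) non_unifiable ls ->
  l \in ls -> Q P (lit_sem (m := play_model) 0 l).
Proof.
move=> /consistent_withP[h1 h2] lls.
have [/andP[ue /allP en]] := wf lls; move: lls ue en.
case: l => [b [[[k w]|] env]] lls /= ue en sz.
  apply: (Q_follows (b := b)) => s sP fs; rewrite /lit_sem /=.
  case: b lls fs => lls fs.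
    have szv : size (val (0 : dom play_model) s env) == k by rewrite size_val sz.
    by exists (Tuple szv) => //; exists env, s.
  move=> [x [env' [s' [el' fs' xE]]] xv].
  have [_ /= sz'] := wf el'.
  apply: (follows_non_unifiable (h2 _ _ _ el' lls) _ fs' fs); first by rewrite sz'.
  by rewrite -xE.
have := h1 _ _ lls; rewrite /innermost_exists.
case: env lls ue en sz => [|i [|j [|]]] //= lls; rewrite in_cons orbF andbT => ij en _ Pm.
have semE (s : seq nat) : lit_sem (m := play_model) 0 (b, (None, [:: i; j])) s <->
    signed b (nth 0 s i = nth 0 s j).
  rewrite /lit_sem; have e := @sem_eq play_model 0 i j s.
  by case: (b) => /=; [exact: e | split=> h /e/h].
case: b semE {lls} => semE.
  have [o om io] : exists2 o, o < maxn i j & (maxn i j = i /\ o = j) \/ (maxn i j = j /\ o = i).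
    by case: (ltngtP i j) ij => // lt _; [exists i | exists j]; auto.
  apply: (Q_choose (d := 0) (g := fun u => nth 0 u o) Pm) => s sP; rewrite nth_take // => sE.
  by apply/semE; move: sE; case: io => -[-> ->].
apply: (Q_follows (b := true)) => s sP fs; apply/semE => /= e.
have [_ lt] := fs _ Pm.
by case: (ltngtP i j) ij lt => // ij' _ /(_ _ ij'); rewrite e ltnn.
Qed.

Lemma consistent_sound : consistent ls ->
  exists m (d : dom m), forall l, l \in ls -> Q P (lit_sem d l).
Proof.
case/orP=> h; [exists unit_model, tt | exists play_model, 0] => l.
  exact: unit_model_sound.
exact: play_model_sound.
Qed.

End Soundness.

End Consistency.

Theorem satisfiable_consistent t : satisfiable t <->
  exists2 ls, Sel t true true (iota 0 (ar t)) (ar t) ls & consistent (prefix_of t) ls.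
Proof.
have wf ls l : Sel t true true (iota 0 (ar t)) (ar t) ls -> l \in ls -> wf_lit (prefix_of t) l.
  move=> sl; apply: (Sel_wf sl); rewrite ?size_iota // ?size_cat ?size_nseq //.
  by rewrite /wf_env iota_uniq; apply/allP => i; rewrite mem_iota.
rewrite satisfiable_Sel; split=> [[ls [m [d [sl h]]]]|[ls sl cl]].
  exists ls => //; apply: (consistent_complete _ h) => l; exact: wf sl.
have [m [d h]] := consistent_sound (fun l => @wf ls l sl) cl.
by exists ls, m, d.
Qed.

(** * The verifier *)

(* A node of a term: its token, with the arity and the name of a relation     *)
(* symbol, the arity of the first argument of Join, or that of the argument   *)
(* of Ex.                                                                     *)
Definition lexeme := (token * (nat * seq bool))%type.

Fixpoint lexemes (t : term) : seq lexeme :=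
  match t with
  | Rel k w => [:: (tRel, (k, w))]
  | Equ => [:: (tEqu, (0, [::]))]
  | Perm t => (tPerm, (0, [::])) :: lexemes t
  | Swap t => (tSwap, (0, [::])) :: lexemes t
  | Neg t => (tNeg, (0, [::])) :: lexemes t
  | Join t u => (tJoin, (ar t, [::])) :: lexemes t ++ lexemes u
  | Ex t => (tEx, (ar t, [::])) :: lexemes t
  end.

(* The input is read from right to left. The state consists of the relation   *)
(* symbol being read, of the arities of the terms that have been read and of  *)
(* their lexemes, each with the bit that was guessed for it.                  *)
Definition pstate := (option (nat * seq bool) * (seq nat * seq (bool * lexeme)))%type.

Definition parse_unary (c : token) (b : bool) (p : pstate) : option pstate :=
  if p.1 is Some _ then None
  else if p.2.1 is k :: ks then Some (None, (p.2.1, (b, (c, (0, [::]))) :: p.2.2))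
  else None.

Definition parse_bit (x : bool) (p : pstate) : option pstate :=
  if p.1 is Some kw then
    if kw.1 == 0 then Some (Some (0, x :: kw.2), p.2) else None
  else None.

Definition parse_token (c : token) (b : bool) (p : pstate) : option pstate :=
  match c with
  | tEnd => if p.1 is Some _ then None else Some (Some (0, [::]), p.2)
  | tBit0 => parse_bit false p
  | tBit1 => parse_bit true p
  | tArity => if p.1 is Some kw then Some (Some (kw.1.+1, kw.2), p.2) else None
  | tRel => if p.1 is Some kw then
              Some (None, (kw.1 :: p.2.1, (b, (tRel, kw)) :: p.2.2))
            else None
  | tEqu => if p.1 is Some _ then None
            else Some (None, (2 :: p.2.1, (b, (tEqu, (0, [::]))) :: p.2.2))
  | tPerm | tSwap | tNeg => parse_unary c b p
  | tJoin => if p.1 is Some _ then None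
             else if p.2.1 is k :: ks then
               if ks is l :: ks' then
                 Some (None, (k + l :: ks', (b, (tJoin, (k, [::]))) :: p.2.2))
               else None
             else None
  | tEx => if p.1 is Some _ then None
           else if p.2.1 is k :: ks then
             Some (None, (k.-1 :: ks, (b, (tEx, (k, [::]))) :: p.2.2))
           else None
  end.

Definition parse_step (cb : token * bool) (p : option pstate) : option pstate :=
  if p is Some p' then parse_token cb.1 cb.2 p' else None.

Definition parse (s : seq (token * bool)) : option pstate :=
  foldr parse_step (Some (None, ([::], [::]))) s.

Definition pending (o : option (nat * seq bool)) : seq token :=
  if o is Some (k, w) then
    nseq k tArity ++ [seq (if b then tBit1 else tBit0) | b <- w] ++ [:: tEnd]
  else [::].

(** Read from the right, Polish notation leaves a list of complete terms, preceded by at most one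
    partially read relation symbol. *)
Lemma parse_sound s o ks ls : parse s = Some (o, (ks, ls)) ->
  exists2 ts, ks = map ar ts & map fst s = pending o ++ flatten (map encode ts).
Proof.
elim: s o ks ls => [|[c b] s IH] o ks ls /=; first by case=> <- <- _; exists [::].
rewrite -/(parse s) /parse_step; case: (parse s) IH => // -[o' [ks' ls']] IH.
have {IH} [ts -> sE] := IH _ _ _ erefl; rewrite {}sE.
case: c => //=.
- case: o' => // -[k w] /= [<- <- _]; exists (Rel k w :: ts) => //=.
- by case: o' => // -[k w] /= [<- <- _]; exists ts.
- by case: o' => // -[[|k] w] //= [<- <- _]; exists ts.
- by case: o' => // -[[|k] w] //= [<- <- _]; exists ts.
- by case: o' => // -[<- <- _]; exists ts.
- by case: o' => // -[<- <- _]; exists (Equ :: ts).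
- by rewrite /parse_unary /=; case: o' => //; case: ts => //= t ts [<- <- _];
    exists (Perm t :: ts).
- by rewrite /parse_unary /=; case: o' => //; case: ts => //= t ts [<- <- _];
    exists (Swap t :: ts).
- by rewrite /parse_unary /=; case: o' => //; case: ts => //= t ts [<- <- _];
    exists (Neg t :: ts).
- by case: o' => //; case: ts => [|t [|u ts]] //= [<- <- _];
    exists (Join t u :: ts); rewrite //= -catA.
- by case: o' => //; case: ts => [|t ts] //= [<- <- _]; exists (Ex t :: ts).
Qed.

Definition parses_to (t : term) (s : seq (token * bool)) (bs : seq bool) : Prop :=
  size bs = size (lexemes t) /\ forall ks ls,
  foldr parse_step (Some (None, (ks, ls))) s =
    Some (None, (ar t :: ks, zip bs (lexemes t) ++ ls)).

Lemma parse_rel k w (bs : seq bool) b p :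
  foldr parse_step (Some (None, p))
    (zip (encode (Rel k w)) (b :: bs)) = 
  Some (None, (k :: p.1, (b, (tRel, (k, w))) :: p.2)) \/ size bs <> (k + size w).+1.
Proof.
have [sz|] := eqVneq (size bs) (k + size w).+1; last by move/eqP; right.
left; rewrite /=.
have -> : foldr parse_step (Some (None, p)) (zip (nseq k tArity ++
   [seq (if b0 then tBit1 else tBit0) | b0 <- w] ++ [:: tEnd]) bs) = Some (Some (k, w), p).
  elim: k bs sz => [|k IH] [|b' bs] //= [sz]; last by rewrite IH.
    by elim: w bs b' sz => [|x w IH] [|b'' bs] b' //= [sz]; rewrite IH //; case: x.
by case: p.
Qed.

Lemma parse_cat t u s1 s2 bs1 bs2 ks ls :
  parses_to t s1 bs1 -> parses_to u s2 bs2 ->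
  foldr parse_step (Some (None, (ks, ls))) (s1 ++ s2) =
  Some (None, ([:: ar t, ar u & ks], zip (bs1 ++ bs2) (lexemes t ++ lexemes u) ++ ls)).
Proof.
move=> [sz1 h1] [sz2 h2]; rewrite foldr_cat h2 h1.
by rewrite zip_cat // catA.
Qed.

Lemma parses_to_encode t s : map fst s = encode t -> exists bs, parses_to t s bs.
Proof.
elim: t s => [k w||t IH|t IH|t IH|t IHt u IHu|t IH] s sE.
- case: s sE => [|[c b] s] // [-> sE].
  exists [:: b]; split=> // ks ls.
  have szs : size s = (k + size w).+1.
    by rewrite -(size_map fst) sE !size_cat size_nseq size_map /=; lia.
  have [] := parse_rel k w (map snd s) b (ks, ls); last by rewrite size_map.
  move=> <-; congr (foldr _ _ _); rewrite /= -sE; congr cons.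
  by rewrite -/(unzip1 s) -/(unzip2 s) zip_unzip.
- case: s sE => [|[c b] [|]] // [->]; exists [:: b]; by split.
- case: s sE => [|[c b] s] // [-> /IH[bs [sz h]]]; exists (b :: bs).
  by split=> [|ks ls] /=; rewrite ?sz // h.
- case: s sE => [|[c b] s] // [-> /IH[bs [sz h]]]; exists (b :: bs).
  by split=> [|ks ls] /=; rewrite ?sz // h.
- case: s sE => [|[c b] s] // [-> /IH[bs [sz h]]]; exists (b :: bs).
  by split=> [|ks ls] /=; rewrite ?sz // h.
- case: s sE => [|[c b] s] // [-> sE].
  have e1 : map fst (take (size (encode t)) s) = encode t.
    by rewrite map_take sE take_size_cat.
  have e2 : map fst (drop (size (encode t)) s) = encode u.
    by rewrite map_drop sE drop_size_cat.
  have [bs1 h1] := IHt _ e1; have [bs2 h2] := IHu _ e2.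
  exists (b :: bs1 ++ bs2); split=> [|ks ls].
    by rewrite /= !size_cat; case: h1 => ->; case: h2 => ->.
  by rewrite /= -[s in foldr _ _ s](cat_take_drop (size (encode t))) (parse_cat _ _ h1 h2).
- case: s sE => [|[c b] s] // [-> /IH[bs [sz h]]]; exists (b :: bs).
  by split=> [|ks ls] /=; rewrite ?sz // h.
Qed.

(** A node takes the bit of its first token, and the other tokens of a relation symbol get [false];
    so every choice of one bit per node can be guessed. *)
Lemma parses_to_bits t bs : size bs = size (lexemes t) ->
  exists2 s, map fst s = encode t & parses_to t s bs.
Proof.
elim: t bs => [k w||t IH|t IH|t IH|t IHt u IHu|t IH] [|b bs] //= [sz].
- case: bs sz => // _.
  have e : size (encode (Rel k w)) = size (b :: nseq (k + size w).+1 false).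
    by rewrite /= !size_cat size_nseq size_map /= size_nseq; lia.
  exists (zip (encode (Rel k w)) (b :: nseq (k + size w).+1 false)).
    by rewrite -/(unzip1 _) unzip1_zip // e.
  split=> // ks ls.
  by have [|] := parse_rel k w (nseq (k + size w).+1 false) b (ks, ls); rewrite ?size_nseq.
- by case: bs sz => // _; exists [:: (tEqu, b)].
- have [s sE [sz' h]] := IH _ sz; exists ((tPerm, b) :: s); first by rewrite /= sE.
  by split=> [|ks ls] /=; rewrite ?sz // h.
- have [s sE [sz' h]] := IH _ sz; exists ((tSwap, b) :: s); first by rewrite /= sE.
  by split=> [|ks ls] /=; rewrite ?sz // h.
- have [s sE [sz' h]] := IH _ sz; exists ((tNeg, b) :: s); first by rewrite /= sE.
  by split=> [|ks ls] /=; rewrite ?sz // h.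
- rewrite size_cat in sz.
  have sz1 : size (take (size (lexemes t)) bs) = size (lexemes t).
    by rewrite size_takel // sz leq_addr.
  have sz2 : size (drop (size (lexemes t)) bs) = size (lexemes u).
    by rewrite size_drop sz addKn.
  have [s1 e1 h1] := IHt _ sz1; have [s2 e2 h2] := IHu _ sz2.
  exists ((tJoin, b) :: s1 ++ s2); first by rewrite /= map_cat e1 e2.
  split=> [|ks ls]; first by rewrite /= size_cat sz.
  by rewrite /= (parse_cat _ _ h1 h2) cat_take_drop.
- have [s sE [sz' h]] := IH _ sz; exists ((tEx, b) :: s); first by rewrite /= sE.
  by split=> [|ks ls] /=; rewrite ?sz // h.
Qed.

(* The terms that remain to be read, each with its polarity, whether it is    *)
(* selected, and the indices of its free variables; then the quantifier       *)
(* prefix and the selected literals.                                          *)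
Definition frame := (bool * (bool * seq nat))%type.
Definition sstate := (seq frame * (seq bool * seq lit))%type.

Definition add_literal (r : option (nat * seq bool)) (f : frame) (fs : seq frame)
    (v : seq bool * seq lit) : sstate :=
  (fs, if f.2.1 then (v.1, v.2 ++ [:: (f.1, (r, f.2.2))]) else v).

Definition select_lexeme (c : token) (x : bool * (nat * seq bool)) (f : frame)
    (fs : seq frame) (v : seq bool * seq lit) : sstate :=
  match c with
  | tRel => add_literal (Some x.2) f fs v
  | tEqu => add_literal None f fs v
  | tPerm => ((f.1, (f.2.1, rot 1 f.2.2)) :: fs, v)
  | tSwap => ((f.1, (f.2.1, swap_last f.2.2)) :: fs, v)
  | tNeg => ((~~ f.1, f.2) :: fs, v)
  | tJoin => ([:: (f.1, (f.2.1 && (f.1 || x.1), take x.2.1 f.2.2)),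
                 (f.1, (f.2.1 && (f.1 || ~~ x.1), drop x.2.1 f.2.2)) & fs], v)
  | tEx => if x.2.1 == 0 then (f :: fs, v) else
           ((f.1, (f.2.1, rcons f.2.2 (size v.1))) :: fs, (rcons v.1 f.1, v.2))
  | _ => (f :: fs, v)
  end.

Definition select_step (st : sstate) (x : bool * lexeme) : sstate :=
  if st.1 is f :: fs then select_lexeme x.2.1 (x.1, x.2.2) f fs st.2 else st.

Lemma select_step_ar t b alive env fs pre ls bs :
  size bs = size (lexemes t) -> exists2 ls',
  Sel t b alive env (size pre) ls' &
  foldl select_step ((b, (alive, env)) :: fs, (pre, ls)) (zip bs (lexemes t)) =
    (fs, (pre ++ kinds t b, ls ++ ls')).
Proof.
elim: t b alive env fs pre ls bs => [k w||t IH|t IH|t IH|t IHt u IHu|t IH]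
  b alive env fs pre ls [|c bs] //= [sz].
- case: bs sz => // _; rewrite /select_step /= /add_literal /= cats0.
  by eexists; [reflexivity | case: alive; rewrite ?cats0].
- case: bs sz => // _; rewrite /select_step /= /add_literal /= cats0.
  by eexists; [reflexivity | case: alive; rewrite ?cats0].
- exact: IH.
- exact: IH.
- exact: IH.
- rewrite size_cat in sz.
  have sz1 : size (take (size (lexemes t)) bs) = size (lexemes t).
    by rewrite size_takel // sz leq_addr.
  have sz2 : size (drop (size (lexemes t)) bs) = size (lexemes u).
    by rewrite size_drop sz addKn.
  rewrite -[bs](cat_take_drop (size (lexemes t))) zip_cat // foldl_cat.
  have [l1 s1 ->] := IHt b (alive && (b || c)) (take (ar t) env)
    ((b, (alive && (b || ~~ c), drop (ar t) env)) :: fs) pre ls _ sz1.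
  have [l2 s2 ->] := IHu b (alive && (b || ~~ c)) (drop (ar t) env) fs
    (pre ++ kinds t b) (ls ++ l1) _ sz2.
  exists (l1 ++ l2); last by rewrite -!catA.
  by exists c, l1, l2; split=> //; rewrite -size_cat.
- rewrite /select_step /=; case: eqP => _; first exact: IH.
  have [l s1 ->] := IH b alive (rcons env (size pre)) fs (rcons pre b) ls _ sz.
  by exists l; rewrite -?cat_rcons //; rewrite size_rcons in s1.
Qed.

(** The bit of a [Join] node is the choice [c] in [Sel]; the other nodes are given [true]. *)
Lemma select_step_Sel t b alive env fs pre ls ls' :
  Sel t b alive env (size pre) ls' -> exists2 bs, size bs = size (lexemes t) &
  foldl select_step ((b, (alive, env)) :: fs, (pre, ls)) (zip bs (lexemes t)) =
    (fs, (pre ++ kinds t b, ls ++ ls')).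
Proof.
elim: t b alive env fs pre ls ls' => [k w||t IH|t IH|t IH|t IHt u IHu|t IH]
  b alive env fs pre ls ls'.
- move=> /= ->; exists [:: true] => //; rewrite /= /select_step /= /add_literal /= cats0.
  by case: alive; rewrite ?cats0.
- move=> /= ->; exists [:: true] => //; rewrite /= /select_step /= /add_literal /= cats0.
  by case: alive; rewrite ?cats0.
- by move=> /IH h; have [bs sz e] := h fs ls; exists (true :: bs); rewrite /= ?sz.
- by move=> /IH h; have [bs sz e] := h fs ls; exists (true :: bs); rewrite /= ?sz.
- by move=> /IH h; have [bs sz e] := h fs ls; exists (true :: bs); rewrite /= ?sz.
- move=> /= [c [l1 [l2 [-> s1 s2]]]].
  have [bs1 sz1 e1] := IHt _ _ _ ((b, (alive && (b || ~~ c), drop (ar t) env)) :: fs) _ ls _ s1.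
  rewrite -size_cat in s2; have [bs2 sz2 e2] := IHu _ _ _ fs _ (ls ++ l1) _ s2.
  exists (c :: bs1 ++ bs2); first by rewrite /= !size_cat sz1 sz2.
  rewrite /= zip_cat // foldl_cat /select_step /= -/select_step e1 e2.
  by rewrite -!catA.
- move=> /=; case: eqP => t0 sl.
    have [bs sz e] := IH _ _ _ fs _ ls _ sl; exists (true :: bs); rewrite /= ?sz //.
    by rewrite /select_step /= -/select_step t0.
  rewrite -(size_rcons pre b) in sl.
  have [bs sz e] := IH _ _ _ fs _ ls _ sl; exists (true :: bs); rewrite /= ?sz //.
  by rewrite /select_step /= -/select_step; move/eqP/negPf: t0 => ->; rewrite e cat_rcons.
Qed.

Definition select (k : nat) (ls : seq (bool * lexeme)) : sstate :=
  foldl select_step ([:: (true, (true, iota 0 k))], (nseq k true, [::])) ls.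

Definition verify (s : seq (token * bool)) : bool :=
  if parse s is Some p then
    if p.1 is Some _ then false else
    if p.2.1 is k :: ks then
      if ks is _ :: _ then false
      else consistent (select k p.2.2).2.1 (select k p.2.2).2.2
    else false
  else false.

Lemma verifyP (w : seq token) :
  gra_sat w <-> exists2 bs : seq bool, size bs = size w & verify (zip w bs).
Proof.
split.
  move=> [t -> /satisfiable_consistent[ls sl cl]].
  have szP : size (nseq (ar t) true) = ar t by rewrite size_nseq.
  rewrite -{2}szP in sl.
  have [bs sz e] := select_step_Sel [::] [::] sl.
  have [s sE [_ h]] := parses_to_bits sz.
  exists (map snd s); first by rewrite -sE !size_map.
  have -> : zip (encode t) (map snd s) = s by rewrite -sE -/(unzip1 s) zip_unzip.
  by rewrite /verify /parse h /= /select cats0 e.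
move=> [bs sz]; rewrite /verify.
case E: (parse _) => [[[//|] [[|k [|]] ls]]|] //= cl.
have [ts ksE sE] := parse_sound E.
case: ts ksE sE => [|t [|]] // [kE]; rewrite /= cats0 -/(unzip1 _) unzip1_zip ?sz // => wE.
exists t => //; apply/satisfiable_consistent.
have tE : map fst (zip w bs) = encode t by rewrite -/(unzip1 _) unzip1_zip ?sz.
have [bs' [sz' h]] := parses_to_encode tE.
move: E; rewrite /parse h => -[_ lsE].
have [ls' sl e] := select_step_ar true true (iota 0 (ar t)) [::] (nseq (ar t) true) [::] sz'.
exists ls'; first by rewrite size_nseq in sl.
by move: cl; rewrite /select -lsE cats0 kE e.
Qed.

(** * Polynomial time of the verifier *)

Lemma pt_parse_token c : pt (fun v : bool * pstate => parse_token c v.1 v.2).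
Proof.
case: c; rewrite /parse_token /parse_unary /parse_bit; pt_auto.
Qed.

Lemma pt_consistent : pt (fun a : seq bool * seq lit => consistent a.1 a.2).
Proof.
rewrite /consistent /consistent_with /same_symbol /non_unifiable /innermost_exists /maxn.
pt_auto.
Qed.

Lemma pt_rcons A X {cA : Code A} {cX : Code X} (s : A -> seq X) (x : A -> X) :
  pt s -> pt x -> pt (fun a => rcons (s a) (x a)).
Proof.
move=> ps px; apply: (pt_ext (f := fun a => s a ++ [:: x a])).
  by move=> a; rewrite cats1.
by pt_auto.
Qed.

Lemma pt_swap_last A X {cA : Code A} {cX : Code X} (s : A -> seq X) :
  pt s -> pt (fun a => swap_last (s a)).
Proof.
move=> ps.
apply: (pt_ext (f := fun a => if rev (s a) is x :: u then
    if u is y :: v then rev [:: y, x & v] else s a else s a)).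
  by move=> a; rewrite /swap_last; case: (rev (s a)) => [|x [|y v]].
apply: (pt_case_seq (f1 := fun a x u => if u is y :: v then rev [:: y, x & v] else s a)).
- by pt_auto.
- by [].
have ps1 : pt (fun u : A * (X * seq X) => s u.1).
  by apply: (pt_comp (g := fun u => u.1) ps); pt_auto.
by apply: (@pt_case_seq _ X _ _ _ _ (fun u : A * (X * seq X) => u.2.2) (fun u => s u.1)
  (fun u y v => rev [:: y, u.2.1 & v])); pt_auto.
Qed.

Lemma pt_select_lexeme c :
  pt (fun v : (bool * (nat * seq bool)) * (frame * (seq frame * (seq bool * seq lit))) =>
    select_lexeme c v.1 v.2.1 v.2.2.1 v.2.2.2).
Proof.
rewrite /select_lexeme /add_literal; case: c; rewrite /rot; pt_auto;
  repeat first [apply: pt_swap_last | apply: pt_rcons]; pt_auto.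
Qed.

(* For accumulators that duplicate a component, whose size is the potential.  *)
Lemma pt_foldl_potential A Z X {cA : Code A} {cZ : Code Z} {cX : Code X}
    (pot : Z -> nat) (g : A -> Z -> X -> Z) (z : A -> Z) (s : A -> seq X) (B : A -> nat) :
  pt (fun u : A * (Z * X) => g u.1 u.2.1 u.2.2) -> pt z -> pt s ->
  pb (fun a => pot (z a)) -> pb B ->
  (forall a y x, sz x <= sz (s a) -> pot (g a y x) <= pot y + B a) ->
  (forall a y x, sz x <= sz (s a) -> sz (g a y x) <= sz y + 2 * pot y + B a) ->
  pt (fun a => foldl (g a) (z a) (s a)).
Proof.
move=> pg pz ps ppot pB hpot hsz; have sz' := pt_sz pz; have ss := pt_sz ps.
pose (K := fun (a : A) y n => 2 * (pot y + n * B a) + B a).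
apply: (pt_foldl (N := fun a => sz (z a) + sz (s a) * K a (z a) (sz (s a)))) => //.
  by rewrite /K; pb_auto.
move=> a i _; set y := z a.
have : sz (take i (s a)) <= sz (s a).
  elim: (s a) i => [|x u IH] [|i] //=; rewrite ?sz_nil ?sz_cons //.
  by have := IH i; lia.
move: (take i (s a)) => u us.
have step n : size u <= n -> sz (foldl (g a) y u) <= sz y + size u * K a y n.
  elim: u n y us => [|x u IH] n y /=; first by rewrite addn0.
  rewrite sz_cons => us un; case: n un => // n; rewrite ltnS => un.
  have xs : sz x <= sz (s a) by lia.
  have us' : sz u <= sz (s a) by lia.
  apply: leq_trans (IH n _ us' un) _.
  have h1 := hpot a y x xs; have h2 := hsz a y x xs.
  have h3 : size u * K a (g a y x) n <= size u * K a y n.+1.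
    by rewrite leq_mul2l /K mulSn; apply/orP; right; lia.
  have h4 : 2 * pot y + B a <= K a y n.+1 by rewrite /K; lia.
  by rewrite mulSn; lia.
have su : size u <= sz (s a) by apply: leq_trans (ltnW (size_sz u)) us.
apply: leq_trans (step _ su) _.
by rewrite leq_add2l leq_mul2r su orbT.
Qed.

Lemma sz_some X {cX : Code X} (x : X) : sz (Some x) = (sz x).+2.
Proof. exact: (treeszE Leaf (code x)). Qed.

Lemma sz_none X {cX : Code X} : sz (@None X) = 1.
Proof. by []. Qed.

Lemma sz_gt0 X {cX : Code X} (x : X) : 0 < sz x.
Proof. exact: treesz_gt0. Qed.

Lemma sz_take_drop X {cX : Code X} n (s : seq X) :
  sz (take n s) + sz (drop n s) = (sz s).+1.
Proof.
elim: s n => [|x s IH] n //; case: n => [|n]; first by rewrite take0 drop0 add1n.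
by rewrite /= !sz_cons; have := IH n; lia.
Qed.

Lemma sz_rcons X {cX : Code X} (s : seq X) x : sz (rcons s x) = (sz x + sz s).+1.
Proof. by elim: s => [|y s IH]; rewrite ?rcons_cons !sz_cons ?IH; lia. Qed.

Lemma sz_rev X {cX : Code X} (s : seq X) : sz (rev s) = sz s.
Proof. by elim: s => // x s IH; rewrite rev_cons sz_rcons IH sz_cons. Qed.

Lemma sz_swap_last X {cX : Code X} (s : seq X) : sz (swap_last s) = sz s.
Proof.
rewrite /swap_last; case E: (rev s) => [|x [|y u]] //.
by rewrite -(sz_rev s) E sz_rev !sz_cons; lia.
Qed.

Lemma sz_rot X {cX : Code X} n (s : seq X) : sz (rot n s) <= (sz s).+1.
Proof. by rewrite -(sz_take_drop n s) /rot addnC; apply: sz_cat. Qed.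

Definition max_token := \max_(c : token) sz c.

Lemma sz_token (c : token) : sz c <= max_token.
Proof. exact: (leq_bigmax (F := fun c : token => sz c)). Qed.

(** The pending symbol and the arities are the parts of the state that get copied into lexemes. *)
Definition parse_potential (p : option pstate) : nat :=
  if p is Some q then sz q.1 + sz q.2.1 else 0.

Lemma parse_token_sz c b p q : parse_token c b p = Some q ->
  sz q.1 + sz q.2.1 <= sz p.1 + sz p.2.1 + 10 /\
  sz q.2.2 <= sz p.2.2 + sz p.1 + sz p.2.1 + max_token + 20.
Proof.
have tok d := sz_token d; have bool_sz := sz_bool b.
case: p => [o [ks ls]] /=.
have unary d : parse_unary d b (o, (ks, ls)) = Some q ->
  sz q.1 + sz q.2.1 <= sz o + sz ks + 10 /\
  sz q.2.2 <= sz ls + sz o + sz ks + max_token + 20.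
  rewrite /parse_unary /=; case: o => //; case: ks => // k ks [<-] /=.
  by rewrite !sz_cons !sz_pair /= !sz_nat sz_nil; have := tok d; split; lia.
have bit x : parse_bit x (o, (ks, ls)) = Some q ->
  sz q.1 + sz q.2.1 <= sz o + sz ks + 10 /\
  sz q.2.2 <= sz ls + sz o + sz ks + max_token + 20.
  rewrite /parse_bit /= {unary}; case: o => // -[[|k] w] //= [<-] /=.
  by rewrite !sz_some !sz_pair /= !sz_cons !sz_nat; have := sz_bool x; split; lia.
case: c; rewrite /parse_token; try exact: unary; try exact: bit.
- clear unary bit; case: o => // -[k w] [<-] /=.
  by rewrite !sz_cons !sz_some !sz_pair /= sz_none; have := tok tRel; split; lia.
- clear unary bit; case: o => // -[k w] [<-] /=.
  by rewrite !sz_some !sz_pair /= !sz_nat; split; lia.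
- clear unary bit; case: o => // -[<-] /=.
  by rewrite !sz_some !sz_pair /= !sz_nat sz_nil; split; lia.
- clear unary bit; case: o => // -[<-] /=.
  by rewrite !sz_cons !sz_pair /= !sz_nat sz_nil; have := tok tEqu; split; lia.
- clear unary bit; case: o => //; case: ks => [|k [|l ks]] // [<-] /=.
  by rewrite !sz_cons !sz_pair /= !sz_nat sz_nil; have := tok tJoin; split; lia.
- clear unary bit; case: o => //; case: ks => [|k ks] // [<-] /=.
  by rewrite !sz_cons !sz_pair /= !sz_nat sz_nil; have := tok tEx; split; lia.
Qed.

Lemma pt_parse A {cA : Code A} (s : A -> seq (token * bool)) :
  pt s -> pt (fun a => parse (s a)).
Proof.
move=> ps; have prs := pt_rev ps.
apply: (pt_ext (f := fun a => foldl (fun p cb => parse_step cb p)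
   (Some (None, ([::], [::]))) (rev (s a)))).
  by move=> a; rewrite foldl_rev.
apply: (pt_foldl_potential (pot := parse_potential) (B := fun _ => max_token + 40)) => //.
- rewrite /parse_step; apply: pt_case_option; [by pt_auto | by pt_auto |].
  apply: (pt_fin (F := fun c (u : A * (option pstate * (token * bool)) * pstate) =>
    parse_token c u.1.2.2.2 u.2)
    (x := fun u : A * (option pstate * (token * bool)) * pstate => u.1.2.2.1));
    last by pt_auto.
  move=> c; apply: (pt_comp (g := fun u : A * (option pstate * (token * bool)) * pstate =>
    (u.1.2.2.2, u.2)) (pt_parse_token c)).
  by pt_auto.
- by pt_auto.
- by pb_auto.
- by pb_auto.
- move=> a [p|] [c b] _ //; rewrite /parse_step /=.
  case E: (parse_token c b p) => [q|] //=.
  by have [h _] := parse_token_sz E; lia.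
move=> a [p|] [c b] _; rewrite /parse_step /=; last by lia.
case E: (parse_token c b p) => [q|]; last by rewrite sz_none sz_some; lia.
have [h1 h2] := parse_token_sz E; move: h1 h2.
by case: q {E} => [? [? ?]]; case: p => [? [? ?]] /=; rewrite !sz_some !sz_pair /=; lia.
Qed.

(** The potential is the size of the prefix. A [Join] divides the indices of a frame between two
    frames instead of duplicating them, and an [Ex] adds the length of the prefix in unary, which is
    bounded by the potential. *)
Lemma select_lexeme_sz c x f fs v :
  sz (select_lexeme c x f fs v).2.1 <= sz v.1 + 10 /\
  sz (select_lexeme c x f fs v) <= sz fs + sz f + sz v + 2 * sz v.1 + sz x + 50.
Proof.
case: x => b [k w]; case: f => p [l e]; case: v => P ls.
have [[sb sp] sl] := (sz_bool b, sz_bool p, sz_bool l).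
pose proof (sz_gt0 b) as sb0; pose proof (sz_gt0 p) as sp0; pose proof (sz_gt0 l) as sl0.
have lit_sz r : sz r <= sz (k, w) + 2 ->
  sz (add_literal r (p, (l, e)) fs (P, ls)).2.1 <= sz P + 10 /\
  sz (add_literal r (p, (l, e)) fs (P, ls)) <=
    sz fs + sz (p, (l, e)) + sz (P, ls) + 2 * sz P + sz (b, (k, w)) + 50.
  move=> hr; rewrite /add_literal /=; case: (l); rewrite !sz_pair /= in hr *; last by lia.
  pose proof (sz_cat ls [:: (p, (r, e))]) as h; rewrite sz_cons !sz_pair /= sz_nil in h.
  by lia.
case: c => /=; try by rewrite !sz_pair /= !sz_cons !sz_pair /=; lia.
- by apply: lit_sz; rewrite sz_some addn2.
- by apply: lit_sz; rewrite sz_none; lia.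
- pose proof (sz_rot 1 e) as h; rewrite !sz_pair /= !sz_cons !sz_pair /=; lia.
- by rewrite !sz_pair /= !sz_cons !sz_pair /= sz_swap_last; lia.
- by have := sz_bool (~~ p); rewrite !sz_pair /= !sz_cons !sz_pair /=; lia.
- pose proof (sz_take_drop k e) as h; have h1 := sz_bool (l && (p || b)).
  have h2 := sz_bool (l && (p || ~~ b)).
  by rewrite !sz_pair /= !sz_cons !sz_pair /=; lia.
- case: eqP => _; first by rewrite !sz_pair /= !sz_cons !sz_pair /=; lia.
  pose proof (size_sz P) as h; rewrite !sz_pair /= !sz_cons !sz_pair /= !sz_rcons sz_nat; lia.
Qed.

Lemma pt_select A {cA : Code A} (k : A -> nat) (ls : A -> seq (bool * lexeme)) :
  pt k -> pt ls -> pt (fun a => select (k a) (ls a)).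
Proof.
move=> pk pls; have pi : pt (fun a => nseq (k a) true) by pt_auto.
have sk := pt_sz pi; have sls := pt_sz pls.
apply: (pt_foldl_potential (pot := fun st => sz st.2.1) (g := fun _ => select_step)
  (B := fun a => sz (ls a) + 60)) => //.
- rewrite /select_step; apply: pt_case_seq; [by pt_auto | by pt_auto |].
  set U := (A * (sstate * (bool * lexeme)) * (frame * seq frame))%type.
  apply: (pt_fin (F := fun c (u : U) =>
    select_lexeme c (u.1.2.2.1, u.1.2.2.2.2) u.2.1 u.2.2 u.1.2.1.2)
    (x := fun u : U => u.1.2.2.2.1)); last by pt_auto.
  move=> c; apply: (pt_comp (g := fun u : U =>
    ((u.1.2.2.1, u.1.2.2.2.2), (u.2.1, (u.2.2, u.1.2.1.2)))) (pt_select_lexeme c)).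
  by pt_auto.
- by pt_auto.
- by pb_auto.
- move=> a [[|f fs] v] [b [c x]] /=; rewrite /select_step /=; first by lia.
  by have [h _] := select_lexeme_sz c (b, x) f fs v; lia.
move=> a [[|f fs] v] [b [c x]] xs; rewrite /select_step /=; first by lia.
have [_ h] := select_lexeme_sz c (b, x) f fs v; apply: leq_trans h _.
rewrite (sz_pair (f :: fs, v)) sz_cons (sz_pair (b, x)) /=.
by move: xs; rewrite (sz_pair (b, (c, x))) (sz_pair (c, x)) /=; lia.
Qed.

Lemma pt_verify : pt verify.
Proof.
rewrite /verify; apply: pt_case_option; [by apply: pt_parse; pt_auto | by pt_auto |].
apply: pt_case_option; [by pt_auto | | by pt_auto].
apply: pt_case_seq; [by pt_auto | by pt_auto |].
apply: pt_case_seq; [by pt_auto | | by pt_auto].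
set U := (seq (token * bool) * pstate * (nat * seq nat))%type.
have ps : pt (fun u : U => select u.2.1 u.1.2.2.2) by apply: pt_select; pt_auto.
by apply: (pt_comp (g := fun u : U => ((select u.2.1 u.1.2.2.2).2.1,
  (select u.2.1 u.1.2.2.2).2.2)) pt_consistent); pt_auto.
Qed.

Theorem corollary5p9 : NP_complete gra_sat.
Proof.
split; first exact: in_NP_of_pt pt_verify verifyP.
exact: NP_reduces_to_gra_sat.
Qed.
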